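(* Let $\lambda=(\lambda_1,\dots,\lambda_d)=\{1^{m_1},\dots,p^{m_p}\}$ be a partition of $n$. The conormal variety ${\rm Con}_\lambda$ is the set of pairs $(f,g)\in\mathbb{P}^n\times\mathbb{P}^n$ of the form $$ f(x,y)=\prod_{i=1}^d (t_i x-s_i y)^{\lambda_i}\qquad\text{and}\qquad g(u,v)=\sum_{1\le i\le d,\ \lambda_i\neq 1}(s_iu+t_iv)^{n-\lambda_i+2}\cdot g_i(u,v),$$ where $(s_i:t_i)$ runs over $\mathbb{P}^1$ and $g_i$ runs over binary forms of degree $\lambda_i-2$. This parametrization is a finite-to-one map $$(\mathbb{P}^1)^{m_1}\times\mathcal{J}_\lambda\dashrightarrow{\rm Con}_\lambda\subset\mathbb{P}^n\times\mathbb{P}^n$$ whose degree is $m_1!\,m_2!\cdots m_p!$.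
   Context: $K$ is a field of characteristic zero. $V=K[x,y]_n$ is the space of binary forms of degree $n$ and $V^\vee=K[u,v]_n$ its dual vector space, with pairing $\langle f,g\rangle=\frac1{n!}\,g(\frac{\partial}{\partial x},\frac{\partial}{\partial y})f(x,y)$. Both $\mathbb{P}(V)$ and $\mathbb{P}(V^\vee)$ are identified with $\mathbb{P}^n$. A partition $\lambda$ of $n$ is written as a list $\lambda_1\ge\dots\ge\lambda_d\ge1$ with sum $n$, or as a multiset $\{1^{m_1},\dots,p^{m_p}\}$, where $m_j=\#\{i:\lambda_i=j\}$, $d$ is the number of parts and $p$ is the largest part. The multiple root locus $\Delta_\lambda\subset\mathbb{P}(V)$ is the image of $(\mathbb{P}^1)^d\to\mathbb{P}^n$, $(\ell_1,\dots,\ell_d)\mapsto\ell_1^{\lambda_1}\cdots\ell_d^{\lambda_d}$, where the $\ell_i$ are linear forms; it has dimension $d$. The conormal variety ${\rm Con}_\lambda$ is the Zariski closure in $\mathbb{P}(V)\times\mathbb{P}(V^\vee)=\mathbb{P}^n\times\mathbb{P}^n$ of the set $\{(f,g): f\text{ is a smooth point of }\Delta_\lambda\text{ and } g\perp T_f\Delta_\lambda\}$, where $T_f\Delta_\lambda$ is the tangent space of $\Delta_\lambda$ at $f$ and $\perp$ refers to the pairing above. The parameter space is $\mathcal{J}_\lambda={\rm Join}(\mathbb{P}^1\times\mathbb{P}^{\lambda_1-2},\dots,\mathbb{P}^1\times\mathbb{P}^{\lambda_d-2})$, the free join (abstract join) of the $d-m_1$ varieties in the argument; the $j$-th argument is empty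 and gets deleted when $\lambda_j=1$. It is the projective toric variety whose polytope is the free join of the products of simplices $\sigma_1\times\sigma_{\lambda_j-2}$ (over $j$ with $\lambda_j\ge2$), and its dimension is $n-m_1-1$. The dashed arrow denotes a rational map. The factor $(\mathbb{P}^1)^{m_1}$ records the points $(s_i:t_i)$ for the indices $i$ with $\lambda_i=1$, and the points $(s_i:t_i)$ and forms $g_i$ with $\lambda_i\ge2$ give the point of $\mathcal{J}_\lambda$.
   Formalization: ''Con is the set of pairs of the form'' is proved as ''Con is the Zariski closure of the set of such pairs''; literal equality fails, e.g. for (2,2), where (l^4, L^3 M) is in Con but not of the form. ''Finite-to-one of degree N'' means that fibres over a dense open subset of Con have N points. *)

(* Defs.v *)
From HB Require Import structures.
From mathcomp Require Import all_boot all_order all_algebra.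
From mathcomp Require Import mpoly.

Set Implicit Arguments.
Unset Strict Implicit.
Unset Printing Implicit Defensive.

Import GRing.Theory.
Local Open Scope ring_scope.

(* Varieties are defined over a field K, by polynomials with coefficients in K
   (pushed forward along iota : K -> L), and are described by their sets of
   L-points, where L is an arbitrary algebraically closed extension of K.
   A point of a projective space is represented by a nonzero vector, two vectors
   giving the same point iff they are related by projeq. *)

Definition is_partition (n : nat) (lam : seq nat) : bool :=
  [&& sorted geq lam, all (leq 1) lam & sumn lam == n].

Notation part lam i := (nth 0%N lam i).

Definition projeq (R : fieldType) (M : lmodType R) (v w : M) : Prop :=
  exists2 c : R, c != 0 & v = c *: w.

(* K[x,y]_n as well as K[u,v]_n; the variables 'X_ord0 and 'X_ord_max are
   x, y in the former case and u, v in the latter. *)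
Notation binform L n := (dhomog 2 L n).

(* The i-th coordinate of a form is the coefficient of x^(n-i) y^i. *)
Definition form_coord (L : fieldType) (n : nat) (f : binform L n)
    (i : 'I_n.+1) : L :=
  (val f)@_(U_(ord0) *+ (n - i) + U_(ord_max) *+ i)%MM.

Definition pairing (L : fieldType) (n : nat) (f g : binform L n) : L :=
  (n`!%:R)^-1 *
  (\sum_(m <- msupp (val g)) (val g)@_m *: mderivm m (val f))@_0%MM.

Section Varieties.

Variables (K : fieldType) (L : closedFieldType) (iota : {rmorphism K -> L}).
Variable n : nat.

Implicit Types (X : binform L n -> Prop)
  (W Z : binform L n -> binform L n -> Prop).

Definition evalP (F : {mpoly K[n.+1]}) (f : binform L n) : L :=
  (map_mpoly iota F).@[form_coord f].

Definition in_ideal X (F : {mpoly K[n.+1]}) : Prop :=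
  (exists e, F \is e.-homog) /\ (forall f, X f -> evalP F f = 0).

(* h belongs to the linear subspace of V whose projectivization is the
   (embedded) tangent space at f of the variety with ideal in_ideal X. *)
Definition tangent X (f h : binform L n) : Prop :=
  forall F, in_ideal X F ->
    \sum_(i < n.+1) evalP F^`M(i) f * form_coord h i = 0.

Definition independent_on X (J : {set 'I_n.+1}) : Prop :=
  forall F : {mpoly K[n.+1]}, in_ideal X F ->
    (forall m, m \in msupp F -> forall i, i \notin J -> m i = 0%N) -> F = 0.

(* The dimension of a projective set is one less than the largest number of
   coordinates that are algebraically independent on it. *)
Definition has_proj_dim X (k : nat) : Prop :=
  (exists2 J, independent_on X J & #|J| = k.+1) /\
  (forall J, independent_on X J -> (#|J| <= k.+1)%N).

Definition smooth_point X (f : binform L n) : Prop :=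
  X f /\
  exists k, has_proj_dim X k /\
    exists T : {vspace binform L n},
      (forall h, h \in T <-> tangent X f h) /\ \dim T = k.+1.

Definition bihomogeneous (F : {mpoly K[n.+1 + n.+1]}) : Prop :=
  exists a b : nat, forall m, m \in msupp F ->
    \sum_(i < n.+1) m (lshift n.+1 i) = a /\
    \sum_(i < n.+1) m (rshift n.+1 i) = b.

Definition evalPP (F : {mpoly K[n.+1 + n.+1]}) (f g : binform L n) : L :=
  (map_mpoly iota F).@[fun i => match split i with
                                | inl j => form_coord f j
                                | inr j => form_coord g j
                                end].

Definition zclosure W (f g : binform L n) : Prop :=
  [/\ f != 0, g != 0 &
      forall F, bihomogeneous F ->
        (forall f' g', W f' g' -> evalPP F f' g' = 0) -> evalPP F f g = 0].

Definition zclosed W : Prop := forall f g, zclosure W f g -> W f g.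

Definition dense_open_in W U : Prop :=
  (exists2 Z, zclosed Z & forall f g, U f g <-> W f g /\ ~ Z f g) /\
  (forall f g, W f g -> zclosure U f g).

Variable lam : seq nat.

Local Notation d := (size lam).
Local Notation unit_parts := {i : 'I_d | part lam i == 1%N}.
Local Notation big_parts := {j : 'I_d | (2 <= part lam j)%N}.

Definition f_param (p : 'I_d -> L^o * L^o) : {mpoly L[2]} :=
  \prod_(i < d) ((p i).2 *: 'X_ord0 - (p i).1 *: 'X_ord_max) ^+ part lam i.

Definition g_param (p : 'I_d -> L^o * L^o)
    (h : forall i : 'I_d, binform L (part lam i - 2)) : {mpoly L[2]} :=
  \sum_(i < d | part lam i != 1%N)
    ((p i).1 *: 'X_ord0 + (p i).2 *: 'X_ord_max) ^+ (n - part lam i + 2)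
    * val (h i).

Definition Delta (f : binform L n) : Prop :=
  exists p : 'I_d -> L^o * L^o,
    (forall i, p i != 0) /\ projeq (val f) (f_param p).

Definition conormal_pair (f g : binform L n) : Prop :=
  [/\ smooth_point Delta f, g != 0 &
      forall h, tangent Delta f h -> pairing h g = 0].

Definition Con (f g : binform L n) : Prop := zclosure conormal_pair f g.

Definition param_pair (f g : binform L n) : Prop :=
  f != 0 /\ g != 0 /\
  exists (p : 'I_d -> L^o * L^o) (h : forall i, binform L (part lam i - 2)),
    [/\ forall i, p i != 0,
        projeq (val f) (f_param p) & projeq (val g) (g_param p h)].

(* Homogeneous coordinates on the ambient space of (P^1)^(m_1) x J_lambda.
   The j-th join factor P^1 x P^(lam_j - 2) sits by its Segre embedding in the
   projectivization of L^2 (x) L[u,v]_(lam_j - 2), i.e., of pairs of forms: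
   ((s : t), h) is the point (s h, t h).  In the free join the various factors
   lie in independent linear spaces, so a point of the join is a nonzero tuple
   of vectors in the Segre cones, up to one common scalar. *)
Record join_vector := JoinVector {
  lin_part : unit_parts -> L^o * L^o;
  join_part : forall j : big_parts,
    binform L (part lam (val j) - 2) * binform L (part lam (val j) - 2)
}.

Definition in_source (x : join_vector) : Prop :=
  [/\ forall i : unit_parts, lin_part x i != 0,
      forall j : big_parts,
        exists (a : L^o * L^o) (h : binform L (part lam (val j) - 2)),
        join_part x j = (a.1 *: h, a.2 *: h) &
      exists j : big_parts, join_part x j != 0].

Definition source_eq (x y : join_vector) : Prop :=
  (forall i : unit_parts, projeq (lin_part x i) (lin_part y i)) /\
  (exists2 c : L, c != 0 &
     forall j : big_parts, join_part x j = c *: join_part y j).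

(* The form (s u + t v)^(n - lam_j + 2) h is not determined by the Segre vector
   (s h, t h) alone: one has to choose a representative of (s : t).  We take
   t = 1; another rational choice changes the map by a birational automorphism
   of the join. *)
Definition param_map (x : join_vector) (f g : binform L n) : Prop :=
  f != 0 /\ g != 0 /\
  exists (p : 'I_d -> L^o * L^o) (h : forall i, binform L (part lam i - 2)),
    [/\ forall i : unit_parts, lin_part x i = p (val i),
        forall j : big_parts, [/\ (p (val j)).2 = 1, h (val j) != 0 &
          join_part x j =
            ((p (val j)).1 *: h (val j), (p (val j)).2 *: h (val j))],
        projeq (val f) (f_param p) & projeq (val g) (g_param p h)].

Local Notation source_index :=
  (unit_parts * bool + big_parts * bool * 'I_n.+1)%type.

(* For a join factor and k > lam_j - 2 the coordinate is 0. *)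
Definition source_coord (x : join_vector) (k : 'I_#|{: source_index}|) : L :=
  match enum_val k with
  | inl (i, b) => if b then (lin_part x i).2 else (lin_part x i).1
  | inr (j, b, k) =>
      let h := if b then (join_part x j).2 else (join_part x j).1 in
      if (k <= part lam (val j) - 2)%N then form_coord h (inord k) else 0
  end.

(* Since D is a union of classes for source_eq and L is infinite, it makes no
   difference whether F is required to be multihomogeneous. *)
Definition dense_in_source (D : join_vector -> Prop) : Prop :=
  forall F : {mpoly K[#|{: source_index}|]},
    (forall x, in_source x -> D x -> (map_mpoly iota F).@[source_coord x] = 0) ->
    forall x, in_source x -> (map_mpoly iota F).@[source_coord x] = 0.

Definition rational_map_to
    (phi : join_vector -> binform L n -> binform L n -> Prop)
    W : Prop :=
  [/\ dense_in_source (fun x => exists f g, phi x f g),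
      (forall x y f g, in_source x -> in_source y -> source_eq x y ->
         phi x f g ->
         forall f' g', phi y f' g' <-> projeq f' f /\ projeq g' g) &
      forall x f g, in_source x -> phi x f g -> W f g].

Definition fibre_card (phi : join_vector -> binform L n -> binform L n -> Prop)
    (f g : binform L n) (N : nat) : Prop :=
  exists xs : 'I_N -> join_vector,
    [/\ forall k, in_source (xs k) /\ phi (xs k) f g,
        forall k l, source_eq (xs k) (xs l) -> k = l &
        forall x, in_source x -> phi x f g -> exists k, source_eq x (xs k)].

(* In characteristic zero, the degree is the cardinality of a general fibre. *)
Definition finite_of_degree
    (phi : join_vector -> binform L n -> binform L n -> Prop)
    W (N : nat) : Prop :=
  exists2 U, dense_open_in W U & forall f g, U f g -> fibre_card phi f g N.

End Varieties.

(* Main.v *)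
Require Import Defs.
From HB Require Import structures.
From mathcomp Require Import all_boot all_order all_algebra all_fingroup.
From mathcomp Require Import ssrcomplements mpoly ring zify.
From Stdlib Require Import Classical.

(** The proof is coordinate computation with polynomials in one variable, organized around
    apolarity. Setting (x, y) = (X, 1) turns f into a multiple of prod (X - r_i)^lambda_i,
    turns g into sum (r_i X + 1)^(n - lambda_i + 2) h_i, and turns the pairing into sum
    p_k q_k / C(n, k).

    Apolarity. Pairing q with (1 + r X)^(n - j) X^j returns the j-th Taylor coefficient of
    q at r, up to the factor C(n, j) (pair_hermite_basis). For distinct roots, g is
    therefore a linear functional that reads, at each r_i, the Taylor coefficients of
    order at most lambda_i - 2; these functionals are exactly those that annihilate the
    multiples of prod (X - r_i)^(lambda_i - 1) (pair_g_poly_eq0, annihilator_is_g_poly),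
    and g determines the h_i (g_poly_inj). On the other hand, moving one root or rescaling
    shows that the tangent directions at f contain the multiples of the same polynomial by
    polynomials of degree at most d (deriv_along_reduced), and a dimension count shows
    that at a general f there is nothing else (tangent_is_reduced). Hence the conormal
    vectors at a general f are the forms g of the parametrization.

    Dimension. The first d + 1 coordinates are algebraically independent on Delta
    (top_coords_independent): a nonzero relation of least degree would have all its
    partial derivatives vanish on Delta. Any d + 2 coordinates are dependent, by counting
    monomials (algebraic_dependence). A relation of least degree between the first d + 1
    coordinates and one more has a nonzero partial derivative with respect to the latter;
    this gives the equations of the tangent space at a general point, and so its
    smoothness (smooth_generic).

    Closures. Irreducibility is replaced by restriction to lines: the parameters (s_i,
    t_i, h_i) form a vector space on which everything in sight is polynomial along lines,
    so an equation that holds where some nonzero such function does not vanish holds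
    everywhere (regular_dense). This gives that pairs of the parametrization lie in Con
    (param_closure_in_Con). Conversely, if g annihilates the tangent space at f, then g is
    a combination of gradients at f of equations of Delta; the same combination of
    gradients at any form f' with distinct roots annihilates the tangent directions there,
    so it is a g of the parametrization (Con_in_param_closure).

    Degree. For a pair (f, g) with leading coefficient of f nonzero, with distinct roots,
    and with every h_i nonzero, a preimage amounts to an ordering of the roots compatible
    with the multiplicities, so the fibre is a torsor under the permutations of the d
    indices that preserve lambda (fibre_stabilizer); there are m_1! ... m_p! of them
    (card_part_stabilizer). It remains that such pairs contain a dense open part of Con. A
    condition that some ordering of the roots satisfies given polynomial equations is
    closed where the leading coefficient is nonzero, because a product over all
    permutations of the roots is symmetric, hence polynomial in the coefficients of f
    (norm_separates). This is applied twice: the equations saying that g annihilates the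
    tangent directions, which hold on the parametrization, persist on its closure
    (closure_root_conditions), and the pairs to be removed form a closed set
    (degenerate_pair_closed). *)

Set Implicit Arguments.
Unset Strict Implicit.
Unset Printing Implicit Defensive.

Import GRing.Theory.
Local Open Scope ring_scope.

(** * Binary forms as polynomials in one variable *)

Section Dehomogenization.

Variable L : fieldType.
Implicit Types (P Q : {mpoly L[2]}) (p q : {poly L}).

Definition dehom : {mpoly L[2]} -> {poly L} :=
  mmap (@polyC L) (fun i : 'I_2 => if i == ord0 then 'X else 1).

HB.instance Definition _ := GRing.RMorphism.copy dehom
  (mmap (@polyC L) (fun i : 'I_2 => if i == ord0 then 'X else 1)).

Lemma dehomZ c P : dehom (c *: P) = c *: dehom P.
Proof. by rewrite /dehom mmapZ /= mul_polyC. Qed.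

Lemma dehom_X0 : dehom 'X_ord0 = 'X.
Proof. by rewrite /dehom mmapX mmap1U eqxx. Qed.

Lemma dehom_X1 : dehom 'X_ord_max = 1.
Proof. by rewrite /dehom mmapX mmap1U. Qed.

(** The exponent of x^k y^(n - k); it has degree n only when k is at most n. *)
Definition mono2 (n k : nat) : 'X_{1..2} := (U_(ord0) *+ k + U_(ord_max) *+ (n - k))%MM.

Lemma mono2E0 n k : mono2 n k ord0 = k.
Proof. by rewrite mnmDE !mulmnE !mnm1E /=; lia. Qed.

Lemma mono2E1 n k : mono2 n k ord_max = (n - k)%N.
Proof. by rewrite mnmDE !mulmnE !mnm1E /=; lia. Qed.

Lemma mdeg2 (m : 'X_{1..2}) : mdeg m = (m ord0 + m ord_max)%N.
Proof. by rewrite mdegE big_ord_recl big_ord1; congr (_ + m _)%N; apply: val_inj. Qed.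

Lemma mdeg_mono2 n k : (k <= n)%N -> mdeg (mono2 n k) = n.
Proof. by move=> kn; rewrite /= mdeg2 mono2E0 mono2E1; lia. Qed.

Lemma mono2_eq n k (m : 'X_{1..2}) : mdeg m = n -> (m == mono2 n k) = (m ord0 == k).
Proof.
move=> mn; apply/eqP/eqP => [->|mk]; first exact: mono2E0.
apply/mnmP => i; case: (unliftP ord0 i) => [j ->|->]; last by rewrite mono2E0.
have -> : lift ord0 j = ord_max by apply: val_inj; rewrite /= (ord1 j).
by rewrite mono2E1 -mk -mn mdeg2; lia.
Qed.

Lemma dehomX m : dehom 'X_[m] = 'X^(m ord0).
Proof.
rewrite /dehom mmapX /mmap1 big_ord_recl big_ord1 eqxx /=.
by rewrite expr1n mulr1.
Qed.

Lemma coef_dehom n P k : P \is n.-homog -> (dehom P)`_k = P@_(mono2 n k).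
Proof.
move=> /dhomogP hP.
rewrite {1 2}[P]mpolyE !raddf_sum coef_sum /= !big_seq; apply: eq_bigr => m mP.
rewrite dehomZ dehomX coefZ coefXn mcoeffZ mcoeffX eq_sym mono2_eq //; exact: hP.
Qed.

Lemma size_dehom n P : P \is n.-homog -> (size (dehom P) <= n.+1)%N.
Proof.
move=> hP; apply/leq_sizeP => k kn; rewrite (coef_dehom _ hP).
by apply: (dhomog_nemf_coeff hP); rewrite /= mdeg2 mono2E0 mono2E1; lia.
Qed.

Lemma dehom_inj n P Q : P \is n.-homog -> Q \is n.-homog -> dehom P = dehom Q -> P = Q.
Proof.
move=> hP hQ e; apply/mpolyP => m.
have [mn|mn] := eqVneq (mdeg m) n; last by rewrite !(dhomog_nemf_coeff _ mn).
have -> : m = mono2 n (m ord0) by apply/eqP; rewrite mono2_eq.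
by rewrite -!coef_dehom // e.
Qed.

(** The truncation to degree n makes this total, so that form_of can be applied without
    a size proof. *)
Definition homogenize n p : {mpoly L[2]} := \sum_(k < n.+1) p`_k *: 'X_[mono2 n k].

Lemma homogenize_homog n p : homogenize n p \is n.-homog.
Proof.
apply: rpred_sum => k _; apply: rpredZ; rewrite dhomogX /=.
by rewrite mdeg_mono2 // -ltnS.
Qed.

Lemma dehom_homogenize n p : dehom (homogenize n p) = take_poly n.+1 p.
Proof.
rewrite raddf_sum /take_poly poly_def /=; apply: eq_bigr => k _.
by rewrite dehomZ dehomX mono2E0.
Qed.

Definition form_of n p : binform L n := DHomog (homogenize_homog n p).

Lemma dehom_form_of n p : (size p <= n.+1)%N -> dehom (val (form_of n p)) = p.
Proof. by move=> sp; rewrite dehom_homogenize take_poly_id. Qed.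

Lemma form_coordE n (f : binform L n) (i : 'I_n.+1) :
  form_coord f i = (dehom (val f))`_(n - i).
Proof.
rewrite /form_coord (@coef_dehom n) //; last exact: dhomog_is_dhomog.
rewrite /mono2; congr (_@_(_ + _ *+ _)%MM).
by have := ltn_ord i; lia.
Qed.

Lemma dehom_form_inj n (f g : binform L n) : dehom (val f) = dehom (val g) -> f = g.
Proof.
by move=> e; apply/val_inj/(@dehom_inj n) => //; exact: dhomog_is_dhomog.
Qed.

Lemma dehom_eq0 n (f : binform L n) : (dehom (val f) == 0) = (f == 0).
Proof.
apply/eqP/eqP => [e|->]; last by rewrite raddf0.
by apply: dehom_form_inj; rewrite e raddf0.
Qed.

(** The apolarity pairing in one variable: with the numbering of pairingE, x^k y^(n - k)
    is dual to C(n, k) u^k v^(n - k). *)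
Definition pair n p q : L := \sum_(k < n.+1) p`_k * q`_k / 'C(n, k)%:R.

Hypothesis charL : [pchar L] =i pred0.

Lemma natr_neq0 k : (0 < k)%N -> k%:R != 0 :> L.
Proof. by move=> k0; have /pcharf0P -> := charL; rewrite -lt0n. Qed.

(** Applying a monomial differential operator to a form of the same degree leaves k! (n
    - k)! times the matching coefficient, and k! (n - k)! / n! is 1 / C(n, k). *)
Lemma pairingE n (f g : binform L n) :
  pairing f g = pair n (dehom (val f)) (dehom (val g)).
Proof.
have hf := dhomog_is_dhomog f; have hg := dhomog_is_dhomog g.
have e : \sum_(m <- msupp (val g)) (val g)@_m *: mderivm m (val f)
       = \sum_(k < n.+1) (val g)@_(mono2 n k) *: mderivm (mono2 n k) (val f).
  have e0 : val g = \sum_(k < n.+1) (val g)@_(mono2 n k) *: 'X_[mono2 n k].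
    apply: (@dehom_inj n) => //.
      apply: rpred_sum => k _; apply: rpredZ; rewrite dhomogX /=.
      by rewrite mdeg_mono2 // -ltnS.
    apply/polyP => k; rewrite (coef_dehom _ hg) raddf_sum coef_sum /=.
    under eq_bigr do rewrite dehomZ dehomX mono2E0 coefZ coefXn.
    case: (ltnP k n.+1) => kn; last first.
      rewrite big1 => [|i _].
        by apply: (dhomog_nemf_coeff hg); rewrite /= mdeg2 mono2E0 mono2E1; lia.
      by rewrite (_ : (k == i) = false) ?mulr0 //; have := ltn_ord i; lia.
    rewrite (bigD1 (Ordinal kn)) //= eqxx mulr1 big1 ?addr0 // => i ne.
    by rewrite (_ : (k == i) = false) ?mulr0 //; apply/negbTE; rewrite eq_sym.
  pose D (p : {mpoly L[2]}) := \sum_(m <- msupp p) p@_m *: mderivm m (val f).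
  have DE (p : {mpoly L[2]}) b : (msize p <= b)%N ->
      D p = \sum_(m : 'X_{1..2 < b}) p@_m *: mderivm m (val f).
    move=> pb; rewrite /D (big_mksub 'X_{1..2 < b}) ?msupp_uniq //=; last first.
      by move=> x /msize_mdeg_lt => h; exact: leq_trans h pb.
    rewrite big_rmcond //= => m /memN_msupp_eq0 ->.
    by rewrite scale0r.
  have Dadd a (p : {mpoly L[2]}) : D (a *: p) = a *: D p.
    rewrite (DE _ (msize p)) ?msizeZ_le // (DE p (msize p)) // scaler_sumr.
    by apply: eq_bigr => m _; rewrite mcoeffZ scalerA.
  have DD (p q : {mpoly L[2]}) : D (p + q) = D p + D q.
    pose b := maxn (msize (p + q)) (maxn (msize p) (msize q)).
    rewrite !(DE _ b); first last.
    - by rewrite /b; lia.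
    - by rewrite /b; lia.
    - by rewrite /b; lia.
    by rewrite -big_split; apply: eq_bigr => m _; rewrite mcoeffD scalerDl.
  have D0 : D 0 = 0 by rewrite /D msupp0 big_nil.
  rewrite -/(D _) {1}e0 (big_morph D DD D0); apply: eq_bigr => k _.
  by rewrite Dadd /D msuppX big_seq1 mcoeffX eqxx scale1r.
rewrite /pairing e /pair raddf_sum /= mulr_sumr; apply: eq_bigr => k _.
have kn : (k <= n)%N by rewrite -ltnS.
rewrite mcoeffZ mcoeff_mderivm addm0 big_ord_recl big_ord1.
rewrite (_ : lift _ _ = ord_max) ?mono2E0 ?mono2E1; last exact: val_inj.
rewrite !ffactnn -[_ *+ _]mulr_natr (coef_dehom _ hf).
rewrite (_ : (dehom (val g))`_k = (val g)@_(mono2 n k)); last exact: coef_dehom.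
rewrite -(bin_fact kn) !natrM.
have := natr_neq0 (fact_gt0 k); have := natr_neq0 (fact_gt0 (n - k)).
have : 'C(n, k)%:R != 0 :> L by apply: natr_neq0; rewrite bin_gt0.
by move=> h1 h2 h3; field; rewrite h1 h2 h3.
Qed.

End Dehomogenization.

(** * The parametrized forms in one variable *)

Section Parametrization.

Variables (L : closedFieldType) (n : nat) (lam : seq nat).
Hypothesis lamP : is_partition n lam.
Local Notation d := (size lam).

Lemma part_gt0 (i : 'I_d) : (0 < part lam i)%N.
Proof. by case/and3P: lamP => _ /allP h _; apply: h; rewrite mem_nth. Qed.

Lemma sum_part : (\sum_(i < d) part lam i = n)%N.
Proof. by case/and3P: lamP => _ _ /eqP <-; rewrite sumnE (big_nth 0%N) big_mkord. Qed.

Lemma part_le (i : 'I_d) : (part lam i <= n)%N.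
Proof. by rewrite -sum_part (bigD1 i) //= leq_addr. Qed.

Lemma part_ge2 (i : 'I_d) : (part lam i != 1%N) = (2 <= part lam i)%N.
Proof. by have := part_gt0 i; lia. Qed.

Definition f_poly (s t : 'I_d -> L) : {poly L} :=
  \prod_(i < d) (t i *: 'X - (s i)%:P) ^+ part lam i.

Definition g_poly (s t : 'I_d -> L) (h : 'I_d -> {poly L}) : {poly L} :=
  \sum_(i < d | part lam i != 1%N) (s i *: 'X + (t i)%:P) ^+ (n - part lam i + 2) * h i.

Lemma dehom_f_param (p : 'I_d -> L^o * L^o) :
  dehom (f_param p) = f_poly (fun i => (p i).1) (fun i => (p i).2).
Proof.
rewrite /f_param /f_poly rmorph_prod; apply: eq_bigr => i _ /=.
by rewrite rmorphXn rmorphB /= !dehomZ dehom_X0 dehom_X1 alg_polyC.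
Qed.

Lemma dehom_g_param (p : 'I_d -> L^o * L^o) (h : forall i : 'I_d, binform L (part lam i - 2)) :
  dehom (g_param n p h)
  = g_poly (fun i => (p i).1) (fun i => (p i).2) (fun i => dehom (val (h i))).
Proof.
rewrite /g_param /g_poly raddf_sum; apply: eq_bigr => i _ /=.
by rewrite rmorphM rmorphXn rmorphD /= !dehomZ dehom_X0 dehom_X1 alg_polyC.
Qed.

Lemma linear_homog (a b : L) : a *: 'X_ord0 + b *: 'X_ord_max \is [in L[2], 1.-homog].
Proof. by apply: rpredD; apply: rpredZ; rewrite dhomogX /= mdeg1. Qed.

Lemma f_param_homog (p : 'I_d -> L^o * L^o) : f_param p \is n.-homog.
Proof.
rewrite -sum_part /f_param.
elim/big_rec2: _ => [|i e P _ hP]; first exact: dhomog1.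
apply: dhomogM => //; rewrite -[X in X.-homog]mul1n; apply: dhomogMn.
by rewrite -scaleNr linear_homog.
Qed.

Lemma g_param_homog (p : 'I_d -> L^o * L^o) (h : forall i : 'I_d, binform L (part lam i - 2)) :
  g_param n p h \is n.-homog.
Proof.
apply: rpred_sum => i; rewrite part_ge2 => i2.
have e : ((n - part lam i + 2) + (part lam i - 2) = n)%N by have := part_le i; lia.
have hl k : ((p i).1 *: 'X_ord0 + (p i).2 *: 'X_ord_max) ^+ k \is [in L[2], k.-homog].
  by rewrite -[X in X.-homog]mul1n; apply: dhomogMn; exact: linear_homog.
by have := dhomogM (hl (n - part lam i + 2)%N) (dhomog_is_dhomog (h i)); rewrite e.
Qed.

Lemma projeq_dehom (f : binform L n) P : P \is n.-homog ->
  projeq (val f) P <-> exists2 c : L, c != 0 & dehom (val f) = c *: dehom P.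
Proof.
move=> hP; split=> -[c c0 e]; exists c => //; first by rewrite e dehomZ.
apply: (@dehom_inj _ n); [exact: dhomog_is_dhomog | exact: rpredZ | by rewrite dehomZ].
Qed.

Lemma pair_neq0 (a : L^o * L^o) : (a != 0) = (a.1 != 0) || (a.2 != 0).
Proof. by case: a => x y; rewrite -negb_and; congr (~~ _); rewrite xpair_eqE. Qed.

Lemma size_f_poly s t : (size (f_poly s t) <= n.+1)%N.
Proof.
pose p (i : 'I_d) : L^o * L^o := (s i, t i).
by have := size_dehom (f_param_homog p); rewrite dehom_f_param.
Qed.

Lemma size_g_poly s t (h : 'I_d -> {poly L}) :
  (forall i, size (h i) <= part lam i - 1)%N -> (size (g_poly s t h) <= n.+1)%N.
Proof.
move=> hs.
pose p (i : 'I_d) : L^o * L^o := (s i, t i).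
pose h' (i : 'I_d) : binform L (part lam i - 2) := form_of _ (h i).
have := size_dehom (g_param_homog p h'); rewrite dehom_g_param.
rewrite (_ : g_poly _ _ _ = g_poly s t h) //; apply: eq_bigr => i i1.
by rewrite dehom_form_of //; apply: leq_trans (hs i) _; have := part_ge2 i; lia.
Qed.

Lemma f_poly_neq0 s t : (forall i, (s i != 0) || (t i != 0)) -> f_poly s t != 0.
Proof.
move=> st; apply/prodf_neq0 => i _; apply: expf_neq0; apply/eqP => e.
have e0 := congr1 (coefp 0) e; have e1 := congr1 (coefp 1) e.
move: (st i) e1 e0; rewrite /coefp.
rewrite !coefB !coefZ !coefX !coefC ?coef0 /= mulr0 mulr1 sub0r subr0 => h t0 /eqP.
by rewrite oppr_eq0 => /eqP s0; rewrite s0 t0 eqxx in h.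
Qed.

End Parametrization.

(** * Apolarity and Taylor coefficients *)

Section TaylorCoefficients.

Variable L : fieldType.
Implicit Types (p q : {poly L}) (r : L).

(** The coefficient of (X - r)^j in q, that is, the j-th divided derivative of q at r;
    it makes sense in every characteristic. *)
Definition taylor q r j : L := (q \Po ('X + r%:P))`_j.

Lemma coef_XaddC_exp r i j : (('X + r%:P) ^+ i)`_j = r ^+ (i - j) *+ 'C(i, j).
Proof.
rewrite addrC exprDn coef_sum.
under eq_bigr => k _ do rewrite coefMn -polyC_exp coefCM coefXn.
case: (ltnP j i.+1) => ji; last first.
  rewrite bin_small // mulr0n big1 // => k _.
  by rewrite (_ : (j == k) = false) ?mulr0 ?mul0rn //; have := ltn_ord k; lia.
rewrite (bigD1 (Ordinal ji)) //= eqxx mulr1 big1 ?addr0 // => k ne.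
by rewrite (_ : (j == k) = false) ?mulr0 ?mul0rn //; apply/negbTE; rewrite eq_sym.
Qed.

Lemma taylorE n q r j : (size q <= n)%N ->
  taylor q r j = \sum_(i < n) q`_i * (r ^+ (i - j) *+ 'C(i, j)).
Proof.
move=> sq; rewrite /taylor comp_polyE coef_sum.
under eq_bigr do rewrite coefZ coef_XaddC_exp.
rewrite (big_ord_widen _ (fun i => q`_i * (r ^+ (i - j) *+ 'C(i, j))) sq).
rewrite big_mkcond; apply: eq_bigr => i _; case: ltnP => // h.
by rewrite nth_default ?mul0r.
Qed.

Lemma comp_polyXaddCK q r : (q \Po ('X + r%:P)) \Po ('X - r%:P) = q.
Proof. by rewrite -comp_polyA comp_polyD comp_polyX comp_polyC subrK comp_polyXr. Qed.

Lemma taylor_XsubC_exp q r a j :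
  taylor (('X - r%:P) ^+ a * q) r j = if (j < a)%N then 0 else taylor q r (j - a).
Proof.
rewrite /taylor rmorphM rmorphXn rmorphB /= comp_polyX comp_polyC addrK.
by rewrite coefXnM.
Qed.

Lemma taylor0 q r : taylor q r 0 = q.[r].
Proof. by rewrite /taylor -horner_coef0 horner_comp !hornerE. Qed.

Lemma taylor_dvdp q r a : (('X - r%:P) ^+ a %| q)%R <-> forall j, (j < a)%N -> taylor q r j = 0.
Proof.
split=> [/dvdpP[u ->] j ja|h]; first by rewrite mulrC taylor_XsubC_exp ja.
rewrite -(comp_polyXaddCK q r) -[X in X \Po _](poly_take_drop a).
rewrite (_ : take_poly a _ = 0) ?add0r; last first.
  by apply/polyP => j; rewrite coef_take_poly coef0; case: ifP => // /h.
rewrite rmorphM rmorphXn /= comp_polyX; exact: dvdp_mulIr.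
Qed.

Lemma coprime_XsubC_exp r r' a b : r != r' ->
  coprimep (('X - r%:P) ^+ a) (('X - r'%:P) ^+ b).
Proof.
move=> ne; apply/coprimep_expl/coprimep_expr.
by rewrite coprimep_XsubC root_XsubC eq_sym.
Qed.

Lemma prod_XsubC_dvdp (I : finType) (r : I -> L) (a : I -> nat) q :
  injective r -> (forall i, ('X - (r i)%:P) ^+ a i %| q) ->
  \prod_i ('X - (r i)%:P) ^+ a i %| q.
Proof.
move=> inj h.
suff : forall s : seq I, uniq s -> \prod_(i <- s) ('X - (r i)%:P) ^+ a i %| q.
  by move=> H; exact: (H (index_enum I) (index_enum_uniq I)).
elim=> [|i s IH] /=; first by rewrite big_nil dvd1p.
case/andP => nis us; rewrite big_cons Gauss_dvdp ?h ?IH //.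
rewrite big_seq; elim/big_rec: _ => [|k P ks hP]; first exact: coprimep1.
rewrite coprimepMr hP andbT; apply: coprime_XsubC_exp; apply/eqP => /inj e.
by rewrite e ks in nis.
Qed.

Lemma pairDr n q p1 p2 : pair n q (p1 + p2) = pair n q p1 + pair n q p2.
Proof.
by rewrite /pair -big_split; apply: eq_bigr => k _; rewrite coefD mulrDr mulrDl.
Qed.

Lemma pair0r n q : pair n q 0 = 0.
Proof. by rewrite /pair big1 // => k _; rewrite coef0 mulr0 mul0r. Qed.

Lemma pairC n q p : pair n q p = pair n p q.
Proof. by apply: eq_bigr => k _; rewrite (mulrC q`__). Qed.

Lemma pairZr n q c p : pair n q (c *: p) = c * pair n q p.
Proof.
by rewrite /pair mulr_sumr; apply: eq_bigr => k _; rewrite coefZ mulrCA -!mulrA.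
Qed.

Lemma pairZl n q c p : pair n (c *: q) p = c * pair n q p.
Proof. by rewrite pairC pairZr pairC. Qed.

Lemma pairDl n q1 q2 p : pair n (q1 + q2) p = pair n q1 p + pair n q2 p.
Proof. by rewrite pairC pairDr !(pairC _ p). Qed.

Lemma pair_sumr n q (I : finType) (P : pred I) (F : I -> {poly L}) :
  pair n q (\sum_(i | P i) F i) = \sum_(i | P i) pair n q (F i).
Proof. by rewrite (big_morph (pair n q) (pairDr n q) (pair0r n q)). Qed.

Lemma pair_suml n q (I : finType) (P : pred I) (F : I -> {poly L}) :
  pair n (\sum_(i | P i) F i) q = \sum_(i | P i) pair n (F i) q.
Proof. by rewrite pairC pair_sumr; apply: eq_bigr => i _; rewrite pairC. Qed.

Hypothesis charL : [pchar L] =i pred0.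
Let natL k : (0 < k)%N -> k%:R != 0 :> L := natr_neq0 charL (k := k).

Lemma coef_lin_exp r m j : ((r *: 'X + 1) ^+ m)`_j = r ^+ j *+ 'C(m, j).
Proof.
rewrite exprD1n coef_sum.
under eq_bigr => k _ do rewrite coefMn exprZn coefZ coefXn.
case: (ltnP j m.+1) => jm; last first.
  rewrite bin_small // mulr0n big1 // => k _.
  by rewrite (_ : (j == k) = false) ?mulr0 ?mul0rn //; have := ltn_ord k; lia.
rewrite (bigD1 (Ordinal jm)) //= eqxx mulr1 big1 ?addr0 // => k ne.
by rewrite (_ : (j == k) = false) ?mulr0 ?mul0rn //; apply/negbTE; rewrite eq_sym.
Qed.

(** Both sides compare C(n - j, k - j) C(n, j) with C(n, k) C(k, j): two ways to choose
    j elements inside k elements among n. *)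
Lemma coef_hermite_basis n r j k : (j <= n)%N -> (k <= n)%N ->
  ((r *: 'X + 1) ^+ (n - j) * 'X^j)`_k * 'C(n, j)%:R
  = 'C(n, k)%:R * (r ^+ (k - j) *+ 'C(k, j)).
Proof.
move=> jn kn; rewrite coefMXn; case: ltnP => [kj|jk].
  by rewrite (bin_small kj) mulr0n mulr0 mul0r.
suff e : ('C(n - j, k - j) * 'C(n, j) = 'C(n, k) * 'C(k, j))%N.
  by rewrite coef_lin_exp mulr_natr -mulrnA e mulr_natl mulnC mulrnA.
apply/eqP; rewrite -(eqn_pmul2r (fact_gt0 j)) -(eqn_pmul2r (fact_gt0 (k - j))).
rewrite -(eqn_pmul2r (fact_gt0 (n - k))); apply/eqP.
have h1 := bin_fact jn; have h2 := bin_fact kn; have h3 := bin_fact jk.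
have h4 : ('C(n - j, k - j) * ((k - j)`! * (n - k)`!) = (n - j)`!)%N.
  have e : (n - k = (n - j) - (k - j))%N by lia.
  by rewrite [in LHS]e bin_fact //; lia.
transitivity (n`!); last by rewrite -h2 -h3; ring.
by rewrite -h1 -h4; ring.
Qed.

(** The key formula of apolarity. The weights 1 / C(n, k) turn the coefficients of (1 +
    r X)^(n - j) X^j into those of the j-th Taylor coefficient at r as a linear form in
    q. *)
Lemma pair_hermite_basis n q r j : (j <= n)%N -> (size q <= n.+1)%N ->
  pair n q ((r *: 'X + 1) ^+ (n - j) * 'X^j) = taylor q r j / 'C(n, j)%:R.
Proof.
move=> jn sq; rewrite (taylorE _ _ sq) mulr_suml; apply: eq_bigr => k _.
have kn : (k <= n)%N by rewrite -ltnS.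
have := @coef_hermite_basis n r j k jn kn.
have : 'C(n, k)%:R != 0 :> L by apply: natL; rewrite bin_gt0.
have : 'C(n, j)%:R != 0 :> L by apply: natL; rewrite bin_gt0.
set B := _`_k; set X := r ^+ _ *+ _ => h1 h2 h3.
have -> : B = 'C(n, k)%:R * X / 'C(n, j)%:R by rewrite -h3 mulfK.
by field; rewrite h1 h2.
Qed.

(** For every r, the products (1 + r X)^(k - j) X^j form a basis of the polynomials of
    degree at most k; this is what relates a factor h_i to the Taylor coefficients that
    it reads. *)
Lemma hermite_expansion r k (h : {poly L}) : (size h <= k.+1)%N ->
  exists c : nat -> L,
    h = \sum_(j < k.+1) c j *: ((r *: 'X + 1) ^+ (k - j) * 'X^j).
Proof.
elim: k h => [|k IH] h sh.
  by exists (fun=> h`_0); rewrite big_ord1 !expr0 mulr1 {1}(size1_polyC sh) alg_polyC.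
(* subtracting h`_0 times the power of rX + 1 leaves a multiple of 'X *)
pose g := h - h`_0 *: (r *: 'X + 1) ^+ k.+1.
have g0 : g`_0 = 0 by rewrite coefB coefZ coef_lin_exp bin0 expr0 mulr1 subrr.
have sg : (size g <= k.+2)%N.
  rewrite (leq_trans (size_polyD _ _)) // geq_max sh size_polyN.
  rewrite (leq_trans (size_scale_leq _ _)) // (leq_trans (size_poly_exp_leq _ _)) //.
  have : (size (r *: 'X + 1 : {poly L})%R <= 2)%N.
    rewrite (leq_trans (size_polyD _ _)) // geq_max size_poly1 andbT.
    by rewrite (leq_trans (size_scale_leq _ _)) // size_polyX.
  by case: (size _) => [|[|[|]]] //= _; lia.
have [g' eg] : exists g', g = g' * 'X.
  exists (drop_poly 1 g); rewrite -[LHS](poly_take_drop 1) (_ : take_poly 1 g = 0) ?add0r //.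
  by apply/polyP => j; rewrite coef_take_poly coef0; case: ltnP => //; case: j.
have sg' : (size g' <= k.+1)%N.
  have [->|g'0] := eqVneq g' 0; first by rewrite size_poly0.
  by move: sg; rewrite eg size_mulX.
have [c ec] := IH _ sg'.
exists (fun j => if j is j'.+1 then c j' else h`_0).
rewrite big_ord_recl /= subn0 expr0 mulr1 -[LHS](subrK (h`_0 *: (r *: 'X + 1) ^+ k.+1)).
rewrite addrC; congr (_ + _); rewrite -/g eg ec mulr_suml; apply: eq_bigr => j _.
by rewrite -scalerAl -mulrA -exprSr subSS.
Qed.

(** After the expansion of h, the form (1 + r X)^(n - m + 1) h reads Taylor coefficients
    at r of order below m only, and those of a multiple of (X - r)^m vanish. *)
Lemma pair_jet n q r m (h : {poly L}) : (m <= n)%N -> (size q <= n.+1)%N -> (size h <= m)%N ->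
  ('X - r%:P) ^+ m %| q -> pair n q ((r *: 'X + 1) ^+ (n - m + 1) * h) = 0.
Proof.
case: m => [|k] kn sq sh.
  by move: sh; rewrite leqn0 size_poly_eq0 => /eqP ->; rewrite mulr0 pair0r.
move=> /taylor_dvdp hq; have [c ->] := hermite_expansion r sh.
rewrite mulr_sumr pair_sumr big1 // => j _.
rewrite -scalerAr pairZr mulrA -exprD.
have -> : (n - k.+1 + 1 + (k - j) = n - j)%N by have := ltn_ord j; lia.
rewrite pair_hermite_basis //; last by have := ltn_ord j; lia.
by rewrite hq ?mul0r ?mulr0.
Qed.

End TaylorCoefficients.

(** * Annihilators of tangent directions *)

Section Hermite.

Variables (L : closedFieldType) (n : nat) (lam : seq nat).
Hypothesis lamP : is_partition n lam.
Hypothesis charL : [pchar L] =i pred0.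
Local Notation d := (size lam).
Implicit Types (i j : 'I_d) (r s t : 'I_d -> L) (h : 'I_d -> {poly L}) (q u : {poly L}).
Let natL k : (0 < k)%N -> k%:R != 0 :> L := natr_neq0 charL (k := k).

(** The bound that the degree of g_i is at most lambda_i - 2. For a part equal to 1 it
    forces h i = 0, in accordance with the missing summand. *)
Definition small_jets h := forall i : 'I_d, (size (h i) <= part lam i - 1)%N.

Definition root_prod r (e : 'I_d -> nat) : {poly L} := \prod_i ('X - (r i)%:P) ^+ e i.

(** Multiplicities after removing k copies of the i-th root: root_prod r (drop_roots 1
    i) is the derivative of f with respect to that root, up to a constant. *)
Definition drop_roots k (i : 'I_d) (j : 'I_d) : nat := (part lam j - (j == i) * k)%N.

Lemma root_prod_monic r e : root_prod r e \is monic.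
Proof. by apply: monic_prod => i _; rewrite monic_exp ?monicXsubC. Qed.

Lemma size_root_prod r e : size (root_prod r e) = (\sum_i e i).+1.
Proof.
rewrite /root_prod; elim/big_rec2: _ => [|i k P _ sP]; first by rewrite size_poly1.
rewrite size_monicM ?monic_exp ?monicXsubC -?size_poly_gt0 ?sP // size_exp_XsubC.
by rewrite addSn addnS.
Qed.

Lemma dvd_root_prod r e i k : (k <= e i)%N -> ('X - (r i)%:P) ^+ k %| root_prod r e.
Proof.
move=> ke; rewrite /root_prod (bigD1 i) //=; apply: dvdp_mulr.
exact: dvdp_exp2l.
Qed.

Lemma f_poly_chart s t : (forall i, t i != 0) ->
  f_poly s t = (\prod_i t i ^+ part lam i) *: root_prod (fun i => s i / t i) (fun i => part lam i).
Proof.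
move=> t0; rewrite /f_poly /root_prod -scaler_prod; apply: eq_bigr => i _.
by rewrite -exprZn scalerBr -[t i *: _%:P]mul_polyC -polyCM mulrCA divff ?mulr1.
Qed.

Lemma f_poly_monic r : f_poly r (fun=> 1) = root_prod r (fun i => part lam i).
Proof. by rewrite /f_poly; apply: eq_bigr => i _; rewrite scale1r. Qed.

Lemma g_poly_chart s t h : (forall i, t i != 0) ->
  g_poly n s t h = g_poly n (fun i => s i / t i) (fun=> 1)
                    (fun i => t i ^+ (n - part lam i + 2) *: h i).
Proof.
move=> t0; rewrite /g_poly; apply: eq_bigr => i _.
rewrite -scalerAr scalerAl -exprZn scalerDr scalerA -[t i *: _%:P]mul_polyC -polyCM.
by rewrite mulrCA divff ?mulr1.
Qed.

Lemma g_polyE r h : g_poly n r (fun=> 1) h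
  = \sum_(i < d | part lam i != 1%N) (r i *: 'X + 1) ^+ (n - (part lam i - 1) + 1) * h i.
Proof.
apply: eq_bigr => i i1; congr (_ ^+ _ * _).
by have := part_ge2 lamP i; have := part_le lamP i; lia.
Qed.

Lemma pair_g_poly_single r h q i : small_jets h -> (size q <= n.+1)%N -> part lam i != 1%N ->
  (forall j, j != i -> ('X - (r j)%:P) ^+ (part lam j - 1) %| q) ->
  pair n q (g_poly n r (fun=> 1) h)
  = pair n q ((r i *: 'X + 1) ^+ (n - (part lam i - 1) + 1) * h i).
Proof.
move=> sh sq i1 hq; rewrite g_polyE pair_sumr (bigD1 i) //= big1 ?addr0 // => j /andP[_ ji].
apply: pair_jet => //; last exact: hq.
by have := part_le lamP j; lia.
Qed.

Lemma pair_g_poly_eq0 r h q : small_jets h -> (size q <= n.+1)%N ->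
  (forall j, ('X - (r j)%:P) ^+ (part lam j - 1) %| q) ->
  pair n q (g_poly n r (fun=> 1) h) = 0.
Proof.
move=> sh sq hq; rewrite g_polyE pair_sumr big1 // => j _.
apply: pair_jet => //.
by have := part_le lamP j; lia.
Qed.

(** The coefficients of h_i in the basis of hermite_expansion are recovered one at a
    time, from the highest order down: pairing with a polynomial that vanishes to order
    a at r_i and to order lambda_j - 1 at the other roots r_j leaves the coefficient of
    index a, times a nonzero number. The recursion runs downwards because this
    polynomial has Taylor coefficients of order above a as well. *)
Lemma g_poly_inj r h : injective r -> small_jets h -> g_poly n r (fun=> 1) h = 0 ->
  forall i, part lam i != 1%N -> h i = 0.
Proof.
move=> inj sh G0 i i1; have i2 := part_ge2 lamP i; rewrite i1 in i2.
have [k ek] : exists k, part lam i = k.+2 by exists (part lam i - 2)%N; lia.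
have kn : (k.+2 <= n)%N by rewrite -ek part_le.
have [|c ec] := @hermite_expansion _ (r i) k (h i); first by rewrite (leq_trans (sh i)) // ek.
suff c0 : forall m (j : nat), (j <= k)%N -> (k - j < m)%N -> c j = 0.
  rewrite ec big1 // => j _; rewrite (c0 (k - j).+1) ?scale0r //.
  by rewrite -ltnS.
elim=> // m IH a ak am.
pose e j := if j == i then a else (part lam j - 1)%N.
have sq : (size (root_prod r e) <= n.+1)%N.
  rewrite size_root_prod ltnS -(sum_part lamP); apply: leq_sum => j _; rewrite /e.
  by case: eqP => [->|_]; lia.
have := @pair_g_poly_single r h (root_prod r e) i sh sq i1.
rewrite G0 pair0r => H.
rewrite ec mulr_sumr pair_sumr in H.
have {}H : pair n (root_prod r e)
   ((r i *: 'X + 1) ^+ (n - (part lam i - 1) + 1) *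
      (c a *: ((r i *: 'X + 1) ^+ (k - a) * 'X^a))) = 0.
  rewrite {}H; last by move=> j ji; apply: dvd_root_prod; rewrite /e (negbTE ji).
  have ak' : (a < k.+1)%N by [].
  rewrite (bigD1 (Ordinal ak')) //= big1 ?addr0 // => j ja.
  rewrite -scalerAr pairZr mulrA -exprD ek.
  have -> : (n - (k.+2 - 1) + 1 + (k - j) = n - j)%N by have := ltn_ord j; lia.
  rewrite pair_hermite_basis //; last by have := ltn_ord j; lia.
  case: (ltnP j a) => ja'.
    rewrite (taylor_dvdp _ _ a).1 ?mul0r ?mulr0 //; apply: dvd_root_prod.
    by rewrite /e eqxx.
  rewrite IH ?mul0r //; first by rewrite -ltnS.
  have : (a != j)%N by apply: contra ja => /eqP e'; apply/eqP/val_inj.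
  by have := ltn_ord j; lia.
move: H; rewrite -scalerAr pairZr mulrA -exprD ek.
have -> : (n - (k.+2 - 1) + 1 + (k - a) = n - a)%N by lia.
rewrite pair_hermite_basis //; last by lia.
rewrite {1}/root_prod (bigD1 i) //= {1}/e eqxx taylor_XsubC_exp ltnn subnn taylor0.
move=> /eqP; rewrite mulf_eq0 => /orP[/eqP//|].
rewrite mulf_eq0 invr_eq0 (negbTE (natL _)) ?orbF; last by rewrite bin_gt0; lia.
rewrite horner_prod => /prodf_eq0[j ji]; rewrite horner_exp expf_eq0 => /andP[_].
by rewrite !hornerE subr_eq0 => /eqP/inj e'; rewrite e' eqxx in ji.
Qed.

(** Pairing g with f / (X - r_i)^2 gives a condition on (f, g) alone, polynomial in the
    roots, that guarantees h_i to be nonzero. *)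
Lemma top_jet_neq0 r h i : small_jets h -> part lam i != 1%N ->
  pair n (root_prod r (drop_roots 2 i)) (g_poly n r (fun=> 1) h) != 0 -> h i != 0.
Proof.
move=> sh i1; apply: contraNneq => h0.
rewrite (@pair_g_poly_single _ _ _ i) ?h0 ?mulr0 ?pair0r //.
  rewrite size_root_prod ltnS -(sum_part lamP); apply: leq_sum => j _.
  by rewrite leq_subr.
by move=> j ji; apply: dvd_root_prod; rewrite /drop_roots (negbTE ji) /=; lia.
Qed.

(** With h_i = X^(lambda_i - 2), g reads exactly the Taylor coefficient of order
    lambda_i - 2 at r_i, which is the order of vanishing of f / (X - r_i)^2 there. So
    the condition of top_jet_neq0 is not identically violated. *)
Lemma top_jet_of_monomials r i : injective r -> part lam i != 1%N ->
  pair n (root_prod r (drop_roots 2 i))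
         (g_poly n r (fun=> 1) (fun j => 'X^(part lam j - 2))) != 0.
Proof.
move=> inj i1; have i2 := part_ge2 lamP i; rewrite i1 in i2.
have sh : small_jets (fun j => if part lam j == 1%N then 0 else 'X^(part lam j - 2) : {poly L}).
  move=> j; case: eqP => [->|/eqP]; first by rewrite size_poly0.
  by rewrite (part_ge2 lamP) size_polyXn; lia.
have -> : g_poly n r (fun=> 1) (fun j => 'X^(part lam j - 2))
  = g_poly n r (fun=> 1) (fun j => if part lam j == 1%N then 0 else 'X^(part lam j - 2) : {poly L}).
  by apply: eq_bigr => j j1; rewrite (negbTE j1).
have kn := part_le lamP i.
have sq : (size (root_prod r (drop_roots 2 i)) <= n.+1)%N.
  rewrite size_root_prod ltnS -(sum_part lamP); apply: leq_sum => j _.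
  by rewrite leq_subr.
rewrite (@pair_g_poly_single _ _ _ i) //; last first.
  by move=> j ji; apply: dvd_root_prod; rewrite /drop_roots (negbTE ji) /=; lia.
rewrite (negbTE i1).
have -> : (n - (part lam i - 1) + 1 = n - (part lam i - 2))%N by lia.
rewrite pair_hermite_basis //; last by lia.
rewrite mulf_neq0 ?invr_eq0 ?natL ?bin_gt0 //; last by lia.
rewrite /root_prod (bigD1 i) //= {1}/drop_roots eqxx mul1n.
rewrite taylor_XsubC_exp ltnn subnn taylor0 horner_prod.
apply/prodf_neq0 => j ji; rewrite horner_exp expf_neq0 // !hornerE subr_eq0.
by apply: contra ji => /eqP/inj->.
Qed.

Lemma root_prod_drop1 r i : root_prod r (drop_roots 1 i)
  = root_prod r (fun j => part lam j - 1)%N * \prod_(j | j != i) ('X - (r j)%:P).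
Proof.
rewrite /root_prod (bigD1 i) //= [in RHS](bigD1 i) //= -mulrA -big_split /=.
congr (_ * _); first by rewrite /drop_roots eqxx mul1n.
apply: eq_bigr => j ji; rewrite -exprSr /drop_roots (negbTE ji).
by congr (_ ^+ _); have := part_gt0 lamP j; lia.
Qed.

Lemma root_prod_full r : root_prod r (fun i => part lam i)
  = root_prod r (fun j => part lam j - 1)%N * \prod_j ('X - (r j)%:P).
Proof.
rewrite /root_prod -big_split /=; apply: eq_bigr => j _; rewrite -exprSr.
by congr (_ ^+ _); have := part_gt0 lamP j; lia.
Qed.

(** After division by prod (X - r_i)^(lambda_i - 1), this is Lagrange interpolation: f
    becomes P = prod (X - r_j), the other generators become P / (X - r_i), and together
    they span the polynomials of degree at most d. *)
Lemma tangent_span r u : injective r -> (size u <= d.+1)%N ->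
  exists c0 (c : 'I_d -> L), root_prod r (fun j => part lam j - 1)%N * u
    = c0 *: root_prod r (fun i => part lam i)
      + \sum_i c i *: root_prod r (drop_roots 1 i).
Proof.
move=> inj su.
pose P := \prod_j ('X - (r j)%:P).
pose R i := \prod_(j | j != i) ('X - (r j)%:P).
have sP : size P = d.+1 by rewrite size_prod_XsubC /index_enum -enumT size_enum_ord.
have sR k : (size (R k) <= d)%N.
  have R0 : R k != 0 by apply/monic_neq0/monic_prod => j _; rewrite monicXsubC.
  have e : P = R k * ('X - (r k)%:P) by rewrite /P (bigD1 k) //= mulrC.
  by move: sP; rewrite e size_Mmonic ?monicXsubC // size_XsubC addn2 => -[->].
have Ri k : (R k).[r k] != 0.
  rewrite horner_prod; apply/prodf_neq0 => j ji; rewrite !hornerE subr_eq0.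
  by apply: contra ji => /eqP/inj->.
have Rj k j : j != k -> (R k).[r j] = 0.
  by move=> ji; rewrite horner_prod (bigD1 j) //= !hornerE subrr mul0r.
pose c k := u.[r k] / (R k).[r k].
exists u`_d, c.
suff eu : u = u`_d *: P + \sum_i c i *: R i.
  rewrite root_prod_full -/P {1}eu mulrDr -scalerAr mulr_sumr; congr (_ + _).
  by apply: eq_bigr => i _; rewrite root_prod_drop1 -scalerAr.
apply/eqP; rewrite -subr_eq0; apply/eqP.
set w := _ - _.
have sw : (size w <= d)%N.
  apply/leq_sizeP => j dj; rewrite !coefB coefD coefZ coef_sum.
  rewrite [X in _ - (_ + X)]big1 ?addr0; last first.
    by move=> i _; rewrite coefZ nth_default ?mulr0 // (leq_trans (sR i)).
  move: dj; rewrite leq_eqVlt => /orP[/eqP <-|dj].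
    have := monicP (monic_prod_XsubC (index_enum 'I_d) xpredT r).
    by rewrite lead_coefE -/P sP /= => ->; rewrite mulr1 subrr.
  rewrite [u`_j]nth_default ?(leq_trans su) // [P`_j]nth_default ?sP //.
  by rewrite mulr0 subr0.
apply/eqP; rewrite -size_poly_leq0 leqNgt; apply/negP => w0.
have: (size (codom r) < size w)%N.
  apply: max_poly_roots; first by rewrite -size_poly_gt0.
    apply/allP => x /codomP[i ->]; rewrite /root /w !hornerE horner_sum.
    rewrite (bigD1 i) //= big1 ?addr0; last by move=> j ji; rewrite hornerZ Rj ?mulr0 // eq_sym.
    have P0 : P.[r i] = 0 by rewrite horner_prod (bigD1 i) //= !hornerE subrr mul0r.
    by rewrite !hornerE /c divfK ?Ri // P0 mulr0 add0r subrr.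
  by rewrite map_inj_uniq ?enum_uniq.
by rewrite size_codom card_ord => /leq_trans/(_ sw); rewrite ltnn.
Qed.

(** The converse of pair_g_poly_eq0. Let M be the matrix whose rows read the Taylor
    coefficients of order at most lambda_i - 2 at r_i. Its kernel consists of the
    multiples of prod (X - r_i)^(lambda_i - 1), which g annihilates by tangent_span; so
    g, as a row vector, lies in the row space of M, and pair_hermite_basis identifies
    its entries with the coefficients of a g_poly. *)
Lemma annihilator_is_g_poly r (g : {poly L}) : injective r -> (size g <= n.+1)%N ->
  pair n (root_prod r (fun i => part lam i)) g = 0 ->
  (forall i, pair n (root_prod r (drop_roots 1 i)) g = 0) ->
  exists2 h, small_jets h & g = g_poly n r (fun=> 1) h.
Proof.
move=> inj sg g0 g1.
pose A := root_prod r (fun j => part lam j - 1)%N.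
have perp u : (size u <= d.+1)%N -> pair n (A * u) g = 0.
  move=> su; have [c0 [c ->]] := tangent_span inj su.
  rewrite pairDl pairZl g0 mulr0 add0r pair_suml big1 // => i _.
  by rewrite pairZl g1 mulr0.
pose T : finType := ('I_d * 'I_n.+1)%type.
pose E (k : 'I_n.+1) (ij : T) : L :=
  if (ij.2.+1 < part lam ij.1)%N then r ij.1 ^+ (k - ij.2) *+ 'C(k, ij.2) else 0.
pose M : 'M[L]_(#|T|, n.+1) := \matrix_(a, k) E k (enum_val a).
have ME (ij : T) k : M (enum_rank ij) k = E k ij by rewrite mxE enum_rankK.
pose v : 'rV[L]_n.+1 := \row_k (g`_k / 'C(n, k)%:R).
have /submxP[D eD] : (v <= M)%MS.
  rewrite submxE; apply/eqP/matrixP => x y; rewrite !mxE.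
  pose w := \poly_(k < n.+1) (cokermx M (inord k) y).
  have wE (k : 'I_n.+1) : w`_k = cokermx M k y by rewrite coef_poly ltn_ord inord_val.
  transitivity (pair n w g).
    by apply: eq_bigr => k _; rewrite mxE wE mulrC mulrA.
  have /dvdpP[u eu] : A %| w.
    apply: prod_XsubC_dvdp => // i; apply/taylor_dvdp => j ji.
    have jn : (j < n.+1)%N by have := part_le lamP i; lia.
    rewrite (taylorE _ _ (size_poly _ _)).
    have := (matrixP _ _).2 (mulmx_coker M) (enum_rank ((i, Ordinal jn) : T)) y.
    rewrite !mxE => e; rewrite -[RHS]e; apply: eq_bigr => k _.
    rewrite wE ME /E /= mulrC.
    by rewrite (_ : (j.+1 < part lam i)%N); last by lia.
  rewrite eu mulrC perp //.
  have [->|u0] := eqVneq u 0; first by rewrite size_poly0.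
  have := size_poly n.+1 (fun k => cokermx M (inord k) y); rewrite -/w eu.
  rewrite size_Mmonic ?root_prod_monic // size_root_prod.
  have : (\sum_(i < d) (part lam i - 1) + d = n)%N.
    rewrite -(sum_part lamP) -[X in (_ + X)%N]card_ord -sum1_card -big_split /=.
    by apply: eq_bigr => i _; have := part_gt0 lamP i; lia.
  by move=> e1; rewrite addnS /= -[X in (_ <= X.+1)%N]e1 -addnS addnC leq_add2l.
pose c i (j : 'I_n.+1) := D 0 (enum_rank ((i, j) : T)).
pose h i := \sum_(j < n.+1 | (j.+1 < part lam i)%N)
   (c i j * 'C(n, j)%:R) *: ((r i *: 'X + 1) ^+ (part lam i - 2 - j) * 'X^j).
have hs : small_jets h.
  move=> i; rewrite /h; elim/big_ind: _ => [|p q sp sq|j ji]; first by rewrite size_poly0.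
    by rewrite (leq_trans (size_polyD _ _)) // geq_max sp.
  rewrite (leq_trans (size_scale_leq _ _)) // size_mulXn ?expf_neq0 //; last first.
    apply/eqP => /(congr1 (fun p : {poly L} => p`_0)).
    by rewrite coefD coefZ coefX mulr0 add0r coef1 coef0 => /eqP; rewrite oner_eq0.
  have : (size ((r i *: 'X + 1) ^+ (part lam i - 2 - j)) <= (part lam i - 2 - j).+1)%N.
    rewrite (leq_trans (size_poly_exp_leq _ _)) //.
    have : (size (r i *: 'X + 1 : {poly L})%R <= 2)%N.
      rewrite (leq_trans (size_polyD _ _)) // geq_max size_poly1 andbT.
      by rewrite (leq_trans (size_scale_leq _ _)) // size_polyX.
    by case: (size _) => [|[|[|]]] //= _; lia.
  by lia.
exists h => //.
have gk (k : 'I_n.+1) : g`_k = 'C(n, k)%:R * \sum_i \sum_j c i j * E k (i, j).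
  have := (matrixP _ _).2 eD 0 k; rewrite !mxE => e.
  have -> : g`_k = 'C(n, k)%:R * (g`_k / 'C(n, k)%:R).
    by rewrite mulrC divfK // natL // bin_gt0 -ltnS.
  rewrite e; congr (_ * _); rewrite (reindex (@enum_rank _)) /=; last first.
    exact/onW_bij/enum_rank_bij.
  rewrite pair_bigA; apply: eq_bigr => -[i j] _ /=.
  by rewrite ME.
apply/polyP => k; case: (ltnP k n.+1) => kn; last first.
  rewrite !nth_default //.
    by apply: leq_trans kn; apply: size_g_poly => //; exact: hs.
  exact: leq_trans sg kn.
rewrite (gk (Ordinal kn)) /= /g_poly coef_sum mulr_sumr [RHS]big_mkcond.
apply: eq_bigr => i _; case: ifP => [i1|/negbFE/eqP i1]; last first.
  by rewrite big1 ?mulr0 // => j _; rewrite /E /= i1 mulr0.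
have i2 := part_ge2 lamP i; rewrite i1 in i2.
rewrite [LHS]mulr_sumr /h mulr_sumr coef_sum [RHS]big_mkcond.
apply: eq_bigr => j _; rewrite /E /=; case: ifP => ji; last by rewrite !mulr0.
rewrite -scalerAr coefZ [_ ^+ _ * (_ * _)]mulrA -exprD.
have -> : (n - part lam i + 2 + (part lam i - 2 - j) = n - j)%N.
  by have := part_le lamP i; lia.
rewrite -mulrA [_%:R * _`_k]mulrC coef_hermite_basis ?(mulrCA 'C(n, k)%:R) //.
by rewrite -ltnS.
Qed.

End Hermite.

(** * Vanishing at the natural numbers *)

Section CharZero.

Variable L : fieldType.
Hypothesis charL : [pchar L] =i pred0.

Lemma natr_inj : injective (fun k : nat => k%:R : L).
Proof.
move=> i j /eqP; wlog ij : i j / (i <= j)%N => [W|].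
  by case: (leqP i j) => [|/ltnW] ij e; [exact: W | rewrite (W j i) // eq_sym].
rewrite eq_sym -subr_eq0 -natrB //; have /pcharf0P -> := charL.
by rewrite subn_eq0 => ji; apply/eqP; rewrite eqn_leq ij.
Qed.

Lemma poly_eq0_nat (P : {poly L}) : (forall k : nat, P.[k%:R] = 0) -> P = 0.
Proof.
move=> h; apply/eqP/negPn/negP => P0.
have := @max_poly_roots _ P [seq k%:R | k <- iota 0 (size P)] P0.
rewrite size_map size_iota ltnn => H; suff : false by []; apply: H.
  by apply/allP => x /mapP[k _ ->]; rewrite /root h.
by rewrite map_inj_uniq ?iota_uniq //; exact: natr_inj.
Qed.

End CharZero.

(** * Functions that are polynomial along lines *)

Section Regular.

Variables (L : fieldType) (V : lmodType L).

(** Weaker than being polynomial, but enough to argue on one line at a time, and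
    immediate to check for composites. *)
Definition regular (phi : V -> L) : Prop :=
  forall v w, exists P : {poly L}, forall e, phi (v + e *: w) = P.[e].

Definition pregular (P : V -> {poly L}) : Prop := forall k, regular (fun v => (P v)`_k).

Lemma eq_regular phi psi : phi =1 psi -> regular phi -> regular psi.
Proof. by move=> e h v w; have [P hP] := h v w; exists P => x; rewrite -e. Qed.

Lemma regular_cst c : regular (fun=> c).
Proof. by move=> v w; exists c%:P => e; rewrite hornerC. Qed.

Lemma regular_lin (phi : V -> L) :
  (forall v w e, phi (v + e *: w) = phi v + e * phi w) -> regular phi.
Proof.
move=> h v w; exists ((phi v)%:P + phi w *: 'X) => e.
by rewrite h !hornerE mulrC.
Qed.

Lemma regularD phi psi : regular phi -> regular psi -> regular (fun v => phi v + psi v).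
Proof.
move=> h1 h2 v w; have [P hP] := h1 v w; have [Q hQ] := h2 v w.
by exists (P + Q) => e; rewrite hP hQ hornerD.
Qed.

Lemma regularM phi psi : regular phi -> regular psi -> regular (fun v => phi v * psi v).
Proof.
move=> h1 h2 v w; have [P hP] := h1 v w; have [Q hQ] := h2 v w.
by exists (P * Q) => e; rewrite hP hQ hornerM.
Qed.

Lemma regularN phi : regular phi -> regular (fun v => - phi v).
Proof. by move=> h v w; have [P hP] := h v w; exists (- P) => e; rewrite hP hornerN. Qed.

Lemma regular_sum (I : Type) (s : seq I) (A : pred I) (phi : I -> V -> L) :
  (forall i, regular (phi i)) -> regular (fun v => \sum_(i <- s | A i) phi i v).
Proof.
move=> h; elim: s => [|i s IH].
  by apply: (@eq_regular (fun=> 0)) (regular_cst 0) => v; rewrite big_nil.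
case Ai: (A i).
  by apply: eq_regular (regularD (h i) IH) => v; rewrite big_cons Ai.
by apply: eq_regular IH => v; rewrite big_cons Ai.
Qed.

Lemma regular_prod (I : Type) (s : seq I) (A : pred I) (phi : I -> V -> L) :
  (forall i, regular (phi i)) -> regular (fun v => \prod_(i <- s | A i) phi i v).
Proof.
move=> h; elim: s => [|i s IH].
  by apply: (@eq_regular (fun=> 1)) (regular_cst 1) => v; rewrite big_nil.
case Ai: (A i).
  by apply: eq_regular (regularM (h i) IH) => v; rewrite big_cons Ai.
by apply: eq_regular IH => v; rewrite big_cons Ai.
Qed.

Lemma regularX phi k : regular phi -> regular (fun v => phi v ^+ k).
Proof.
by move=> h v w; have [P hP] := h v w; exists (P ^+ k) => e; rewrite hP horner_exp.
Qed.

Lemma regular_meval m (G : {mpoly L[m]}) (phi : V -> 'I_m -> L) :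
  (forall i, regular (fun v => phi v i)) -> regular (fun v => G.@[phi v]).
Proof.
move=> h; apply: (@eq_regular (fun v => \sum_(a <- msupp G) G@_a * \prod_i phi v i ^+ a i)).
  by move=> v; rewrite mevalE.
apply: regular_sum => a; apply: regularM; first exact: regular_cst.
by apply: regular_prod => i; apply: regularX.
Qed.

Lemma pregular_cst P : pregular (fun=> P).
Proof. by move=> k; exact: regular_cst. Qed.

Lemma pregularD P Q : pregular P -> pregular Q -> pregular (fun v => P v + Q v).
Proof. by move=> h1 h2 k; apply: eq_regular (regularD (h1 k) (h2 k)) => v; rewrite coefD. Qed.

Lemma pregularN P : pregular P -> pregular (fun v => - P v).
Proof. by move=> h1 k; apply: eq_regular (regularN (h1 k)) => v; rewrite coefN. Qed.

Lemma pregularM P Q : pregular P -> pregular Q -> pregular (fun v => P v * Q v).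
Proof.
move=> h1 h2 k.
apply: (@eq_regular (fun v => \sum_(j < k.+1) (P v)`_j * (Q v)`_(k - j))).
  by move=> v; rewrite coefM.
by apply: regular_sum => j; apply: regularM.
Qed.

Lemma pregularX P k : pregular P -> pregular (fun v => P v ^+ k).
Proof.
move=> h; elim: k => [|k IH] j; first exact: (pregular_cst 1).
by apply: eq_regular (pregularM h IH j) => v; rewrite exprS.
Qed.

Lemma pregularZ phi P : regular phi -> pregular P -> pregular (fun v => phi v *: P v).
Proof. by move=> h1 h2 k; apply: eq_regular (regularM h1 (h2 k)) => v; rewrite coefZ. Qed.

Lemma pregularC phi : regular phi -> pregular (fun v => (phi v)%:P).
Proof.
move=> h k; case: (eqVneq k 0%N) => k0.
  by apply: eq_regular h => v; rewrite coefC k0.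
by apply: eq_regular (regular_cst 0) => v; rewrite coefC (negbTE k0).
Qed.

Lemma pregular_sum (I : Type) (s : seq I) (A : pred I) (P : I -> V -> {poly L}) :
  (forall i, pregular (P i)) -> pregular (fun v => \sum_(i <- s | A i) P i v).
Proof.
move=> h k; apply: eq_regular (regular_sum s A (fun i => h i k)) => v.
by rewrite coef_sum.
Qed.

Lemma pregular_prod (I : Type) (s : seq I) (A : pred I) (P : I -> V -> {poly L}) :
  (forall i, pregular (P i)) -> pregular (fun v => \prod_(i <- s | A i) P i v).
Proof.
move=> h; elim: s => [|i s IH] k.
  by apply: eq_regular (regular_cst (1 : {poly L})`_k) => v; rewrite big_nil.
case Ai: (A i).
  by apply: eq_regular (pregularM (h i) IH k) => v; rewrite big_cons Ai.
by apply: eq_regular (IH k) => v; rewrite big_cons Ai.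
Qed.

Hypothesis charL : [pchar L] =i pred0.

(** A nonempty open set is dense. The line joining a given point to a point where psi is
    nonzero meets the zero set of psi finitely often; phi psi vanishes on the whole
    line, hence so does phi. *)
Lemma regular_dense phi psi : regular phi -> regular psi ->
  (exists w, psi w != 0) -> (forall v, psi v != 0 -> phi v = 0) -> forall v, phi v = 0.
Proof.
move=> h1 h2 [w pw] h v.
have [P hP] := h1 v (w - v); have [Q hQ] := h2 v (w - v).
have PQ : P * Q = 0.
  apply: (poly_eq0_nat charL) => k; rewrite hornerM -hP -hQ.
  by have [->|/h ->] := eqVneq (psi (v + k%:R *: (w - v))) 0; rewrite ?mulr0 ?mul0r.
move/eqP: PQ; rewrite mulf_eq0 => /orP[/eqP P0|/eqP Q0].
  by rewrite -[v]addr0 -[in LHS](scale0r (w - v)) hP P0 horner0.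
by move: pw; rewrite -[w](subrKC v) -[w - v]scale1r hQ Q0 horner0 eqxx.
Qed.

Lemma regular_neq0_both phi psi : regular phi -> regular psi ->
  (exists w, phi w != 0) -> (exists w, psi w != 0) -> exists w, phi w * psi w != 0.
Proof.
move=> h1 h2 [v pv] e2; apply: NNPP => N.
have : phi v = 0.
  apply: (regular_dense h1 h2 e2) => u pu; apply/eqP/negPn/negP => fu.
  by apply: N; exists u; rewrite mulf_neq0.
by move=> e; rewrite e eqxx in pv.
Qed.

Lemma regular_neq0_all (I : finType) (phi : I -> V -> L) :
  (forall i, regular (phi i)) -> (forall i, exists w, phi i w != 0) ->
  exists w, forall i, phi i w != 0.
Proof.
move=> h e.
suff [w] : exists w, \prod_(i <- enum I) phi i w != 0.
  rewrite prodf_seq_neq0 => /allP hw; exists w => i.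
  by apply: (implyP (hw i _)) => //; rewrite mem_enum.
elim: (enum I) => [|i s [w IH]].
  by exists 0; rewrite big_nil oner_neq0.
have [u] := regular_neq0_both (h i) (regular_prod s xpredT h) (e i) (ex_intro _ w IH).
by exists u; rewrite big_cons.
Qed.

End Regular.

(** * Evaluation of polynomials over the base field *)

Section Evaluation.

Variables (K : fieldType) (L : fieldType) (iota : {rmorphism K -> L}).

(** Evaluation at a point of the extension becomes a ring morphism from polynomials over
    the base field, so that the rewriting rules for morphisms apply directly. *)
Lemma meval_map_mpoly m (x : 'I_m -> L) (F : {mpoly K[m]}) :
  (map_mpoly iota F).@[x] = mmap iota x F.
Proof.
rewrite (mevalE) /mmap (perm_big _ (msupp_map_mpoly _ _)) /=; last exact: fmorph_inj.
by apply: eq_bigr => a _; rewrite mcoeff_map_mpoly.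
Qed.

Lemma eq_mmap m (R S : nzRingType) (f : R -> S) (x y : 'I_m -> S) (F : {mpoly R[m]}) :
  x =1 y -> mmap f x F = mmap f y F.
Proof. by move=> e; apply: eq_bigr => a _; rewrite (mmap1_eq _ e). Qed.

Lemma mmap_sumE m (R S : nzRingType) (f : R -> S) (x : 'I_m -> S) (F : {mpoly R[m]}) :
  mmap f x F = \sum_(a <- msupp F) f F@_a * \prod_i x i ^+ a i.
Proof. by []. Qed.

Lemma mmapXU m (x : 'I_m -> L) i : mmap iota x 'X_i = x i.
Proof. by rewrite mmapX mmap1U. Qed.

End Evaluation.

Lemma mmap_comp (a b : nat) (R : nzRingType) (S : comNzRingType) (f : {rmorphism R -> S})
    (h : 'I_b -> S) (q : 'I_a -> {mpoly R[b]}) (p : {mpoly R[a]}) :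
  mmap f h (mmap (@mpolyC b R) q p) = mmap f (fun i => mmap f h (q i)) p.
Proof.
rewrite [mmap (@mpolyC b R) q p]/mmap raddf_sum; apply: eq_bigr => m _ /=.
rewrite rmorphM /= mmapC rmorph_prod; congr (_ * _).
by apply: eq_bigr => i _; rewrite /= rmorphXn.
Qed.

(** * Symmetrization over the roots *)

Section Norm.

Variables (K : fieldType) (L : fieldType) (iota : {rmorphism K -> L}) (n : nat).
Hypothesis charL : [pchar L] =i pred0.

Local Notation R := {mpoly K[n.+1]}.

(** Evaluation at a pair of coordinate vectors, not assumed to come from forms. *)
Definition bieval (z g : 'I_n.+1 -> L) (F : {mpoly K[n.+1 + n.+1]}) : L :=
  mmap iota (fun i => match split i with inl j => z j | inr j => g j end) F.

HB.instance Definition _ z g := GRing.RMorphism.copy (bieval z g)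
  (mmap iota (fun i => match split i with inl j => z j | inr j => g j end)).

(** The ring of coefficients of E is the polynomial ring in the coordinates of g, so
    that E is a polynomial in the roots for which symmetry in the roots makes sense. *)
Definition root_eval (rho : 'I_n -> L) (g : 'I_n.+1 -> L) (E : {mpoly R[n]}) : L :=
  mmap (mmap iota g) rho E.

Definition root_coords c (rho : 'I_n -> L) (i : 'I_n.+1) : L :=
  c * (\prod_k ('X - (rho k)%:P))`_(n - i).

Lemma root_eval_msym s rho g E : root_eval rho g (msym s E) = root_eval (fun i => rho (s i)) g E.
Proof. by rewrite /root_eval mmap_comp; apply: eq_mmap => i; rewrite mmapX mmap1U. Qed.

Lemma root_eval_mesym k rho g : root_eval rho g (mesym n R k) = (mesym n L k).@[rho].
Proof.
rewrite /root_eval /mesym !raddf_sum; apply: eq_bigr => h _ /=.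
by rewrite !rmorph_prod; apply: eq_bigr => i _ /=; rewrite mmapX mmap1U mevalXU.
Qed.

Lemma root_coordsE c rho (i : 'I_n.+1) :
  root_coords c rho i = c * ((-1) ^+ i * (mesym n L i).@[rho]).
Proof.
rewrite /root_coords; congr (_ * _).
have := mroots_coeff [tuple rho k | k < n] i.
rewrite (_ : \prod_(c <- _) _ = \prod_k ('X - (rho k)%:P)).
  by move=> ->; congr (_ * _); apply: meval_eq => k; rewrite tnth_mktuple.
by rewrite big_tuple; apply: eq_bigr => k _; rewrite tnth_mktuple.
Qed.

Lemma root_coords0 c rho : root_coords c rho ord0 = c.
Proof. by rewrite root_coordsE expr0 mul1r mesym0E meval1 mulr1. Qed.

(** By the fundamental theorem, Q is a polynomial t in the elementary symmetric
    functions of the roots, which are quotients z_i / z_0 of coefficients up to sign.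
    Multiplying by a power of z_0 beyond the degree of t clears the denominators; the
    additional factor z_0 makes F vanish on the hyperplane at infinity z_0 = 0. *)
Lemma symmetric_to_coef (Q : {mpoly R[n]}) : Q \is symmetric ->
  exists (F : {mpoly K[n.+1 + n.+1]}) (D : nat),
    (forall c rho g, bieval (root_coords c rho) g F = c ^+ D.+1 * root_eval rho g Q)
    /\ (forall z g, z ord0 = 0 -> bieval z g F = 0).
Proof.
move=> /sym_fundamental[t [et _]].
pose zvar i : {mpoly K[n.+1 + n.+1]} := 'X_(lshift n.+1 i).
pose emb : R -> {mpoly K[n.+1 + n.+1]} :=
  mmap (@mpolyC _ K) (fun j => 'X_(rshift n.+1 j)).
pose D := msize t.
exists (zvar ord0 * \sum_(m <- msupp t) emb t@_m * zvar ord0 ^+ (D - mdeg m)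
           * \prod_(i < n) ((-1) ^+ i.+1 * zvar (lift ord0 i)) ^+ m i), D.
have evZ z g i : bieval z g (zvar i) = z i.
  by rewrite /bieval /zvar mmapX mmap1U (unsplitK (inl i)).
have evemb z g c : bieval z g (emb c) = mmap iota g c.
  rewrite /bieval /emb mmap_comp; apply: eq_mmap => i.
  by rewrite mmapX mmap1U (unsplitK (inr i)).
split=> [c rho g|z g z0]; last first.
  by rewrite rmorphM /= evZ z0 mul0r.
rewrite rmorphM /= evZ root_coords0 exprS -mulrA; congr (_ * _).
rewrite -et /root_eval /comp_mpoly mmap_comp rmorph_sum /= [X in _ = _ * X]mmap_sumE mulr_sumr
  !big_seq.
apply: eq_bigr => m mt.
rewrite !rmorphM rmorphXn rmorph_prod /= evemb evZ root_coords0.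
rewrite mulrCA -mulrA; congr (_ * _).
have -> : D = (D - mdeg m + mdeg m)%N by rewrite subnK // ltnW // msize_mdeg_lt.
rewrite exprD addnK -mulrA; congr (_ * _).
rewrite mdegE -prodrXr -big_split; apply: eq_bigr => i _ /=.
rewrite -exprMn tnth_mktuple -[mmap _ _ (mesym _ _ _)]/(root_eval rho g _) root_eval_mesym.
rewrite rmorphXn rmorphM rmorphXn rmorphN1 /= evZ root_coordsE.
congr (_ ^+ _); rewrite lift0; set x := meval _ _.
by rewrite mulrCA [_ * (_ * x)]mulrA -expr2 sqrr_sign mul1r.
Qed.

(** The condition that all E_j vanish for some ordering of the roots is the vanishing of
    prod_s sum_j mu^j E_j(rho o s) for all numbers mu. For a point where it fails, one
    mu works for all permutations s, because finitely many nonzero polynomials in mu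
    have a common nonroot. The product is symmetric in the roots, so symmetric_to_coef
    applies. *)
Lemma norm_separates m (E : 'I_m -> {mpoly R[n]}) (rho0 : 'I_n -> L) g0 :
  (forall s : 'S_n, exists j, root_eval (fun i => rho0 (s i)) g0 (E j) != 0) ->
  exists F : {mpoly K[n.+1 + n.+1]},
  [/\ forall c rho g, (forall j, root_eval rho g (E j) = 0) -> bieval (root_coords c rho) g F = 0,
      forall z g, z ord0 = 0 -> bieval z g F = 0 &
      forall c, c != 0 -> bieval (root_coords c rho0) g0 F != 0].
Proof.
move=> h.
pose p (s : 'S_n) : {poly L} := \poly_(j < m)
   (if insub j is Some j' then root_eval (fun i => rho0 (s i)) g0 (E j') else 0).
have p0 s : p s != 0.
  have [j ej] := h s; apply: contraNneq ej => /(congr1 (fun q : {poly L} => q`_j)).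
  by rewrite coef_poly ltn_ord valK coef0 => ->.
have [mu hmu] : exists mu : nat, forall s, (p s).[mu%:R] != 0.
  apply: NNPP => N.
  have : \prod_s p s = 0.
    apply: (poly_eq0_nat charL) => k; rewrite horner_prod; apply/eqP/prodf_eq0.
    apply: NNPP => N'; apply: N; exists k => s; apply/eqP => e.
    by apply: N'; exists s => //; apply/eqP.
  by move/eqP/prodf_eq0 => [s _]; rewrite (negbTE (p0 s)).
pose P := \sum_(j < m) mu%:R ^+ j * E j.
pose Q := \prod_(s : 'S_n) msym s P.
have evP rho g : root_eval rho g P = \sum_(j < m) mu%:R ^+ j * root_eval rho g (E j).
  rewrite /root_eval raddf_sum; apply: eq_bigr => j _ /=.
  by rewrite rmorphM rmorphXn rmorph_nat.
have evQ rho g : root_eval rho g Q = \prod_(s : 'S_n) root_eval (fun i => rho (s i)) g P.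
  by rewrite {1}/root_eval rmorph_prod; apply: eq_bigr => s _; exact: root_eval_msym.
have symQ : Q \is symmetric.
  apply/issymP => s; rewrite rmorph_prod.
  rewrite /=; under eq_bigr do rewrite -msymMm.
  by rewrite [RHS](reindex_inj (mulIg s)).
have [F [D [hF1 hF2]]] := symmetric_to_coef symQ.
exists F; split=> // [c rho g e0|c c0].
  rewrite hF1 evQ (bigD1 (1%g : 'S_n)) //= evP big1 ?mul0r ?mulr0 // => j _.
  have -> : root_eval (fun i => rho ((1%g : 'S_n) i)) g (E j) = root_eval rho g (E j).
    by apply: eq_mmap => i; rewrite perm1.
  by rewrite e0 mulr0.
rewrite hF1 mulf_neq0 ?expf_neq0 // evQ; apply/prodf_neq0 => s _.
have := hmu s; rewrite horner_poly evP; congr (_ != 0).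
apply: eq_bigr => j _; rewrite valK mulrC; congr (_ * _).
Qed.

End Norm.

(** * Bihomogeneous components and closures of bicones *)

Section Bihomogeneous.

Variables (K : fieldType) (L : closedFieldType) (iota : {rmorphism K -> L}) (n : nat).
Hypothesis charL : [pchar L] =i pred0.
Implicit Types (F : {mpoly K[n.+1 + n.+1]}) (z g : 'I_n.+1 -> L).

Definition deg1 (m : 'X_{1..n.+1 + n.+1}) := (\sum_(i < n.+1) m (lshift n.+1 i))%N.
Definition deg2 (m : 'X_{1..n.+1 + n.+1}) := (\sum_(i < n.+1) m (rshift n.+1 i))%N.

Definition bicomp a b F : {mpoly K[n.+1 + n.+1]} :=
  \sum_(m <- msupp F | (deg1 m == a) && (deg2 m == b)) F@_m *: 'X_[m].

Lemma bicomp_bihomogeneous a b F : bihomogeneous (bicomp a b F).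
Proof.
exists a, b => m; rewrite mcoeff_msupp /bicomp raddf_sum /= => h.
suff /andP[/eqP ? /eqP ?] : (deg1 m == a) && (deg2 m == b) by split.
apply: contraNT h => h; rewrite big1 // => m' h'.
rewrite mcoeffZ mcoeffX; case: eqP => [e|]; last by rewrite mulr0.
by rewrite -e h' in h.
Qed.

Lemma bievalE z g F : bieval iota z g F = \sum_(m <- msupp F) iota F@_m *
  (\prod_i z i ^+ m (lshift n.+1 i) * \prod_i g i ^+ m (rshift n.+1 i)).
Proof.
rewrite /bieval mmap_sumE; apply: eq_bigr => m _; congr (_ * _).
rewrite big_split_ord /=; congr (_ * _); apply: eq_bigr => i _.
  by rewrite (unsplitK (inl i)).
by rewrite (unsplitK (inr i)).
Qed.

Lemma eq_bieval z z' g g' F : z =1 z' -> g =1 g' -> bieval iota z g F = bieval iota z' g' F.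
Proof.
move=> ez eg; rewrite !bievalE; apply: eq_bigr => m _.
congr (_ * (_ * _)); apply: eq_bigr => i _; first by rewrite ez.
by rewrite eg.
Qed.

Lemma bievalZ z g c F : bieval iota z g (c *: F) = iota c * bieval iota z g F.
Proof. by rewrite /bieval mmapZ. Qed.

Lemma bievalX z g m : bieval iota z g 'X_[m]
  = \prod_i z i ^+ m (lshift n.+1 i) * \prod_i g i ^+ m (rshift n.+1 i).
Proof. by rewrite bievalE msuppX big_seq1 mcoeffX eqxx rmorph1 mul1r. Qed.

Lemma bieval_scale z g F x y N : (forall m, m \in msupp F -> deg1 m < N /\ deg2 m < N)%N ->
  bieval iota (fun i => x * z i) (fun i => y * g i) F
  = \sum_(a < N) x ^+ a * \sum_(b < N) y ^+ b * bieval iota z g (bicomp a b F).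
Proof.
move=> hN; rewrite bievalE.
transitivity (\sum_(m <- msupp F) \sum_(a < N) \sum_(b < N)
    (if (deg1 m == a) && (deg2 m == b) then
       x ^+ a * (y ^+ b * bieval iota z g (F@_m *: 'X_[m])) else 0)).
  rewrite !big_seq; apply: eq_bigr => m mF; have [m1 m2] := hN m mF.
  rewrite (bigD1 (Ordinal m1)) //= [X in _ = _ + X]big1 ?addr0; last first.
    move=> a ne; apply: big1 => b _; rewrite (_ : (deg1 m == a) = false) //.
    by apply/negbTE; rewrite eq_sym.
  rewrite (bigD1 (Ordinal m2)) //= [X in _ = _ + X]big1 ?addr0; last first.
    move=> b ne; rewrite (_ : (deg2 m == b) = false) ?andbF //.
    by apply/negbTE; rewrite eq_sym.
  have eX u (w : 'I_n.+1 -> L) (k : 'I_n.+1 -> nat) :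
      \prod_i (u * w i) ^+ k i = u ^+ (\sum_i k i) * \prod_i w i ^+ k i.
    by rewrite -prodrXr -big_split; apply: eq_bigr => i _; rewrite exprMn.
  rewrite !eqxx /= bievalZ bievalX !eX -/(deg1 m) -/(deg2 m); ring.
rewrite exchange_big; apply: eq_bigr => a _; rewrite exchange_big mulr_sumr.
apply: eq_bigr => b _ /=; rewrite -big_mkcond /= -!mulr_sumr; congr (_ * (_ * _)).
by rewrite /bicomp raddf_sum.
Qed.

Lemma bicomp_bound F : exists N, forall m, m \in msupp F -> (deg1 m < N /\ deg2 m < N)%N.
Proof.
exists (\max_(m <- msupp F) (deg1 m + deg2 m)).+1 => m mF.
have : (deg1 m + deg2 m <= \max_(m <- msupp F) (deg1 m + deg2 m))%N.
  by apply: leq_bigmax_seq.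
by lia.
Qed.

(** As x and y vary, F(x z, y g) is a polynomial in x and y whose coefficients are the
    values of the components of F at (z, g). *)
Lemma vanish_bicomp z g F :
  (forall x y, x != 0 -> y != 0 -> bieval iota (fun i => x * z i) (fun i => y * g i) F = 0) ->
  forall a b, bieval iota z g (bicomp a b F) = 0.
Proof.
move=> h a b; have [N hN] := bicomp_bound F.
have [/andP[aN bN]|] := boolP ((a < N) && (b < N))%N; last first.
  rewrite negb_and -!leqNgt => hab; rewrite /bicomp big_seq_cond big1 ?raddf0 //.
  move=> m /andP[mF /andP[/eqP ma /eqP mb]]; have := hN m mF.
  by case/orP: hab; lia.
(* the factor 'X extends the vanishing from nonzero points to all natural numbers *)
have van (e : nat -> L) : (forall x, x != 0 -> \sum_(k < N) x ^+ k * e k = 0) ->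
    forall k, (k < N)%N -> e k = 0.
  move=> he k kN; pose P : {poly L} := \poly_(k < N) e k.
  suff P0 : P = 0 by have := coef_poly N e k; rewrite -/P P0 coef0 kN.
  have : forall x : nat, ('X * P).[x%:R] = 0.
    move=> x; rewrite !hornerE horner_poly.
    have [->|x0] := eqVneq (x%:R : L) 0; first by rewrite mul0r.
    rewrite [X in _ * X](_ : _ = 0) ?mulr0 // -[RHS](he x%:R) //.
    by apply: eq_bigr => j _; rewrite mulrC.
  by move/(poly_eq0_nat charL)/eqP; rewrite mulf_eq0 polyX_eq0 => /eqP.
apply: (van (fun b => bieval iota z g (bicomp a b F))) (bN) => // y y0.
apply: (van (fun a => \sum_(b < N) y ^+ b * bieval iota z g (bicomp a b F))) (aN) => // x x0.
by rewrite -bieval_scale // h.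
Qed.

Lemma bicomp_vanish z g F : (forall a b, bieval iota z g (bicomp a b F) = 0) ->
  forall x y, bieval iota (fun i => x * z i) (fun i => y * g i) F = 0.
Proof.
move=> h x y; have [N hN] := bicomp_bound F.
rewrite (bieval_scale _ _ _ _ hN) big1 // => a _; rewrite big1 ?mulr0 // => b _.
by rewrite h mulr0.
Qed.

Lemma evalPP_bieval F (f g : binform L n) :
  evalPP iota F f g = bieval iota (form_coord f) (form_coord g) F.
Proof. by rewrite /evalPP meval_map_mpoly. Qed.

Lemma form_coordZ c (f : binform L n) i : form_coord (c *: f) i = c * form_coord f i.
Proof. by rewrite /form_coord mcoeffZ. Qed.

Definition bicone (W : binform L n -> binform L n -> Prop) :=
  forall (f g : binform L n) (c c' : L), c != 0 -> c' != 0 -> W f g -> W (c *: f) (c' *: g).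

(** The closure is tested on bihomogeneous polynomials; on a bicone, vanishing of F is
    vanishing of all its components, so every polynomial can be used. *)
Lemma zclosure_vanish (W : binform L n -> binform L n -> Prop) F : bicone W ->
  (forall f g : binform L n, W f g -> bieval iota (form_coord f) (form_coord g) F = 0) ->
  forall f g : binform L n, zclosure iota W f g -> bieval iota (form_coord f) (form_coord g) F = 0.
Proof.
move=> cW h f g [_ _ cl].
have H := @bicomp_vanish (form_coord f) (form_coord g) F _ 1 1.
rewrite -[RHS]H; first by apply: eq_bieval => i; rewrite mul1r.
move=> a b; rewrite -evalPP_bieval; apply: cl; first exact: bicomp_bihomogeneous.
move=> f' g' W'; rewrite evalPP_bieval; apply: vanish_bicomp => x y x0 y0.
rewrite -[RHS](h (x *: f') (y *: g')); last exact: cW.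
by apply: eq_bieval => i; rewrite form_coordZ.
Qed.

End Bihomogeneous.

(** * Algebraic dependence by counting monomials *)

Section AlgebraicDependence.

Variables (K : fieldType) (d : nat).
Local Notation M := {mpoly K[d]}.

(** The degree of the zero polynomial is taken to be below every bound. *)
Definition deg_le N (p : M) := (msize p <= N.+1)%N.

Lemma deg_leM N N' p q : deg_le N p -> deg_le N' q -> deg_le (N + N') (p * q).
Proof.
rewrite /deg_le => hp hq; have [->|p0] := eqVneq p 0; first by rewrite mul0r mmeasure0.
have [->|q0] := eqVneq q 0; first by rewrite mulr0 mmeasure0.
rewrite msizeM //; move: hp hq; set a := mmeasure _ p; set b := mmeasure _ q; lia.
Qed.

Lemma deg_le_sum N (I : Type) (s : seq I) (P : pred I) (F : I -> M) :
  (forall i, P i -> deg_le N (F i)) -> deg_le N (\sum_(i <- s | P i) F i).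
Proof.
move=> h; rewrite /deg_le; elim/big_rec: _ => [|i p Pi hp]; first by rewrite mmeasure0.
by rewrite (leq_trans (mmeasureD_le _ _ _)) // geq_max hp andbT; exact: h.
Qed.

Lemma deg_leX N k p : deg_le N p -> deg_le (k * N) (p ^+ k).
Proof.
move=> h; elim: k => [|k IH]; first by rewrite /deg_le expr0 msize1.
by rewrite exprS mulSn; apply: deg_leM.
Qed.

(** The coefficients of a product of linear factors have bounded degree in its roots; a
    crude uniform bound suffices for counting. *)
Lemma deg_le_coef_prod_XsubX (e : 'I_d -> nat) k :
  deg_le (\sum_i e i) (\prod_i ('X - ('X_i : M)%:P) ^+ e i)`_k.
Proof.
pose pdle N (p : {poly M}) := forall k, deg_le N p`_k.
have pdleM N N' p q : pdle N p -> pdle N' q -> pdle (N + N')%N (p * q).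
  move=> hp hq j; rewrite coefM; apply: deg_le_sum => i _; exact: deg_leM.
have pdle1 : pdle 0%N 1.
  by move=> j; rewrite coef1 /deg_le; case: (j == 0%N); rewrite ?msize1 ?mmeasure0.
have pdleX (i : 'I_d) m : pdle m (('X - ('X_i : M)%:P) ^+ m).
  elim: m => [|m IH]; first by rewrite expr0.
  rewrite exprS; apply: (pdleM 1%N m) => // j.
  rewrite coefB coefX coefC /deg_le (leq_trans (mmeasureD_le _ _ _)) //.
  rewrite mmeasureN geq_max; apply/andP; split.
    by case: (j == 1%N); rewrite ?msize1 ?mmeasure0.
  by case: (j == 0%N); rewrite ?mmeasure0 // msizeX mdeg1.
suff : pdle (\sum_i e i)%N (\prod_i ('X - ('X_i : M)%:P) ^+ e i) by apply.
elim/big_rec2: _ => [|i N p _ hp]; first exact: pdle1.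
exact: pdleM.
Qed.

(** Exponents below D for d + 1 of the polynomials give D^(d+1) monomials, which the
    last polynomial completes to the same degree (d+1) D. They lie in a space of
    polynomials in d variables of degree at most T = B (d+1) D, of dimension at most (T
    + 1)^d, which is at most (c D)^d with c = B (d+1) + 1. Taking D = c^d + 1 gives more
    monomials than dimensions. Completing the degree makes the relation homogeneous. *)
Lemma algebraic_dependence B (y : 'I_d.+2 -> M) : (forall k, deg_le B (y k)) ->
  exists D (w : {ffun 'I_d.+1 -> 'I_D} -> K), (exists a, w a != 0) /\
    \sum_a w a *: ((\prod_k y (lift ord_max k) ^+ a k)
                   * y ord_max ^+ (d.+1 * D - \sum_k a k)) = 0.
Proof.
move=> yB; pose c := (B * d.+1 + 1)%N; pose D := (c ^ d).+1.
pose T := (B * (d.+1 * D))%N.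
pose A : finType := {ffun 'I_d.+1 -> 'I_D}.
pose C : finType := {ffun 'I_d -> 'I_T.+1}.
pose Y (a : A) := (\prod_k y (lift ord_max k) ^+ a k)
                   * y ord_max ^+ (d.+1 * D - \sum_k a k).
have aD (a : A) : (\sum_k a k <= d.+1 * D)%N.
  rewrite -[d.+1 in X in (_ <= X)%N]card_ord -sum_nat_const; apply: leq_sum => k _.
  exact: ltnW.
have YT a : deg_le T (Y a).
  have -> : T = (\sum_k a k * B + (d.+1 * D - \sum_k a k) * B)%N.
    by rewrite -big_distrl -mulnDl subnKC ?aD // mulnC.
  apply: deg_leM; last exact: deg_leX.
  elim/big_rec2: _ => [|k N p _ hp]; first by rewrite /deg_le msize1.
  by apply: deg_leM hp; exact: deg_leX.
pose N : 'M[K]_(#|A|, #|C|) :=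
  \matrix_(i, j) (Y (enum_val i))@_[multinom ((enum_val j : C) l : nat) | l < d].
have [v v0 vN] : exists2 v : 'rV[K]_#|A|, v != 0 & v *m N = 0.
  have : kermx N != 0.
    rewrite -mxrank_eq0 mxrank_ker subn_eq0 -ltnNge.
    apply: leq_ltn_trans (rank_leq_col _) _.
    rewrite !card_ffun !card_ord.
    have Tc : (T.+1 <= c * D)%N by rewrite /T /c; have : (0 < D)%N by []; nia.
    have Td : (T.+1 ^ d <= (c * D) ^ d)%N.
      by case: (posnP d) => [->|d0] //; rewrite leq_exp2r.
    apply: leq_ltn_trans Td _.
    by rewrite expnMn expnS ltn_pmul2r ?expn_gt0.
  move=> /rowV0Pn[v /sub_kermxP vN v0]; by exists v.
exists D, (fun a => v 0 (enum_rank (a : A))); split.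
  have [j vj] := rV0Pn _ v0; exists (enum_val j); by rewrite enum_valK.
rewrite -/Y; apply/mpolyP => m; rewrite mcoeff0 raddf_sum /=.
under eq_bigr do rewrite mcoeffZ.
have [mT|[i mi]] : (forall i, m i < T.+1)%N \/ exists i, (T < m i)%N.
- case: (boolP [forall i, (m i < T.+1)%N]) => [/forallP|/forallPn[i]]; first by left.
  by rewrite -leqNgt; right; exists i.
- pose b : C := [ffun i => Ordinal (mT i)].
  have eb : m = [multinom (b l : nat) | l < d] by apply/mnmP => l; rewrite mnmE ffunE.
  have := (matrixP _ _).2 vN 0 (enum_rank b); rewrite !mxE => e.
  rewrite -[RHS]e (reindex (@enum_rank A)) /=; last exact/onW_bij/enum_rank_bij.
  by apply: eq_bigr => a _; rewrite !mxE !enum_rankK eb.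
- rewrite big1 // => a _; rewrite -/(Y a) [X in _ * X]memN_msupp_eq0 ?mulr0 //.
  apply: msize_mdeg_ge; apply: leq_trans (YT a) _; apply: leq_trans mi _.
  by rewrite mdegE (bigD1 i) //= leq_addr.
Qed.

End AlgebraicDependence.

(** * The chain rule along polynomial curves *)

Section Gradient.

Variables (K L : fieldType) (iota : {rmorphism K -> L}) (m : nat).
Hypothesis charL : [pchar L] =i pred0.
Implicit Types (F : {mpoly K[m]}).

Let kappa : {rmorphism K -> {poly L}} := @polyC L \o iota.

Lemma mmap_horner (Q : 'I_m -> {poly L}) F e :
  (mmap kappa Q F).[e] = mmap iota (fun i => (Q i).[e]) F.
Proof.
rewrite mmap_sumE horner_sum; apply: eq_bigr => a _.
rewrite hornerM hornerC horner_prod; congr (_ * _).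
by apply: eq_bigr => i _; rewrite horner_exp.
Qed.

(** The chain rule. Both sides are derivations in F, so it suffices to check the
    variables. *)
Lemma deriv_mmap (Q : 'I_m -> {poly L}) F :
  (mmap kappa Q F)^`() = \sum_i mmap kappa Q F^`M(i) * (Q i)^`().
Proof.
pose good F := (mmap kappa Q F)^`() = \sum_i mmap kappa Q F^`M(i) * (Q i)^`().
have goodM G H : good G -> good H -> good (G * H).
  rewrite /good => hG hH; rewrite rmorphM /= derivM hG hH mulr_suml mulr_sumr -big_split.
  by apply: eq_bigr => i _; rewrite mderivM /= mmapD !rmorphM /=; ring.
have good1 : good 1.
  rewrite /good -mpolyC1 mmapC /= derivC big1 // => i _.
  by rewrite mderivC mmap0 mul0r.
have goodX i : good 'X_i.
  rewrite /good mmapX mmap1U (bigD1 i) //= big1 ?addr0.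
    rewrite mderivX mnm1E eqxx scale1r (_ : (U_(i) - U_(i))%MM = 0%MM).
      by rewrite mpolyX0 -mpolyC1 mmapC /= rmorph1 mul1r.
    by apply/mnmP => j; rewrite mnmBE subnn mnm0E.
  move=> j ji; rewrite mderivX mnm1E eq_sym (negbTE ji) scale0r.
  by rewrite mmap0 mul0r.
elim/mpolyind: F => [|c a F _ _ IH].
  by rewrite mmap0 deriv0 big1 // => i _; rewrite mderiv0 mmap0 mul0r.
rewrite mmapD derivD IH.
under [RHS]eq_bigr do rewrite mderivD mmapD mulrDl.
rewrite big_split; congr (_ + _); rewrite mmapZ /= derivM derivC mul0r add0r.
under [RHS]eq_bigr do rewrite mderivZ mmapZ -mulrA.
rewrite -mulr_sumr; congr (_ * _); rewrite -/(good _) mpolyXE_id.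
elim/big_ind: _ => // i _; elim: (a i) => [|k IHk]; first by rewrite expr0.
by rewrite exprS; apply: goodM.
Qed.

(** The chain rule at the origin of the curve e -> sum_a e^a w_a, on which F vanishes.
    Vanishing at the natural numbers suffices, and is easier to establish than an
    identity in the variable e. *)
Lemma curve_gradient (N : nat) (w : nat -> 'I_m -> L) F :
  (forall k : nat, mmap iota (fun i => \sum_(a < N.+2) k%:R ^+ a * w a i) F = 0) ->
  \sum_i mmap iota (w 0%N) F^`M(i) * w 1%N i = 0.
Proof.
move=> h; pose Q i : {poly L} := \poly_(a < N.+2) w a i.
have Q0 : mmap kappa Q F = 0.
  apply: (poly_eq0_nat charL) => k; rewrite mmap_horner -[RHS](h k).
  apply: eq_mmap => i; rewrite horner_poly; apply: eq_bigr => a _; exact: mulrC.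
have := congr1 (fun p : {poly L} => p.[0]) (deriv_mmap Q F).
rewrite Q0 deriv0 horner0 horner_sum => e; rewrite [RHS]e; apply: eq_bigr => i _.
rewrite hornerM mmap_horner; congr (_ * _).
  by apply: eq_mmap => j; rewrite horner_coef0 coef_poly.
by rewrite horner_coef0 coef_deriv coef_poly.
Qed.

End Gradient.

(** * Equations of the multiple root locus *)

Section DeltaDimension.

Variables (K : fieldType) (L : closedFieldType) (iota : {rmorphism K -> L}).
Variables (n : nat) (lam : seq nat).
Hypothesis lamP : is_partition n lam.
Hypothesis charK : [pchar K] =i pred0.
Local Notation d := (size lam).
Implicit Types (i : 'I_d) (r s t : 'I_d -> L) (F : {mpoly K[n.+1]}) (p u : {poly L}).

Lemma pchar_codomain0 : [pchar L] =i pred0.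
Proof. by move=> q; rewrite -charK; exact: (fmorph_pchar iota). Qed.

Let charL := pchar_codomain0.

Definition root_poly r : {poly L} := root_prod r (fun i => part lam i).
(** Its multiples by polynomials of degree at most d form the affine tangent space at
    root_poly r, for distinct roots. *)
Definition reduced_poly r : {poly L} := root_prod r (fun i => part lam i - 1)%N.

Definition coord_eval F p : L := mmap iota (fun i : 'I_n.+1 => p`_(n - i)) F.

Lemma evalP_coord_eval F (f : binform L n) : evalP iota F f = coord_eval F (dehom (val f)).
Proof.
by rewrite /evalP meval_map_mpoly; apply: eq_mmap => i; rewrite form_coordE.
Qed.

Lemma coord_eval_homog e F c p : F \is e.-homog -> coord_eval F (c *: p) = c ^+ e * coord_eval F p.
Proof.
move=> /dhomogP hF; rewrite /coord_eval !mmap_sumE mulr_sumr !big_seq; apply: eq_bigr => a aF.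
rewrite mulrCA; congr (_ * _); rewrite -(hF a aF) /= mdegE -prodrXr -big_split.
by apply: eq_bigr => i _ /=; rewrite coefZ exprMn.
Qed.

(** For homogeneous F, membership in the ideal of Delta, tested only at monic
    polynomials; see ideal_vanish and vanish_ideal. *)
Definition vanish F := forall r, coord_eval F (root_poly r) = 0.

Lemma size_root_poly r : size (root_poly r) = n.+1.
Proof. by rewrite size_root_prod (sum_part lamP). Qed.

Lemma size_reduced_poly r : size (reduced_poly r) = (n - d).+1.
Proof.
rewrite size_root_prod; congr _.+1.
have : (\sum_(i < d) (part lam i - 1) + d = n)%N.
  rewrite -(sum_part lamP) -[X in (_ + X)%N]card_ord -sum1_card -big_split /=.
  by apply: eq_bigr => i _; have := part_gt0 lamP i; lia.
by move=> e; rewrite -[X in (X - d)%N]e addnK.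
Qed.

Lemma d_le_n : (d <= n)%N.
Proof.
have : (\sum_(i < d) 1 <= \sum_(i < d) part lam i)%N.
  by apply: leq_sum => i _; exact: (part_gt0 lamP).
by rewrite (sum_part lamP) sum_nat_const card_ord muln1.
Qed.

Lemma Delta_root_poly c r : c != 0 -> Delta lam (form_of n (c *: root_poly r)).
Proof.
move=> c0; exists (fun i => (r i, 1)); split.
  by move=> i; rewrite pair_neq0 oner_neq0 orbT.
apply/(projeq_dehom _ (f_param_homog lamP _)); exists c => //.
rewrite dehom_form_of; last by rewrite (leq_trans (size_scale_leq _ _)) ?size_root_poly.
by rewrite dehom_f_param f_poly_monic.
Qed.

Lemma ideal_vanish F : in_ideal iota (Delta lam) F -> vanish F.
Proof.
move=> [_ h] r; have := h _ (Delta_root_poly r (oner_neq0 _)).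
by rewrite evalP_coord_eval dehom_form_of ?scale1r // size_root_poly.
Qed.

(** The vector space of all parameters (s_i, t_i, h_i), on which density arguments take
    place. The degree of h_i is not restricted: jet_form truncates it instead, linearly. *)
Definition param_space := {ffun 'I_d -> (L^o * L^o) * {poly L}}.

Definition root_s (v : param_space) i : L := (v i).1.1.
Definition root_t (v : param_space) i : L := (v i).1.2.
Definition jet_form (v : param_space) i : {poly L} := take_poly (part lam i - 1) (v i).2.

Lemma regular_root_s i : regular (fun v => root_s v i).
Proof. by apply: regular_lin => v w e; rewrite /root_s ffunE ffunE. Qed.

Lemma regular_root_t i : regular (fun v => root_t v i).
Proof. by apply: regular_lin => v w e; rewrite /root_t ffunE ffunE. Qed.

Lemma pregular_jet_form i : pregular (fun v => jet_form v i).
Proof.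
move=> k; apply: regular_lin => v w e.
by rewrite /jet_form !ffunE /= take_polyD take_polyZ coefD coefZ.
Qed.

Lemma pregular_f_poly : pregular (fun v => f_poly (root_s v) (root_t v)).
Proof.
apply: pregular_prod => i; apply: pregularX; apply: pregularD.
  by apply: pregularZ; [exact: regular_root_t | exact: pregular_cst].
by apply: pregularN; apply: pregularC; exact: regular_root_s.
Qed.

Lemma pregular_g_poly : pregular (fun v => g_poly n (root_s v) (root_t v) (jet_form v)).
Proof.
apply: pregular_sum => i; apply: pregularM; last exact: pregular_jet_form.
apply: pregularX; apply: pregularD.
  by apply: pregularZ; [exact: regular_root_s | exact: pregular_cst].
by apply: pregularC; exact: regular_root_t.
Qed.

Lemma regular_mmap m (F : {mpoly K[m]}) (V : lmodType L) (phi : V -> 'I_m -> L) :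
  (forall k, regular (fun v => phi v k)) -> regular (fun v => mmap iota (phi v) F).
Proof.
move=> h; apply: eq_regular (regular_meval (map_mpoly iota F) h) => v.
by rewrite meval_map_mpoly.
Qed.

Lemma regular_coord_eval F (V : lmodType L) (P : V -> {poly L}) :
  pregular P -> regular (fun v => coord_eval F (P v)).
Proof. by move=> h; apply: regular_mmap => i; exact: h. Qed.

(** Forms that have no root at infinity, and hence are multiples of monic polynomials,
    are dense. *)
Lemma vanish_f_poly e F s t c : F \is e.-homog -> vanish F -> coord_eval F (c *: f_poly s t) = 0.
Proof.
move=> hF vF.
pose v0 : param_space := [ffun i => ((s i, t i), 0)].
suff : forall v : param_space, coord_eval F (c *: f_poly (root_s v) (root_t v)) = 0.
  move=> /(_ v0) <-; congr (coord_eval F (c *: _)); apply: eq_bigr => i _.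
  by rewrite /root_s /root_t ffunE.
apply: (@regular_dense _ _ charL _ (fun v : param_space => \prod_i root_t v i)).
- by apply: regular_coord_eval; apply: pregularZ; [exact: regular_cst | exact: pregular_f_poly].
- by apply: regular_prod => i; exact: regular_root_t.
- exists [ffun i => ((0, 1), 0)]; apply/prodf_neq0 => i _.
  by rewrite /root_t ffunE oner_neq0.
move=> v /prodf_neq0 hv; rewrite f_poly_chart; last by move=> i; exact: hv.
by rewrite scalerA (coord_eval_homog _ _ hF) vF mulr0.
Qed.

Lemma vanish_ideal e F : F \is e.-homog -> vanish F -> in_ideal iota (Delta lam) F.
Proof.
move=> hF vF; split; first by exists e.
move=> f [p [_ /(projeq_dehom _ (f_param_homog lamP p))[c _ ef]]].
by rewrite evalP_coord_eval ef dehom_f_param (vanish_f_poly _ _ _ hF).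
Qed.

End DeltaDimension.

(** * Partial derivatives in characteristic zero *)

Section Derivatives.

Variables (K : fieldType) (m : nat).
Implicit Types (F : {mpoly K[m]}) (J : {set 'I_m}).

Definition supp_in J F := forall a, a \in msupp F -> forall k, k \notin J -> a k = 0%N.

Lemma supp_inP J F : supp_in J F <-> forall (a : 'X_{1..m}) k, k \notin J -> (0 < a k)%N ->
  F@_a = 0.
Proof.
split=> [h a k kJ ak|h a aF k kJ].
  by apply/eqP; rewrite mcoeff_eq0; apply: contraL ak => aF; rewrite (h a aF k kJ).
apply/eqP; rewrite -leqn0 leqNgt; apply: contraL aF => ak.
by rewrite mcoeff_msupp (h a k) ?eqxx.
Qed.

Lemma supp_in_deriv J F k : supp_in J F -> supp_in J F^`M(k).
Proof.
move=> /supp_inP h; apply/supp_inP => a j jJ aj.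
by rewrite mcoeff_deriv (h _ j) ?mul0rn // mnmDE; lia.
Qed.

Lemma supp_in_deriv0 J F k : supp_in J F -> k \notin J -> F^`M(k) = 0.
Proof.
move=> /supp_inP h kJ; apply/mpolyP => a.
by rewrite mcoeff_deriv mcoeff0 (h _ k) ?mul0rn // mnmDE mnm1E eqxx; lia.
Qed.

Lemma dhomog_deriv e F k : F \is e.-homog -> F^`M(k) \is e.-1.-homog.
Proof.
move=> hF; apply/dhomogP => a; rewrite mcoeff_msupp mcoeff_deriv => h.
have : F@_(a + U_(k)) != 0 by apply: contraNneq h => ->; rewrite mul0rn.
rewrite -mcoeff_msupp => /(dhomog_mf hF) /= <-.
by rewrite mdegD mdeg1 addn1.
Qed.

Hypothesis charK : [pchar K] =i pred0.

Lemma coef_deriv_eq0 F k (a : 'X_{1..m}) : F^`M(k) = 0 -> (0 < a k)%N -> F@_a = 0.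
Proof.
move=> F0 ak; have := mcoeff_deriv k (a - U_(k)) F.
rewrite F0 mcoeff0 submK; last by rewrite lep1mP -lt0n.
move/esym/eqP; rewrite -mulr_natr mulf_eq0 => /orP[/eqP//|].
by rewrite (negbTE (natr_neq0 charK _)).
Qed.

Lemma deriv_eq0_supp F J k : supp_in (k |: J) F -> F^`M(k) = 0 -> supp_in J F.
Proof.
move=> /supp_inP h F0; apply/supp_inP => a j jJ aj.
have [jk|jk] := eqVneq j k; last by apply: (h _ j) => //; rewrite !inE negb_or jk.
by apply: (coef_deriv_eq0 F0); rewrite -jk.
Qed.

Lemma derivs_eq0 F : (forall k, F^`M(k) = 0) -> F = (F@_0%MM)%:MP.
Proof.
move=> h; apply/mpolyP => a; rewrite mcoeffC.
have [->|a0] := eqVneq a 0%MM; first by rewrite mulr1.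
rewrite mulr0; have [k ak] : exists k, (0 < a k)%N.
  apply: NNPP => N; move/negP: a0; apply; apply/eqP/mnmP => k; rewrite mnm0E.
  by apply/eqP; rewrite -leqn0 leqNgt; apply/negP => ak; apply: N; exists k.
exact: (coef_deriv_eq0 (h k)).
Qed.

End Derivatives.

(** * Algebraic independence of coordinates on the multiple root locus *)

Section Independence.

Variables (K : fieldType) (L : closedFieldType) (iota : {rmorphism K -> L}).
Variables (n : nat) (lam : seq nat).
Hypothesis lamP : is_partition n lam.
Hypothesis charK : [pchar K] =i pred0.
Local Notation d := (size lam).
Implicit Types (i : 'I_d) (r s t : 'I_d -> L) (F : {mpoly K[n.+1]}) (p u : {poly L}).

Let charL : [pchar L] =i pred0 := pchar_codomain0 iota charK.
Let natL k : (0 < k)%N -> k%:R != 0 :> L := natr_neq0 charL (k := k).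

Definition dir_deriv F p u : L := \sum_k coord_eval iota F^`M(k) p * u`_(n - k).

Lemma dir_derivD F p u u' : dir_deriv F p (u + u') = dir_deriv F p u + dir_deriv F p u'.
Proof. by rewrite /dir_deriv -big_split; apply: eq_bigr => k _; rewrite coefD mulrDr. Qed.

Lemma dir_derivZ F p c u : dir_deriv F p (c *: u) = c * dir_deriv F p u.
Proof. by rewrite /dir_deriv mulr_sumr; apply: eq_bigr => k _; rewrite coefZ mulrCA. Qed.

Lemma dir_deriv_sum F p (I : finType) (u : I -> {poly L}) :
  dir_deriv F p (\sum_j u j) = \sum_j dir_deriv F p (u j).
Proof.
apply: (big_morph _ (dir_derivD F p)).
by rewrite /dir_deriv big1 // => k _; rewrite coef0 mulr0.
Qed.

Lemma curve_deriv N (w : nat -> {poly L}) F :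
  (forall k : nat, coord_eval iota F (\sum_(a < N.+2) k%:R ^+ a *: w a) = 0) ->
  dir_deriv F (w 0%N) (w 1%N) = 0.
Proof.
move=> h; apply: (curve_gradient charL (N := N)
  (w := fun a (k : 'I_n.+1) => (w a)`_(n - k))) => k.
rewrite -[RHS](h k); apply: eq_mmap => j; rewrite coef_sum.
by apply: eq_bigr => a _; rewrite coefZ.
Qed.

(** The curve is the line through 0 and f, along which a homogeneous F keeps vanishing. *)
Lemma deriv_scale e F r : F \is e.-homog -> vanish iota lam F ->
  dir_deriv F (root_poly r) (root_poly r) = 0.
Proof.
move=> hF vF; apply: (@curve_deriv 0 (fun=> root_poly r)) => k.
rewrite -scaler_suml (coord_eval_homog _ _ _ hF) vF mulr0 //.
Qed.

(** The curve replaces r_i by r_i + e. Its linear term is - lambda_i (X - r_i)^(lambda_i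
    - 1) times the other factors, and lambda_i is invertible in characteristic zero. *)
Lemma deriv_move_root F r i : vanish iota lam F ->
  dir_deriv F (root_poly r) (root_prod r (drop_roots 1 i)) = 0.
Proof.
move=> vF; pose Q := \prod_(j | j != i) ('X - (r j)%:P) ^+ part lam j.
pose w a := (-1) ^+ a *: (('X - (r i)%:P) ^+ (part lam i - a) * Q) *+ 'C(part lam i, a).
have pi0 := part_gt0 lamP i.
have := @curve_deriv (part lam i).-1 w F.
have -> : w 0%N = root_poly r.
  by rewrite /w bin0 mulr1n expr0 scale1r subn0 /root_poly /root_prod (bigD1 i).
have -> : w 1%N = - (part lam i)%:R *: root_prod r (drop_roots 1 i).
  rewrite /w bin1 expr1 -scaler_nat scalerA mulrN1; congr (_ *: _).
  rewrite /root_prod [RHS](bigD1 i) //= /drop_roots eqxx mul1n; congr (_ * _).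
  by apply: eq_bigr => j ji; rewrite (negbTE ji) subn0.
rewrite dir_derivZ => H; apply/eqP.
have : - (part lam i)%:R != 0 :> L by rewrite oppr_eq0 natL.
move=> c0; rewrite -(mulrI_eq0 _ (mulfI c0)); apply/eqP; apply: H => k.
have -> : \sum_(a < (part lam i).-1.+2) k%:R ^+ a *: w a
    = root_poly (fun j => if j == i then r i + k%:R else r j).
  rewrite /root_poly /root_prod (bigD1 i) //= eqxx.
  have -> : \prod_(j | j != i) ('X - (if j == i then r i + k%:R else r j)%:P) ^+ part lam j = Q.
    by apply: eq_bigr => j ji; rewrite (negbTE ji).
  rewrite prednK // polyCD opprD addrA exprDn mulr_suml; apply: eq_bigr => a _.
  rewrite /w -scalerMnr mulrnAl; congr (_ *+ _).
  rewrite -!mul_polyC -[- (k%:R)%:P]polyCN -[_%:P ^+ a]polyC_exp (exprNn k%:R) polyCM.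
  by move: (_ ^+ (part lam i - a)) => A; ring.
exact: vF.
Qed.

Lemma deriv_along_reduced e F r u : F \is e.-homog -> vanish iota lam F -> injective r ->
  (size u <= d.+1)%N -> dir_deriv F (root_poly r) (reduced_poly r * u) = 0.
Proof.
move=> hF vF inj su; have [c0 [c ->]] := tangent_span lamP inj su.
rewrite dir_derivD dir_derivZ (deriv_scale _ hF vF) mulr0 add0r dir_deriv_sum.
by rewrite big1 // => i _; rewrite dir_derivZ deriv_move_root ?mulr0.
Qed.

(** Division with remainder by reduced_poly r, which has degree n - d: the remainder
    does not reach the coefficients of X^(n-j) with j at most d. So the first d + 1
    coordinates are coordinates on the space of tangent directions. *)
Lemma reduced_top_coords r p : (size p <= n.+1)%N -> exists2 u : {poly L}, (size u <= d.+1)%N &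
  forall j, (j <= d)%N -> (reduced_poly r * u)`_(n - j) = p`_(n - j).
Proof.
move=> sp; have mt : reduced_poly r \is monic by exact: root_prod_monic.
have st : size (reduced_poly r) = (n - d).+1 by rewrite (size_reduced_poly lamP).
have dn := d_le_n lamP.
exists (p %/ reduced_poly r).
  rewrite size_divp ?monic_neq0 // st /=.
  by move: sp; set a := size p; lia.
move=> j jd; rewrite [in RHS](divp_eq p (reduced_poly r)) coefD mulrC.
rewrite [X in _ = _ + X]nth_default ?addr0 //.
have := ltn_modp p (reduced_poly r); rewrite monic_neq0 // st ltnS => /leq_trans; apply.
by lia.
Qed.

Definition top_coords : {set 'I_n.+1} := [set k : 'I_n.+1 | k <= d]%N.

Lemma regular_root_poly F : regular (fun v : {ffun 'I_d -> L^o} => coord_eval iota F (root_poly v)).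
Proof.
apply: regular_coord_eval; apply: pregular_prod => i; apply: pregularX; apply: pregularD.
  exact: pregular_cst.
apply: pregularN; apply: pregularC; apply: regular_lin => v w e.
by rewrite !ffunE.
Qed.

(** Tuples of distinct roots are dense. *)
Lemma vanish_generic F : (forall r, injective r -> coord_eval iota F (root_poly r) = 0) ->
  vanish iota lam F.
Proof.
move=> h r.
pose psi (v : {ffun 'I_d -> L^o}) : L := \prod_i \prod_(j | j != i) (v i - v j).
suff H : forall v : {ffun 'I_d -> L^o}, coord_eval iota F (root_poly v) = 0.
  rewrite -[RHS](H (finfun r)); congr (coord_eval iota F _); apply: eq_bigr => i _;
    by rewrite ffunE.
apply: (@regular_dense _ _ charL _ psi); first exact: regular_root_poly.
- apply: regular_prod => i; apply: regular_prod => j; apply: regular_lin => v w e.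
  by rewrite !ffunE mulrBr opprD !addrA; congr (_ - _); rewrite addrAC.
- exists [ffun i : 'I_d => (i : nat)%:R]; apply/prodf_neq0 => i _.
  apply/prodf_neq0 => j ji; rewrite !ffunE subr_eq0; apply: contra ji => /eqP/(natr_inj charL).
  by move/val_inj => ->.
move=> v /prodf_neq0 hv; apply: h => i j eij; apply/eqP/negPn/negP => ij.
have /prodf_neq0/(_ i) := hv j isT; rewrite ij eij subrr eqxx.
by move=> /(_ isT).
Qed.

(** Along the tangent direction whose first d + 1 coordinates are those of the k-th
    basis vector, the derivative of F is its k-th partial derivative. So every partial
    derivative of a relation is again a relation, of smaller degree, and is zero by
    induction; then F is constant, of positive degree. *)
Lemma top_coords_independent e F : F \is e.-homog -> vanish iota lam F -> supp_in top_coords F ->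
  F = 0.
Proof.
elim: e F => [|e IH] F hF vF sF.
  have F0 : F = (F@_0%MM)%:MP.
    apply/mpolyP => a; rewrite mcoeffC; have [->|a0] := eqVneq a 0%MM; first by rewrite mulr1.
    by rewrite mulr0 (dhomog_nemf_coeff hF) //= mdeg_eq0.
  have := vF (fun=> 0); rewrite F0 /coord_eval mmapC => /eqP.
  by rewrite fmorph_eq0 => /eqP ->.
have F0 : F = (F@_0%MM)%:MP.
  apply: (derivs_eq0 charK) => k.
  have [kt|kt] := boolP (k \in top_coords); last exact: supp_in_deriv0 sF kt.
  apply: IH; [exact: dhomog_deriv hF | | exact: supp_in_deriv].
  apply: vanish_generic => r inj.
  have kd : (k <= d)%N by rewrite inE in kt.
  have [|u su hu] := @reduced_top_coords r 'X^(n - k); first by rewrite size_polyXn; lia.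
  rewrite -[RHS](deriv_along_reduced hF vF inj su) /dir_deriv (bigD1 k) //= hu // coefXn eqxx mulr1.
  rewrite big1 ?addr0 // => j jk.
  have [jt|jt] := boolP (j \in top_coords); last first.
    by rewrite (supp_in_deriv0 sF jt) /coord_eval mmap0 mul0r.
  rewrite hu; last by rewrite inE in jt.
  rewrite coefXn (_ : (n - j == n - k)%N = false) ?mulr0 //.
  apply/negbTE; apply: contra jk => /eqP e'; apply/eqP/val_inj => /=.
  by have := ltn_ord j; have := ltn_ord k; lia.
have := dhomog_nemf_coeff hF (m := 0%MM); rewrite /= mdeg0 => /(_ isT) e0.
by rewrite F0 e0 mpolyC0.
Qed.

(** The coordinates on Delta are polynomials in d roots, so algebraic_dependence gives a
    homogeneous relation. *)
Lemma coords_dependent (J : {set 'I_n.+1}) : (d.+2 <= #|J|)%N ->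
  exists e F, [/\ F != 0, F \is e.-homog, vanish iota lam F & supp_in J F].
Proof.
move=> dJ.
pose j (k : 'I_d.+2) : 'I_n.+1 := enum_val (widen_ord dJ k).
have jJ k : j k \in J by exact: enum_valP.
have jinj : injective j by move=> k l /enum_val_inj/(congr1 val)/= /val_inj.
pose P : {poly {mpoly K[d]}} := \prod_(i < d) ('X - ('X_i)%:P) ^+ part lam i.
have yB k : deg_le n (P`_(n - j k)).
  by rewrite -[n in deg_le n](sum_part lamP); exact: deg_le_coef_prod_XsubX.
have [D [w [[a0 wa0] rel]]] := algebraic_dependence yB.
pose e := (d.+1 * D)%N.
have aD (a : {ffun 'I_d.+1 -> 'I_D}) : (\sum_k a k <= e)%N.
  rewrite /e -[d.+1 in X in (_ <= X)%N]card_ord -sum_nat_const; apply: leq_sum => k _.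
  exact: ltnW.
pose mono (a : {ffun 'I_d.+1 -> 'I_D}) : 'X_{1..n.+1} :=
  ((\sum_k U_(j (lift ord_max k)) *+ a k) + U_(j ord_max) *+ (e - \sum_k a k))%MM.
have monoE a k : mono a (j (lift ord_max k)) = a k.
  rewrite mnmDE mnm_sumE mulmnE mnm1E (inj_eq jinj) (negbTE (neq_lift _ _)) addn0.
  rewrite (bigD1 k) //= mulmnE mnm1E eqxx mul1n big1 ?addn0 // => l lk.
  by rewrite mulmnE mnm1E (inj_eq jinj) (inj_eq lift_inj) (negbTE lk).
have mono_inj : injective mono.
  by move=> a b ab; apply/ffunP => k; apply/val_inj; rewrite /= -!monoE ab.
exists e, (\sum_a w a *: 'X_[mono a]); split.
- apply: contraNneq wa0 => /(congr1 (mcoeff (mono a0))).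
  rewrite mcoeff0 raddf_sum /= (bigD1 a0) //= mcoeffZ mcoeffX eqxx mulr1.
  rewrite big1 ?addr0 => [->//|a aa0].
  by rewrite mcoeffZ mcoeffX (inj_eq mono_inj) (negbTE aa0) mulr0.
- apply: rpred_sum => a _; apply: rpredZ; rewrite dhomogX /= mdegD mdegMn mdeg1 mul1n.
  rewrite mdeg_sum (eq_bigr (fun k => a k : nat)) ?subnKC //.
  by move=> k _; rewrite mdegMn mdeg1 mul1n.
- move=> r.
  have eP : map_poly (mmap iota r) P = root_poly r.
    rewrite rmorph_prod; apply: eq_bigr => i _; rewrite rmorphXn rmorphB /=.
    by rewrite map_polyX map_polyC /= mmapX mmap1U.
  have ev k : mmap iota r P`_k = (root_poly r)`_k by rewrite -eP coef_map.
  rewrite -[RHS](rmorph0 (mmap iota r)) -rel /coord_eval !rmorph_sum; apply: eq_bigr => a _ /=.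
  rewrite !mmapZ; congr (_ * _); rewrite /mono mpolyXD !rmorphM /=.
  rewrite -mpolyXn !rmorphXn /= mmapXU ev; congr (_ * _).
  rewrite -mprodXnE !rmorph_prod; apply: eq_bigr => k _ /=.
  by rewrite !rmorphXn /= mmapXU ev.
apply/supp_inP => a k kJ ak; rewrite raddf_sum big1 // => b _ /=.
rewrite mcoeffZ mcoeffX; case: eqP => [e'|]; last by rewrite mulr0.
have neq l : (j l == k) = false by apply: contraNF kJ => /eqP <-.
move: ak; rewrite -e' mnmDE mnm_sumE mulmnE mnm1E neq addn0 big1 // => l _.
by rewrite mulmnE mnm1E neq.
Qed.

(** A nonzero relation F between the first d + 1 coordinates and the k-th one exists. If
    its partial derivative in the k-th variable vanishes on Delta, that derivative is
    another relation of smaller degree, and it is nonzero because otherwise F would be a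
    relation between independent coordinates. The descent stops. *)
Lemma separating_relation (k : 'I_n.+1) : k \notin top_coords ->
  exists e F, [/\ F \is e.-homog, vanish iota lam F, supp_in (k |: top_coords) F
                & exists r, coord_eval iota F^`M(k) (root_poly r) != 0].
Proof.
move=> kt.
have [|e [F [F0 hF vF sF]]] := @coords_dependent (k |: top_coords).
  rewrite cardsU1 kt add1n ltnS; have dn := d_le_n lamP.
  have inj : injective (fun i : 'I_d.+1 => inord i : 'I_n.+1).
    move=> x y /(congr1 val); rewrite /= !inordK; [exact: val_inj | |];
    by have := ltn_ord x; have := ltn_ord y; lia.
  rewrite -[d.+1]card_ord -(card_imset _ inj) subset_leq_card //.
  apply/subsetP => _ /imsetP[x _ ->]; rewrite inE inordK; by have := ltn_ord x; lia.
have descent e' G : G \is e'.-homog -> G != 0 -> vanish iota lam G -> supp_in (k |: top_coords) G ->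
    (exists r, coord_eval iota G^`M(k) (root_poly r) != 0) \/
      (vanish iota lam G^`M(k) /\ G^`M(k) != 0).
  move=> hG G0 vG sG; have [vk|vk] := classic (vanish iota lam G^`M(k)); last first.
    left; apply: NNPP => N; apply: vk => r; apply/eqP/negPn/negP => h.
    by apply: N; exists r.
  right; split=> //; apply: contraNneq G0 => dG0.
  exact/eqP/(top_coords_independent hG vG)/(deriv_eq0_supp charK sG dG0).
elim: e F F0 hF vF sF => [|e IH] F F0 hF vF sF.
  have [ex|[_]] := descent _ _ hF F0 vF sF; first by exists 0%N, F.
  have e0 : F = (F@_0%MM)%:MP.
    apply/mpolyP => a; rewrite mcoeffC; have [->|a0] := eqVneq a 0%MM; first by rewrite mulr1.
    by rewrite mulr0 (dhomog_nemf_coeff hF) //= mdeg_eq0.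
  by rewrite e0 mderivC eqxx.
have [ex|[vk k0]] := descent _ _ hF F0 vF sF; first by exists e.+1, F.
exact: (IH _ k0 (dhomog_deriv k hF) vk (supp_in_deriv sF)).
Qed.

End Independence.

(** * Annihilators of an arbitrary set of vectors *)

Section SpanOfPredicate.

Variables (F : fieldType) (m : nat) (S : 'rV[F]_m -> Prop).

(** A subset given by a mere predicate has a finite spanning family: rows are added as
    long as the rank grows. *)
Lemma rows_spanning : exists N (A : 'M[F]_(N, m)),
  (forall k, S (row k A)) /\ (forall s, S s -> (s <= A)%MS).
Proof.
suff H : forall b N (A : 'M[F]_(N, m)), (forall k, S (row k A)) -> (m - \rank A <= b)%N ->
    exists N (A : 'M[F]_(N, m)), (forall k, S (row k A)) /\ (forall s, S s -> (s <= A)%MS).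
  by apply: (H m 0%N 0); [case | rewrite leq_subr].
elim=> [|b IH] N A SA hb.
  exists N, A; split=> // s _; apply: submx_full; rewrite /row_full eqn_leq rank_leq_col.
  by rewrite -subn_eq0 -leqn0.
have [all_in|] := classic (forall s, S s -> (s <= A)%MS); first by exists N, A.
move=> H; have [s [Ss sA]] : exists s, S s /\ ~~ (s <= A)%MS.
  apply: NNPP => N'; apply: H => s Ss; apply: NNPP => N''; apply: N'; exists s; split=> //.
  exact/negP.
apply: (IH _ (col_mx A s)) => [k|].
  case: (splitP k) => j ej.
    by rewrite (_ : k = lshift 1 j) ?rowKu //; exact: val_inj.
  rewrite (_ : k = rshift N j); last exact: val_inj.
  by rewrite rowKd (_ : row j s = s) //; apply/rowP => l; rewrite mxE (ord1 j).
have lt : (\rank A < \rank (col_mx A s))%N.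
  apply: rank_ltmx; rewrite ltmxE; apply/andP; split; first by rewrite -addsmxE addsmxSl.
  by rewrite col_mx_sub negb_and sA orbT.
by have := rank_leq_col (col_mx A s); lia.
Qed.

(** Double annihilator: a functional that vanishes wherever all the elements of S vanish
    is a combination of finitely many elements of S. *)
Lemma annihilator_combination (x : 'rV[F]_m) :
  (forall h : 'I_m -> F, (forall s, S s -> \sum_k s 0 k * h k = 0) ->
     \sum_k x 0 k * h k = 0) ->
  exists N (A : 'M[F]_(N, m)) (a : 'I_N -> F),
    (forall j, S (row j A)) /\ forall k, x 0 k = \sum_j a j * A j k.
Proof.
move=> hx; have [N [A [SA hA]]] := rows_spanning.
have /submxP[D eD] : (x <= A)%MS.
  rewrite submxE; apply/eqP/rowP => y; rewrite !mxE.
  apply: (hx (fun k => cokermx A k y)) => s Ss.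
  have := hA s Ss; rewrite submxE => /eqP/rowP/(_ y).
  by rewrite !mxE.
exists N, A, (fun j => D 0 j); split=> // k.
by rewrite eD mxE.
Qed.

End SpanOfPredicate.

(** * Smooth points, tangent spaces and conormal vectors *)

Section Smoothness.

Variables (K : fieldType) (L : closedFieldType) (iota : {rmorphism K -> L}).
Variables (n : nat) (lam : seq nat).
Hypothesis lamP : is_partition n lam.
Hypothesis charK : [pchar K] =i pred0.
Local Notation d := (size lam).
Implicit Types (i : 'I_d) (r s t : 'I_d -> L) (F : {mpoly K[n.+1]}) (p u : {poly L}).

Let charL : [pchar L] =i pred0 := pchar_codomain0 iota charK.

Lemma evalP_gradient F (f h : binform L n) :
  \sum_(k < n.+1) evalP iota F^`M(k) f * form_coord h k
  = dir_deriv iota F (dehom (val f)) (dehom (val h)).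
Proof. by apply: eq_bigr => k _; rewrite evalP_coord_eval form_coordE. Qed.

Lemma dir_deriv_homog e F c p u : F \is e.-homog ->
  dir_deriv iota F (c *: p) u = c ^+ e.-1 * dir_deriv iota F p u.
Proof.
move=> hF; rewrite /dir_deriv mulr_sumr; apply: eq_bigr => k _.
by rewrite (coord_eval_homog _ _ _ (dhomog_deriv k hF)) mulrA.
Qed.

Lemma Delta_has_dim : has_proj_dim iota (Delta lam : binform L n -> Prop) d.
Proof.
split.
  exists (top_coords n lam).
    move=> F iF sF; have [[e hF] _] := iF.
    exact: (top_coords_independent lamP charK hF (ideal_vanish lamP iF)).
  have dn := d_le_n lamP.
  have inj : injective (fun i : 'I_d.+1 => inord i : 'I_n.+1).
    move=> x y /(congr1 val); rewrite /= !inordK; [exact: val_inj | |];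
    by have := ltn_ord x; have := ltn_ord y; lia.
  rewrite -[RHS]card_ord -(card_imset _ inj); apply: eq_card => k.
  rewrite inE; apply/idP/imsetP => [kd|[x _ ->]].
    by exists (inord k); rewrite // !inordK ?ltnS // inord_val.
  by rewrite inordK; have := ltn_ord x; lia.
move=> J iJ; rewrite leqNgt; apply/negP => dJ.
have [e [F [/eqP F0 hF vF sF]]] := coords_dependent iota lamP dJ.
by apply/F0/iJ => //; exact: (vanish_ideal lamP charK hF).
Qed.

(** A choice of separating_relation for every coordinate outside the first d + 1. Where
    none of these k-th partial derivatives vanishes, they determine all coordinates of a
    tangent vector from the first d + 1 ones. *)
Lemma tangent_equations : exists G : 'I_n.+1 -> {mpoly K[n.+1]},
  forall k, k \notin (top_coords n lam) ->
    [/\ exists e, G k \is e.-homog, vanish iota lam (G k), supp_in (k |: (top_coords n lam)) (G k)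
       & exists r, coord_eval iota (G k)^`M(k) (root_poly r) != 0].
Proof.
suff H (k : 'I_n.+1) : exists F, k \notin (top_coords n lam) ->
    [/\ exists e, F \is e.-homog, vanish iota lam F, supp_in (k |: (top_coords n lam)) F
       & exists r, coord_eval iota F^`M(k) (root_poly r) != 0].
  by have [G hG] := fin_all_exists H; exists G.
have [kt|kt] := boolP (k \in (top_coords n lam)); first by exists 0.
have [e [F [hF vF sF [r hr]]]] := separating_relation iota lamP charK kt.
by exists F => _; split=> //; [exists e | exists r].
Qed.

Lemma tangent_generic (f h : binform L n) c r : c != 0 -> injective r ->
  dehom (val f) = c *: root_poly r ->
  forall u, (size u <= d.+1)%N -> dehom (val h) = reduced_poly r * u ->
    tangent iota (Delta lam) f h.
Proof.
move=> c0 inj ef u su eh F iF; have [[e hF] _] := iF.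
rewrite evalP_gradient ef eh (dir_deriv_homog _ _ _ hF).
by rewrite (deriv_along_reduced lamP charK hF (ideal_vanish lamP iF)) ?mulr0.
Qed.

Variable G : 'I_n.+1 -> {mpoly K[n.+1]}.
Hypothesis G_rel : forall k, k \notin (top_coords n lam) ->
    [/\ exists e, G k \is e.-homog, vanish iota lam (G k), supp_in (k |: (top_coords n lam)) (G k)
       & exists r, coord_eval iota (G k)^`M(k) (root_poly r) != 0].

(** A tangent vector agrees in its first d + 1 coordinates with a multiple of
    reduced_poly r, which is itself tangent. The equation G_k, applied to the
    difference, only involves its k-th coordinate and has a nonzero coefficient there. *)
Lemma tangent_is_reduced (f h : binform L n) c r : c != 0 -> injective r ->
  (forall k, k \notin (top_coords n lam) -> coord_eval iota (G k)^`M(k) (root_poly r) != 0) ->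
  dehom (val f) = c *: root_poly r -> tangent iota (Delta lam) f h ->
  exists2 u : {poly L}, (size u <= d.+1)%N & dehom (val h) = reduced_poly r * u.
Proof.
move=> c0 inj nz ef th; have sh := size_dehom (dhomog_is_dhomog h).
have [u su hu] := reduced_top_coords lamP r sh; exists u => //.
have stu : (size (reduced_poly r * u)%R <= n.+1)%N.
  rewrite (leq_trans (size_polyMleq _ _)) // (size_reduced_poly lamP).
  by have := d_le_n lamP; move: su; set a := size u; lia.
suff eq_coord (k : 'I_n.+1) : (dehom (val h))`_(n - k) = (reduced_poly r * u)`_(n - k).
  apply/polyP => j; case: (leqP j n) => jn.
    have jn' : (n - j < n.+1)%N by lia.
    by have := eq_coord (Ordinal jn'); rewrite /= subKn.
  by rewrite !nth_default // (leq_trans _ jn).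
have [kt|kt] := boolP (k \in (top_coords n lam)); first by rewrite hu //; rewrite inE in kt.
have [[e hG] vG sG _] := G_rel kt.
have := th _ (vanish_ideal lamP charK hG vG).
rewrite evalP_gradient ef (dir_deriv_homog _ _ _ hG) => /eqP.
rewrite mulf_eq0 expf_eq0 (negbTE c0) andbF /= => /eqP H.
have {}H : dir_deriv iota (G k) (root_poly r) (dehom (val h) - reduced_poly r * u) = 0.
  rewrite -scaleN1r dir_derivD dir_derivZ H (deriv_along_reduced lamP charK hG vG) //.
  by rewrite mulr0 addr0.
move: H; rewrite /dir_deriv (bigD1 k) //= big1 ?addr0 => [|j jk].
  by move/eqP; rewrite mulf_eq0 (negbTE (nz k kt)) /= coefB subr_eq0 => /eqP.
have [jt|jt] := boolP (j \in (top_coords n lam)).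
  by rewrite coefB hu ?subrr ?mulr0 //; rewrite inE in jt.
rewrite (supp_in_deriv0 sG) ?inE ?negb_or ?jk //; first by rewrite /coord_eval mmap0 mul0r.
by rewrite inE in jt.
Qed.

(** The tangent space has the basis reduced_poly r * X^k for k at most d, so its
    dimension is that of the cone over Delta. *)
Lemma smooth_generic (f : binform L n) c r : c != 0 -> injective r ->
  (forall k, k \notin (top_coords n lam) -> coord_eval iota (G k)^`M(k) (root_poly r) != 0) ->
  dehom (val f) = c *: root_poly r -> smooth_point iota (Delta lam) f.
Proof.
move=> c0 inj nz ef; split.
  have -> : f = form_of n (c *: root_poly r); last exact: Delta_root_poly.
  apply: dehom_form_inj; rewrite dehom_form_of // (leq_trans (size_scale_leq _ _)) //.
  by rewrite (size_root_poly lamP).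
exists d; split; first exact: Delta_has_dim.
pose X := [tuple form_of n (reduced_poly r * 'X^k) | k < d.+1].
have mt : reduced_poly r \is monic by exact: root_prod_monic.
have eX (k : 'I_d.+1) : dehom (val X`_k) = reduced_poly r * 'X^k.
  rewrite (_ : X`_k = form_of n (reduced_poly r * 'X^k)) ?dehom_form_of //.
    rewrite size_mulXn ?monic_neq0 // (size_reduced_poly lamP).
    by have := d_le_n lamP; have := ltn_ord k; lia.
  by rewrite -tnth_nth tnth_mktuple.
have eS (a : 'I_d.+1 -> L) : dehom (val (\sum_k a k *: X`_k))
    = reduced_poly r * \poly_(k < d.+1) a (inord k).
  rewrite poly_def raddf_sum raddf_sum mulr_sumr; apply: eq_bigr => k _ /=.
  by rewrite dehomZ eX inord_val scalerAr.
exists <<X>>%VS; split=> [h|].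
  split=> [/coord_span eh|th].
    apply: (tangent_generic c0 inj ef (u := \poly_(k < d.+1) coord X (inord k) h)).
      exact: size_poly.
    by rewrite {1}eh eS.
  have [u su eu] := tangent_is_reduced c0 inj nz ef th.
  have -> : h = \sum_(k < d.+1) u`_k *: X`_k.
    apply: dehom_form_inj; rewrite eS eu; congr (_ * _).
    apply/polyP => j; rewrite coef_poly; case: ltnP => jd; first by rewrite inordK.
    by rewrite nth_default // (leq_trans su).
  apply: rpred_sum => k _; apply: rpredZ; apply: memv_span.
  by apply: mem_nth; rewrite size_tuple.
have /eqP -> // : free X.
  apply/freeP => a a0 k; have := congr1 (fun h => dehom (val h)) a0.
  rewrite eS !raddf0 => /eqP; rewrite mulf_eq0 (negbTE (monic_neq0 mt)) /=.
  by move/eqP/polyP/(_ k); rewrite coef0 coef_poly ltn_ord inord_val.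
by rewrite size_tuple.
Qed.

Lemma conormal_generic (f g : binform L n) c c' r h : c != 0 -> injective r ->
  (forall k, k \notin (top_coords n lam) -> coord_eval iota (G k)^`M(k) (root_poly r) != 0) ->
  dehom (val f) = c *: root_poly r -> g != 0 -> small_jets h ->
  dehom (val g) = c' *: g_poly n r (fun=> 1) h ->
  conormal_pair iota lam f g.
Proof.
move=> c0 inj nz ef g0 sh eg; split=> //; first exact: (smooth_generic c0 inj nz ef).
move=> w /(tangent_is_reduced c0 inj nz ef)[u su eu].
rewrite pairingE // eg pairZr eu pair_g_poly_eq0 ?mulr0 //.
  by rewrite -eu; exact: size_dehom (dhomog_is_dhomog w).
by move=> j; apply: dvdp_mulr; rewrite /reduced_poly; apply: dvd_root_prod.
Qed.

End Smoothness.

(** * The conormal variety is the closure of the parametrized pairs *)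

Section ConormalClosure.

Variables (K : fieldType) (L : closedFieldType) (iota : {rmorphism K -> L}).
Variables (n : nat) (lam : seq nat).
Hypothesis lamP : is_partition n lam.
Hypothesis charK : [pchar K] =i pred0.
Local Notation d := (size lam).
Implicit Types (i : 'I_d) (r s t : 'I_d -> L) (p q u : {poly L}).
Implicit Types (v : param_space L lam) (h : 'I_d -> {poly L}).

Let charL : [pchar L] =i pred0 := pchar_codomain0 iota charK.
Let natL k : (0 < k)%N -> k%:R != 0 :> L := natr_neq0 charL (k := k).

Definition bieval_poly (F : {mpoly K[n.+1 + n.+1]}) p q : L :=
  bieval iota (fun k : 'I_n.+1 => p`_(n - k)) (fun k : 'I_n.+1 => q`_(n - k)) F.

Lemma evalPP_bieval_poly F (f g : binform L n) :
  evalPP iota F f g = bieval_poly F (dehom (val f)) (dehom (val g)).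
Proof. by rewrite evalPP_bieval; apply: eq_bieval => k; rewrite form_coordE. Qed.

Lemma regular_bieval_poly F (V : lmodType L) (P Q : V -> {poly L}) :
  pregular P -> pregular Q -> regular (fun x => bieval_poly F (P x) (Q x)).
Proof.
move=> hP hQ; apply: (regular_mmap iota F) => k.
by case: (split k) => j; [exact: hP | exact: hQ].
Qed.

Definition f_point v := f_poly (root_s v) (root_t v).
Definition g_point v := g_poly n (root_s v) (root_t v) (jet_form v).

Lemma small_jet_form v : small_jets (jet_form v).
Proof. by move=> i; exact: size_take_poly. Qed.

Definition mk_param s t h : param_space L lam := [ffun i => ((s i, t i), h i)].

Lemma f_point_mk_param s t h : f_point (mk_param s t h) = f_poly s t.
Proof. by apply: eq_bigr => i _; rewrite /root_s /root_t ffunE. Qed.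

Lemma g_point_mk_param s t h : (forall i, part lam i != 1%N -> size (h i) <= part lam i - 1)%N ->
  g_point (mk_param s t h) = g_poly n s t h.
Proof.
by move=> sh; apply: eq_bigr => i i1; rewrite /root_s /root_t /jet_form ffunE /= take_poly_id ?sh.
Qed.

Lemma param_pair_intro (f g : binform L n) c c' s t h :
  (forall i, (s i != 0) || (t i != 0)) -> small_jets h -> c != 0 -> c' != 0 -> g != 0 ->
  dehom (val f) = c *: f_poly s t -> dehom (val g) = c' *: g_poly n s t h -> param_pair lam f g.
Proof.
move=> st sh c0 c'0 g0 ef eg; split; last split=> //.
  by rewrite -dehom_eq0 ef scaler_eq0 (negbTE c0) (negbTE (f_poly_neq0 st)).
pose p i : L^o * L^o := (s i, t i).
exists p, (fun k => form_of (part lam k - 2) (if insub k is Some i then h i else 0)); split.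
- by move=> i; rewrite pair_neq0; exact: st.
- by apply/(projeq_dehom _ (f_param_homog lamP _)); exists c; rewrite // dehom_f_param.
apply/(projeq_dehom _ (g_param_homog lamP _ _)); exists c'; rewrite // dehom_g_param eg.
congr (_ *: _); apply: eq_bigr => i i1; rewrite valK dehom_form_of //.
by rewrite (leq_trans (sh i)) //; have := part_ge2 lamP i; rewrite i1; lia.
Qed.

Lemma param_pair_elim (f g : binform L n) : param_pair lam f g ->
  exists v c c', [/\ forall i, (root_s v i != 0) || (root_t v i != 0), c != 0, c' != 0,
    dehom (val f) = c *: f_point v & dehom (val g) = c' *: g_point v].
Proof.
case=> f0 [g0 [p [h [p0 /(projeq_dehom _ (f_param_homog lamP _))[c c0 ef]
  /(projeq_dehom _ (g_param_homog lamP _ _))[c' c'0 eg]]]]].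
exists (mk_param (fun i => (p i).1) (fun i => (p i).2) (fun i => dehom (val (h i)))), c, c'.
rewrite f_point_mk_param g_point_mk_param -?dehom_f_param -?dehom_g_param; last first.
  move=> i i1; have := size_dehom (dhomog_is_dhomog (h i)).
  by have := part_ge2 lamP i; rewrite i1 => i2;
    rewrite (_ : (part lam i - 2).+1 = part lam i - 1)%N //; lia.
split=> // i; rewrite /root_s /root_t ffunE /= -pair_neq0 //; exact: p0.
Qed.

(** Nonzero exactly when no root is at infinity and the roots are distinct. *)
Definition chart_good v : L :=
  \prod_i root_t v i * \prod_i \prod_(j | j != i)
    (root_s v i * root_t v j - root_s v j * root_t v i).

Lemma regular_chart_good : regular chart_good.
Proof.
apply: regularM; first by apply: regular_prod => i; exact: regular_root_t.
apply: regular_prod => i; apply: regular_prod => j; apply: regularD.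
  by apply: regularM; [exact: regular_root_s | exact: regular_root_t].
by apply: regularN; apply: regularM; [exact: regular_root_s | exact: regular_root_t].
Qed.

Definition root_ratio v i : L := root_s v i / root_t v i.

Lemma chart_goodP v : chart_good v != 0 -> (forall i, root_t v i != 0) /\ injective (root_ratio v).
Proof.
rewrite mulf_eq0 negb_or => /andP[/prodf_neq0 ht /prodf_neq0 hst].
have t0 i : root_t v i != 0 by exact: ht.
split=> // i j /eqP eij; apply/eqP/negPn/negP => ij.
have /prodf_neq0/(_ j) := hst i isT; rewrite eq_sym ij => /(_ isT).
by move: eij; rewrite /root_ratio eqr_div // => /eqP ->; rewrite subrr eqxx.
Qed.

Lemma chart_good_mk_param r h : injective r -> chart_good (mk_param r (fun=> 1) h) != 0.
Proof.
move=> inj; rewrite mulf_neq0 //; apply/prodf_neq0 => i _.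
  by rewrite /root_t ffunE oner_neq0.
apply/prodf_neq0 => j ji; rewrite /root_s /root_t !ffunE /= !mulr1 subr_eq0.
by apply: contra ji => /eqP/inj ->.
Qed.

Lemma natr_inj_ord : injective (fun i : 'I_d => (i : nat)%:R : L).
Proof. by move=> i j /(natr_inj charL)/val_inj. Qed.

Lemma chart_good_ex : exists v, chart_good v != 0.
Proof. by exists (mk_param (fun i => (i : nat)%:R) (fun=> 1) (fun=> 0));
  exact: chart_good_mk_param natr_inj_ord. Qed.

Lemma f_point_chart v : (forall i, root_t v i != 0) ->
  exists2 c, c != 0 & f_point v = c *: root_poly (root_ratio v).
Proof.
move=> t0; exists (\prod_i root_t v i ^+ part lam i); last exact: f_poly_chart.
by apply/prodf_neq0 => i _; rewrite expf_neq0.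
Qed.

Lemma g_point_chart v : (forall i, root_t v i != 0) ->
  exists2 h, small_jets h & g_point v = g_poly n (root_ratio v) (fun=> 1) h.
Proof.
move=> t0; exists (fun i => root_t v i ^+ (n - part lam i + 2) *: jet_form v i);
  last exact: g_poly_chart.
by move=> i; rewrite (leq_trans (size_scale_leq _ _)) // small_jet_form.
Qed.

Lemma size_f_point v : (size (f_point v) <= n.+1)%N.
Proof. exact: size_f_poly. Qed.

Lemma size_g_point v : (size (g_point v) <= n.+1)%N.
Proof. by apply: size_g_poly => // i; exact: small_jet_form. Qed.

Lemma size_scaled c p : (size p <= n.+1)%N -> (size (c *: p) <= n.+1)%N.
Proof. exact/leq_trans/size_scale_leq. Qed.

Lemma f_point_neq0 v : (forall i, root_t v i != 0) -> f_point v != 0.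
Proof. by move=> t0; apply: f_poly_neq0 => i; rewrite t0 orbT. Qed.

(** By regular_dense it suffices to consider the parameters for which the roots are
    finite and distinct, the partial derivatives in tangent_is_reduced do not vanish,
    and one fixed coefficient of g is nonzero; conormal_generic applies to these. Each
    of the three conditions can be met, so they can be met together. *)
Lemma param_closure_in_Con (f g : binform L n) :
  zclosure iota (param_pair lam) f g -> Con iota lam f g.
Proof.
case=> f0 g0 cl; split=> // F bF vF; apply: cl => // {f0 g0}f {}g fg.
have [_ [g0 _]] := fg.
have [v0 [c [c' [st0 c0 c'0 ef eg]]]] := param_pair_elim fg.
have [G hG] := tangent_equations iota lamP charK.
rewrite evalPP_bieval_poly ef eg.
have [k0 gk0] : exists k, (g_point v0)`_k != 0.
  apply: NNPP => N; move/negP: g0; apply; rewrite -dehom_eq0 eg.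
  rewrite (_ : g_point v0 = 0) ?scaler0 //; apply/polyP => k; rewrite coef0.
  by apply/eqP/negPn/negP => H; apply: N; exists k.
have regF : pregular f_point by exact: pregular_f_poly.
have regG : pregular g_point by exact: pregular_g_poly.
have regD (k : 'I_n.+1) : regular (fun v => if k \in (top_coords n lam) then 1 else coord_eval
  iota (G k)^`M(k) (f_point v)).
  case: (k \in (top_coords n lam)); first exact: regular_cst.
  exact: (regular_coord_eval iota _ regF).
have nzD (k : 'I_n.+1) : exists w, (if k \in (top_coords n lam) then 1 else coord_eval iota
  (G k)^`M(k) (f_point w)) != 0.
  have [kt|kt] := boolP (k \in (top_coords n lam)); first by exists 0; rewrite oner_neq0.
  have [_ _ _ [r hr]] := hG k kt.
  by exists (mk_param r (fun=> 1) (fun=> 0)); rewrite f_point_mk_param f_poly_monic.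
have [w1 hw1] := regular_neq0_all charL regD nzD.
pose psi1 v := \prod_(k < n.+1) (if k \in (top_coords n lam) then 1 else coord_eval iota
  (G k)^`M(k) (f_point v)).
have reg1 : regular psi1 by apply: regular_prod.
have exP : exists w, psi1 w != 0 by exists w1; apply/prodf_neq0 => k _; exact: hw1.
have exCP := regular_neq0_both charL regular_chart_good reg1 chart_good_ex exP.
have exG : exists w, (g_point w)`_k0 != 0 by exists v0.
have ex3 := regular_neq0_both charL (regularM regular_chart_good reg1) (regG k0) exCP exG.
apply: (@regular_dense _ _ charL (fun v => bieval_poly F (c *: f_point v) (c' *: g_point v)) _
  _ (regularM (regularM regular_chart_good reg1) (regG k0)) ex3).
  by apply: regular_bieval_poly; apply: pregularZ => //; exact: regular_cst.
move=> v; rewrite mulf_eq0 negb_or => /andP[].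
rewrite (mulf_eq0 (chart_good v)) negb_or => /andP[gd /prodf_neq0 hD] gk.
have [t0 inj] := chart_goodP gd.
have [a a0 eF] := f_point_chart t0; have [h sh eG] := g_point_chart t0.
have sF := size_scaled c (size_f_point v); have sG := size_scaled c' (size_g_point v).
have := vF (form_of n (c *: f_point v)) (form_of n (c' *: g_point v)).
rewrite evalPP_bieval_poly !dehom_form_of //; apply.
apply: (conormal_generic lamP charK hG (c := c * a) (c' := c') (r := root_ratio v) (h := h)) => //.
- by rewrite mulf_neq0.
- move=> k kt; have := hD k isT; rewrite (negbTE kt) eF.
  have [[e hGk] _ _ _] := hG k kt.
  by rewrite (coord_eval_homog _ _ _ (dhomog_deriv k hGk)) mulf_eq0 negb_or => /andP[].
- by rewrite dehom_form_of // eF scalerA.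
- rewrite -dehom_eq0 dehom_form_of // scaler_eq0 (negbTE c'0) /=.
  by apply: contraNneq gk => ->; rewrite coef0.
by rewrite dehom_form_of // eG.
Qed.

Lemma pair_rev p q :
  pair n p q = \sum_(k < n.+1) p`_(n - k) * q`_(n - k) / 'C(n, k)%:R.
Proof.
rewrite /pair (reindex_inj rev_ord_inj) /=; apply: eq_bigr => k _.
by rewrite subSS bin_sub // -ltnS.
Qed.

Definition poly_of_coords (x : 'I_n.+1 -> L) : {poly L} := \poly_(m < n.+1) x (inord (n - m)).

Lemma coef_poly_of_coords x (k : 'I_n.+1) : (poly_of_coords x)`_(n - k) = x k.
Proof.
have kn : (k <= n)%N by rewrite -ltnS.
by rewrite coef_poly subKn // inord_val ltnS leq_subr.
Qed.

Lemma pregular_poly_of_coords (V : lmodType L) (x : V -> 'I_n.+1 -> L) :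
  (forall k, regular (fun y => x y k)) -> pregular (fun y => poly_of_coords (x y)).
Proof.
move=> h m; case: (ltnP m n.+1) => mn.
  by apply: eq_regular (h (inord (n - m))) => y; rewrite coef_poly mn.
by apply: eq_regular (regular_cst 0) => y; rewrite coef_poly ltnNge mn.
Qed.

Lemma poly_coordsP p q : (size p <= n.+1)%N -> (size q <= n.+1)%N ->
  (forall k : 'I_n.+1, p`_(n - k) = q`_(n - k)) -> p = q.
Proof.
move=> sp sq h; apply/polyP => j; case: (leqP j n) => jn.
  have jn' : (n - j < n.+1)%N by lia.
  by have := h (Ordinal jn'); rewrite /= subKn.
by rewrite !nth_default // (leq_trans _ jn).
Qed.

(** Write g as a combination, with fixed coefficients a_j, of gradients at f of
    equations H_j of Delta, and let gv v be the same combination of gradients at the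
    form with parameters v. It is regular in v, equals g at the parameters of f, and
    annihilates the tangent directions at every form with distinct roots, where it is a
    g_poly by annihilator_is_g_poly. Density transports the equations of the closure
    from there to (f, g). *)
Lemma Con_in_param_closure (f g : binform L n) :
  Con iota lam f g -> zclosure iota (param_pair lam) f g.
Proof.
case=> f0 g0 cl; split=> // F bF vF; apply: cl => // {f0 g0}f {}g [[Df _] g0 perp].
have [p [p0 /(projeq_dehom _ (f_param_homog lamP p))[c c0]]] := Df.
rewrite dehom_f_param; set s := fun i => _; set t := fun i => _ => ef.
pose v0 := mk_param s t (fun=> 0).
pose S (x : 'rV[L]_n.+1) := exists H, in_ideal iota (Delta lam : binform L n -> Prop) H
   /\ x = \row_k evalP iota H^`M(k) f.
have [|N [A [a [SA hx]]]] :=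
    @annihilator_combination _ _ S (\row_k (form_coord g k / 'C(n, k)%:R)).
  move=> h hS; have := perp (form_of n (poly_of_coords h)).
  have cw (k : 'I_n.+1) : form_coord (form_of n (poly_of_coords h)) k = h k.
    by rewrite form_coordE dehom_form_of ?coef_poly_of_coords ?size_poly.
  rewrite pairingE // pair_rev => H; rewrite -[RHS]H.
    apply: eq_bigr => k _; rewrite mxE -!form_coordE cw.
    by rewrite mulrC mulrA.
  move=> H' iH'; rewrite -[RHS](hS (\row_k evalP iota H'^`M(k) f)); last by exists H'.
  by apply: eq_bigr => k _; rewrite mxE cw.
have [H hH] := fin_all_exists SA.
pose gam v (k : 'I_n.+1) := 'C(n, k)%:R * \sum_j a j * coord_eval iota (H j)^`M(k) (c *: f_point v).
pose gv v := poly_of_coords (gam v).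
have eg : gv v0 = dehom (val g).
  apply: poly_coordsP; [exact: size_poly | exact: size_dehom (dhomog_is_dhomog g) |].
  move=> k; rewrite coef_poly_of_coords /gam f_point_mk_param -ef -form_coordE.
  have := hx k; rewrite mxE => hxk.
  rewrite (_ : \sum_j _ = form_coord g k / 'C(n, k)%:R); last first.
    rewrite hxk; apply: eq_bigr => j _; congr (_ * _).
    have [_ /rowP/(_ k)] := hH j; rewrite !mxE => ->.
    by rewrite evalP_coord_eval.
  by rewrite mulrC divfK // natL // bin_gt0 -ltnS.
have [m0 gm0] : exists m, (gv v0)`_m != 0.
  apply: NNPP => N'; move/negP: g0; apply; rewrite -dehom_eq0 -eg.
  apply/eqP/polyP => k; rewrite coef0.
  by apply/eqP/negPn/negP => H'; apply: N'; exists k.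
have regG : pregular gv.
  apply: pregular_poly_of_coords => k; apply: regularM; first exact: regular_cst.
  apply: regular_sum => j; apply: regularM; first exact: regular_cst.
  apply: (regular_coord_eval iota); apply: pregularZ; first exact: regular_cst.
  exact: pregular_f_poly.
have exG : exists w, (gv w)`_m0 != 0 by exists v0.
have ex := regular_neq0_both charL regular_chart_good (regG m0) chart_good_ex exG.
rewrite evalPP_bieval_poly ef -(f_point_mk_param s t (fun=> 0)) -eg.
apply: (@regular_dense _ _ charL (fun v => bieval_poly F (c *: f_point v) (gv v)) _
  _ (regularM regular_chart_good (regG m0)) ex).
  apply: regular_bieval_poly => //; apply: pregularZ; first exact: regular_cst.
  exact: pregular_f_poly.
move=> v; rewrite mulf_eq0 negb_or => /andP[gd gm].
have [t0 inj] := chart_goodP gd; have [b b0 eF] := f_point_chart t0.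
have pg u : pair n u (gv v) = \sum_j a j * dir_deriv iota (H j) (c *: f_point v) u.
  rewrite pair_rev; under [RHS]eq_bigr do rewrite /dir_deriv mulr_sumr.
  rewrite exchange_big; apply: eq_bigr => k _ /=.
  rewrite coef_poly_of_coords /gam.
  have C0 : 'C(n, k)%:R != 0 :> L by rewrite natL // bin_gt0 -ltnS.
  rewrite mulrCA mulrC mulKf // mulr_sumr; apply: eq_bigr => j _.
  by rewrite mulrCA; congr (_ * _); exact: mulrC.
have sgv : (size (gv v) <= n.+1)%N by exact: size_poly.
have [|i|h sh eG] := annihilator_is_g_poly lamP charL inj sgv.
- rewrite pg big1 // => j _; have [[[e hHj] vHj] _] := hH j.
  rewrite eF scalerA (dir_deriv_homog iota _ _ _ hHj).
  by rewrite (deriv_scale charK _ hHj) ?mulr0 //; apply: (ideal_vanish lamP); split=> //; exists e.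
- rewrite pg big1 // => j _; have [[[e hHj] vHj] _] := hH j.
  rewrite eF scalerA (dir_deriv_homog iota _ _ _ hHj).
  by rewrite (deriv_move_root lamP charK) ?mulr0 //; apply: (ideal_vanish lamP); split=> //;
    exists e.
have sF := size_scaled c (size_f_point v).
have := vF (form_of n (c *: f_point v)) (form_of n (gv v)).
rewrite evalPP_bieval_poly !dehom_form_of //; apply.
apply: (param_pair_intro (c := c * b) (c' := 1) (s := root_ratio v) (t := fun=> 1) (h := h)) => //.
- by move=> i; rewrite oner_neq0 orbT.
- by rewrite mulf_neq0.
- by rewrite oner_neq0.
- rewrite -dehom_eq0 dehom_form_of //; apply: contraNneq gm => ->; by rewrite coef0.
- by rewrite dehom_form_of // eF scalerA f_poly_monic.
- by rewrite dehom_form_of // scale1r.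
Qed.

End ConormalClosure.

HB.instance Definition _ (K L : fieldType) (iota : {rmorphism K -> L}) n rho g :=
  GRing.RMorphism.copy (@root_eval K L iota n rho g) (mmap (mmap iota g) rho).

(** * The open set of nondegenerate pairs *)

Section ClosedConditions.

Variables (K : fieldType) (L : closedFieldType) (iota : {rmorphism K -> L}).
Variables (n : nat) (lam : seq nat).
Hypothesis lamP : is_partition n lam.
Hypothesis charK : [pchar K] =i pred0.
Local Notation d := (size lam).
Implicit Types (i j : 'I_d) (r : 'I_d -> L) (p q : {poly L}).

Let charL : [pchar L] =i pred0 := pchar_codomain0 iota charK.

(** A labelling of the n roots counted with multiplicity by the d distinct ones,
    together with a representative kappa i of each block. The product formula is stated
    for all rings because it is used with polynomials over different ones. *)
Lemma blocks_exist : exists (beta : 'I_n -> 'I_d) (kappa : 'I_d -> 'I_n),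
  cancel kappa beta /\ forall (S : comNzRingType) (F : 'I_d -> S),
    \prod_k F (beta k) = \prod_i F i ^+ part lam i.
Proof.
pose bl := flatten [seq nseq (part lam i) i | i <- index_enum 'I_d].
have sz : size bl = n.
  rewrite size_flatten /shape -map_comp sumnE big_map /= -[RHS](sum_part lamP).
  by apply: eq_bigr => i _; rewrite size_nseq.
have memb i : i \in bl.
  apply/flatten_mapP; exists i; rewrite ?mem_index_enum //.
  by rewrite mem_nseq (part_gt0 lamP) eqxx.
pose beta (k : 'I_n) : 'I_d := tnth (tcast sz (in_tuple bl)) k.
have idx i : (index i bl < n)%N by rewrite -[X in (_ < X)%N]sz index_mem.
exists beta, (fun i => Ordinal (idx i)); split.
  by move=> i; rewrite /beta (tnth_nth i) val_tcast /= nth_index.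
move=> S F.
transitivity (\prod_(i <- bl) F i).
  rewrite -(big_tuple _ _ (tcast sz (in_tuple bl)) xpredT F).
  by rewrite val_tcast.
rewrite big_flatten big_map /=; apply: eq_bigr => i _.
by rewrite big_nseq iter_mulr_1.
Qed.

(** Nonzero when the roots are distinct and every h_i has a nonzero top coefficient in
    the sense of top_jet_neq0. *)
Definition nondegeneracy r q : L :=
  (\prod_i \prod_(j | j != i) (r i - r j)) *
  \prod_(i < d | part lam i != 1%N) pair n (root_prod r (drop_roots 2 i)) q.

Lemma eq_root_prod r r' e e' : r =1 r' -> e =1 e' -> root_prod r e = root_prod r' e'.
Proof. by move=> er ee; apply: eq_bigr => i _; rewrite er ee. Qed.

Lemma eq_nondegeneracy r r' q : r =1 r' -> nondegeneracy r q = nondegeneracy r' q.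
Proof.
move=> er; congr (_ * _); apply: eq_bigr => i _.
  by apply: eq_bigr => j _; rewrite !er.
by rewrite (eq_root_prod er (frefl _)).
Qed.

(** Some ordering of the roots exhibits p as an element of Delta whose tangent
    directions q annihilates and, for withT = true, which is degenerate. Both flavours
    are conditions on one and the same ordering; this is why a single statement treats
    them. *)
Definition root_conditions (withT : bool) p q := exists c r,
  [/\ c != 0, p = c *: root_poly r, pair n (root_poly r) q = 0,
      forall i, pair n (root_prod r (drop_roots 1 i)) q = 0 & withT -> nondegeneracy r q = 0].

Local Notation R := {mpoly K[n.+1]}.

Section Polynomials.

Variable kappa : 'I_d -> 'I_n.

Definition root_prod_mp (e : 'I_d -> nat) : {poly {mpoly R[n]}} :=
  \prod_i ('X - ('X_(kappa i) : {mpoly R[n]})%:P) ^+ e i.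

(** The pairing with q as a polynomial in the roots, whose coefficients are linear in
    the coordinates of q. *)
Definition pair_mp (e : 'I_d -> nat) : {mpoly R[n]} :=
  \sum_(k < n.+1) (root_prod_mp e)`_(n - k) * ('C(n, k)%:R^-1 *: 'X_k)%:MP.

Lemma root_eval_root_prod rho g e k :
  root_eval iota rho g (root_prod_mp e)`_k = (root_prod (rho \o kappa) e)`_k.
Proof.
have eP : map_poly (root_eval iota rho g) (root_prod_mp e) = root_prod (rho \o kappa) e.
  rewrite rmorph_prod; apply: eq_bigr => i _; rewrite rmorphXn rmorphB /=.
    by rewrite map_polyX map_polyC /= /root_eval mmapX mmap1U.
by rewrite -eP coef_map.
Qed.

Lemma root_eval_pair_mp rho q e :
  root_eval iota rho (fun k : 'I_n.+1 => q`_(n - k)) (pair_mp e)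
  = pair n (root_prod (rho \o kappa) e) q.
Proof.
rewrite pair_rev raddf_sum; apply: eq_bigr => k _ /=.
rewrite rmorphM /= root_eval_root_prod -mulrA; congr (_ * _).
rewrite /root_eval mmapC /= mmapZ mmapXU fmorphV rmorph_nat mulrC //.
Qed.

Variable beta : 'I_n -> 'I_d.

(** The equations of root_conditions in the n roots counted with multiplicity. The first
    family says that all roots of a block agree; the remaining ones then only involve
    one representative of each block. *)
Definition root_condition_mpolys (withT : bool) : seq {mpoly R[n]} :=
  [seq 'X_k - 'X_(kappa (beta k)) | k <- enum 'I_n] ++
  (pair_mp (fun i => part lam i) :: [seq pair_mp (drop_roots 1 i) | i <- enum 'I_d]) ++
  (if withT then [:: (\prod_i \prod_(j | j != i) ('X_(kappa i) - 'X_(kappa j))) *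
       \prod_(i < d | part lam i != 1%N) pair_mp (drop_roots 2 i)] else [::]).

Lemma root_condition_mpolysP withT rho q :
  (forall E, E \in root_condition_mpolys withT ->
    root_eval iota rho (fun k : 'I_n.+1 => q`_(n - k)) E = 0) <->
  [/\ forall k, rho k = rho (kappa (beta k)), pair n (root_poly (rho \o kappa)) q = 0,
      forall i, pair n (root_prod (rho \o kappa) (drop_roots 1 i)) q = 0
    & withT -> nondegeneracy (rho \o kappa) q = 0].
Proof.
set g := fun k : 'I_n.+1 => _.
have eX k : root_eval iota rho g 'X_k = rho k by rewrite /root_eval mmapX mmap1U.
have eT : root_eval iota rho g ((\prod_i \prod_(j | j != i) ('X_(kappa i) - 'X_(kappa j))) *
       \prod_(i < d | part lam i != 1%N) pair_mp (drop_roots 2 i)) = nondegeneracy (rho \o kappa) q.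
  rewrite rmorphM !rmorph_prod /=; congr (_ * _).
    apply: eq_bigr => i _; rewrite rmorph_prod; apply: eq_bigr => j _.
    by rewrite rmorphB /= !eX.
  by apply: eq_bigr => i _; rewrite root_eval_pair_mp.
split=> [h|[h1 h2 h3 h4] E].
  split=> [k||i|w].
  - apply/eqP; rewrite -subr_eq0 -!eX -rmorphB; apply/eqP/h.
    by rewrite mem_cat; apply/orP; left; apply/mapP; exists k; rewrite ?mem_enum.
  - by rewrite -root_eval_pair_mp; apply: h; rewrite !(mem_cat, inE) eqxx ?orbT.
  - rewrite -root_eval_pair_mp; apply: h; rewrite !(mem_cat, inE); apply/orP; right; apply/orP;
    left.
    by apply/orP; right; apply/mapP; exists i; rewrite ?mem_enum.
  by rewrite -eT; apply: h; rewrite !(mem_cat, inE) w inE eqxx !orbT.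
rewrite !(mem_cat, inE) -orbA => /or4P[/mapP[k _ ->]|/eqP->|/mapP[i _ ->]|].
- by rewrite rmorphB /= !eX h1 subrr.
- by rewrite root_eval_pair_mp.
- by rewrite root_eval_pair_mp.
by case: ifP => // w; rewrite inE => /eqP->; rewrite eT h4.
Qed.

End Polynomials.

(** The set where root_conditions holds is closed off the hyperplane of vanishing
    leading coefficient. Adding that hyperplane to the zero set of F makes the union
    closed. *)
Lemma root_conditions_closed withT p q : (size p <= n.+1)%N -> p`_n != 0 ->
  ~ root_conditions withT p q ->
  exists F : {mpoly K[n.+1 + n.+1]}, (forall p' q', p'`_n = 0 \/ root_conditions withT p' q' ->
    bieval_poly iota F p' q' = 0)
    /\ bieval_poly iota F p q != 0.
Proof.
move=> sp pn nS; have [beta [kappa [bk prodB]]] := blocks_exist.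
have szp : size p = n.+1.
  by apply/eqP; rewrite eqn_leq sp ltnNge; apply: contra pn => h; rewrite nth_default.
have [rs ers] := closed_field_poly_normal p.
have c0 : lead_coef p != 0 by rewrite lead_coef_eq0 -size_poly_gt0 szp.
have srs : size rs == n.
  have := szp; rewrite ers size_scale // size_prod_XsubC => -[->] //.
pose rho0 (k : 'I_n) := tnth (Tuple srs) k.
have ep : p = lead_coef p *: \prod_k ('X - (rho0 k)%:P).
  rewrite {1}ers; congr (_ *: _).
  by rewrite -(big_tuple _ _ (Tuple srs) xpredT (fun z => 'X - z%:P)).
pose SM := in_tuple (root_condition_mpolys kappa beta withT).
have [|F [hF hF0 hFn]] := @norm_separates K L iota n charL _ (tnth SM) rho0
    (fun k : 'I_n.+1 => q`_(n - k)).
  move=> s; apply: NNPP => N; apply: nS.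
  have /root_condition_mpolysP[h1 h2 h3 h4] : forall E,
    E \in root_condition_mpolys kappa beta withT ->
      root_eval iota (fun k => rho0 (s k)) (fun k : 'I_n.+1 => q`_(n - k)) E = 0.
    move=> E ES; have /tnthP[j ->] : E \in SM by [].
    apply/eqP/negPn/negP => H; apply: N; by exists j.
  exists (lead_coef p), (fun i => rho0 (s (kappa i))); split=> //.
  rewrite {1}ep; congr (_ *: _); rewrite (reindex_inj (@perm_inj _ s)) /=.
  rewrite /root_poly /root_prod -prodB; apply: eq_bigr => k _.
  by rewrite -h1.
exists F; split=> [p' q' [p'0|[c [r [c'0 -> h2 h3 h4]]]]|].
- by apply: hF0; rewrite subn0.
- pose rho k := r (beta k).
  have er : rho \o kappa =1 r by move=> i; rewrite /rho /= bk.
  rewrite -[RHS](hF c rho (fun k : 'I_n.+1 => q'`_(n - k))).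
    apply: eq_bieval => k //; rewrite /root_coords coefZ; congr (_ * _`_ _).
    by rewrite (prodB _ (fun i => 'X - (r i)%:P)).
  move=> j; apply: (root_condition_mpolysP kappa beta withT rho q').2; last exact: mem_tnth.
  split=> [k||i|w].
  - by rewrite /rho bk.
  - by rewrite /root_poly (eq_root_prod er (frefl _)).
  - by rewrite (eq_root_prod er (frefl _)).
  by rewrite (eq_nondegeneracy _ er) h4.
rewrite /bieval_poly; have := hFn _ c0; rewrite (_ : bieval _ _ _ _ = bieval_poly iota F p q) //.
by apply: eq_bieval => k //; rewrite /root_coords [in RHS]ep coefZ.
Qed.

(** Unique factorization for distinct linear factors. *)
Lemma exponents_unique r e e' : injective r -> root_prod r e = root_prod r e' -> e =1 e'.
Proof.
move=> inj.
suff le f f' : root_prod r f = root_prod r f' -> forall i, (f i <= f' i)%N.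
  by move=> eq i; apply/eqP; rewrite eqn_leq !le.
move=> eq i; have := dvd_root_prod r (leqnn (f i)); rewrite eq.
rewrite {1}/root_prod (bigD1 i) //= mulrC Gauss_dvdpr => [/dvdp_leq|].
  rewrite !size_exp_XsubC; apply.
  by rewrite monic_neq0 // monic_exp ?monicXsubC.
elim/big_rec: _ => [|j P ji hP]; first exact: coprimep1.
rewrite coprimepMr hP andbT; apply: coprime_XsubC_exp.
by apply: contra ji => /eqP/inj ->.
Qed.

Lemma root_root_poly r (x : L) : root (root_poly r) x <-> exists i, x = r i.
Proof.
rewrite /root /root_poly /root_prod horner_prod; split=> [|[i ->]].
  move/prodf_eq0 => [i _]; rewrite horner_exp expf_eq0 => /andP[_].
  by rewrite !hornerE subr_eq0 => /eqP ->; exists i.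
apply/prodf_eq0; exists i => //.
by rewrite horner_exp !hornerE subrr expr0n (gtn_eqF (part_gt0 lamP i)).
Qed.

Lemma root_poly_unique r r1 : injective r -> root_poly r1 = root_poly r ->
  exists tau : 'S_d, (forall i, r1 i = r (tau i)) /\ (forall i, part lam (tau i) = part lam i).
Proof.
move=> inj eq.
have ex (j : 'I_d) : exists i, r1 j = r i by apply/root_root_poly; rewrite -eq;
  apply/root_root_poly; exists j.
have [tau ht] := fin_all_exists ex.
have surj i : i \in codom tau.
  have [j hj] : exists j, r i = r1 j by apply/root_root_poly; rewrite eq; apply/root_root_poly;
    exists i.
  by apply/codomP; exists j; apply: inj; rewrite hj ht.
have tinj : injective tau.
  apply/injectiveP/card_uniqP; rewrite size_codom.
  by apply: eq_card => i; rewrite surj inE.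
exists (perm tinj); split=> i; rewrite permE //.
have : root_prod r (fun i => part lam ((perm tinj)^-1%g i)) = root_prod r (fun i => part lam i).
  rewrite -[RHS]eq /root_poly /root_prod (reindex_inj (@perm_inj _ (perm tinj))) /=.
  by apply: eq_bigr => j _; rewrite permK ht permE.
by move/(exponents_unique inj)/(_ (perm tinj i)); rewrite permK permE.
Qed.

(** The complement of the open set over which the degree is computed. *)
Definition degenerate_pair (f g : binform L n) : Prop :=
  (dehom (val f))`_n = 0 \/ root_conditions true (dehom (val f)) (dehom (val g)).

Lemma nondegeneracy_scale r c q : c != 0 -> nondegeneracy r q = 0 -> nondegeneracy r (c *: q) = 0.
Proof.
move=> c0 /eqP; rewrite /nondegeneracy mulf_eq0 => /orP[/eqP->|]; first by rewrite mul0r.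
move=> /prodf_eq0[i i1 /eqP e]; apply/eqP; rewrite mulf_eq0; apply/orP; right.
by apply/prodf_eq0; exists i; rewrite // pairZr e mulr0.
Qed.

Lemma root_conditions_scale w p q c c' : c != 0 -> c' != 0 -> root_conditions w p q ->
  root_conditions w (c *: p) (c' *: q).
Proof.
move=> c0 c'0 [a [r [a0 -> h2 h3 h4]]]; exists (c * a), r; split.
- by rewrite mulf_neq0.
- by rewrite scalerA.
- by rewrite pairZr h2 mulr0.
- by move=> i; rewrite pairZr h3 mulr0.
by move=> /h4; exact: nondegeneracy_scale.
Qed.

Lemma degenerate_pair_closed : zclosed iota degenerate_pair.
Proof.
move=> f g cl; have [e|ne] := eqVneq (dehom (val f))`_n 0; first by left.
right; apply: NNPP => nS.
have [F [hF /eqP]] := root_conditions_closed (size_dehom (dhomog_is_dhomog f)) ne nS; apply.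
rewrite -evalPP_bieval_poly evalPP_bieval.
have bZ : bicone degenerate_pair.
  move=> f' g' c c' c0 c'0 [e|S]; [left|right]; rewrite /= !dehomZ.
    by rewrite coefZ e mulr0.
  exact: root_conditions_scale.
apply: (zclosure_vanish charL bZ _ cl) => f' g' z.
by rewrite -evalPP_bieval evalPP_bieval_poly; exact: hF.
Qed.

Lemma param_pair_bicone : bicone (fun f g : binform L n => param_pair lam f g).
Proof.
move=> f g c c' c0 c'0 [f0 [g0 [p [h [p0 [a a0 ea] [b b0 eb]]]]]].
split; first by rewrite scaler_eq0 negb_or c0.
split; first by rewrite scaler_eq0 negb_or c'0.
exists p, h; split=> //; [exists (c * a) | exists (c' * b)]; rewrite ?mulf_neq0 //.
  by rewrite -scalerA -ea.
by rewrite -scalerA -eb.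
Qed.

(** Obtained by density from finite, distinct roots, where f is a multiple of a monic
    polynomial of degree n. *)
Lemma f_point_lead (v : param_space L lam) : (f_point v)`_n = \prod_i root_t v i ^+ part lam i.
Proof.
apply/eqP; rewrite -subr_eq0; apply/eqP.
have reg1 := @regular_chart_good L lam.
pose phi := fun w => (@f_point L lam w)`_n - \prod_i root_t w i ^+ part lam i.
rewrite -/(phi v).
apply: (@regular_dense _ _ charL phi _ _ reg1 (chart_good_ex iota lam charK)).
  apply: regularD; first exact: pregular_f_poly.
  apply: regularN; apply: regular_prod => i; apply: regularX; exact: regular_root_t.
move=> {}v gd; have [t0 _] := chart_goodP gd; rewrite /phi /f_point f_poly_chart // coefZ
  -/(root_poly _).
have := root_prod_monic (fun i => root_s v i / root_t v i) (fun i => part lam i).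
by rewrite monicE lead_coefE -/(root_poly _) (size_root_poly lamP) => /eqP ->; rewrite mulr1 subrr.
Qed.

Lemma chart_of_lead (v : param_space L lam) : (f_point v)`_n != 0 -> forall i, root_t v i != 0.
Proof.
rewrite f_point_lead => /prodf_neq0 h i; have := h i isT.
by rewrite expf_eq0 (part_gt0 lamP).
Qed.

Lemma param_pair_root_conditions (f g : binform L n) : param_pair lam f g ->
  (dehom (val f))`_n != 0 -> root_conditions false (dehom (val f)) (dehom (val g)).
Proof.
move=> /(param_pair_elim lamP)[v [c [c' [_ c0 c'0 ef eg]]]].
rewrite ef coefZ mulf_eq0 negb_or => /andP[_ /chart_of_lead t0].
have [a a0 eF] := f_point_chart t0; have [h sh eG] := g_point_chart n t0.
have perp e : (\sum_i e i <= n)%N -> (forall i, part lam i - 1 <= e i)%N ->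
    pair n (root_prod (root_ratio v) e) (c' *: g_point n v) = 0.
  move=> en he; rewrite eG pairZr (pair_g_poly_eq0 lamP charL sh) ?mulr0 //.
    by rewrite size_root_prod ltnS.
  by move=> j; exact: dvd_root_prod.
rewrite eg; exists (c * a), (root_ratio v); split=> //.
- by rewrite mulf_neq0.
- by rewrite eF scalerA.
- apply: perp; first by rewrite (sum_part lamP).
  by move=> i; rewrite leq_subr.
move=> i; apply: perp => [|j].
  by rewrite -[X in (_ <= X)%N](sum_part lamP); apply: leq_sum => j _; rewrite leq_subr.
by rewrite /drop_roots; case: (j == i); lia.
Qed.

(** Off the hyperplane at infinity, the annihilation conditions are closed, so they pass
    from pairs of the parametrization to their limits. *)
Lemma closure_root_conditions (f g : binform L n) : zclosure iota (param_pair lam) f g ->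
  (dehom (val f))`_n != 0 -> root_conditions false (dehom (val f)) (dehom (val g)).
Proof.
move=> cl ne; apply: NNPP => nS.
have [F [hF /eqP]] := root_conditions_closed (size_dehom (dhomog_is_dhomog f)) ne nS; apply.
rewrite -evalPP_bieval_poly evalPP_bieval.
apply: (zclosure_vanish charL param_pair_bicone _ cl) => f' g' z.
rewrite -evalPP_bieval evalPP_bieval_poly; apply: hF.
have [|l] := eqVneq (dehom (val f'))`_n 0; first by left.
by right; exact: param_pair_root_conditions.
Qed.

(** A limit of pairs of the parametrization with finite, distinct roots is itself such a
    pair: the limit still annihilates the tangent directions, and annihilator_is_g_poly
    applies. *)
Lemma nondegenerate_pair_normal_form (f g : binform L n) : zclosure iota (param_pair lam) f g ->
  ~ degenerate_pair f g ->
  exists c r h, [/\ c != 0, injective r, small_jets h,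
    dehom (val f) = c *: root_poly r /\ dehom (val g) = g_poly n r (fun=> 1) h
    & forall i, part lam i != 1%N -> h i != 0].
Proof.
move=> cl nZ; have lead : (dehom (val f))`_n != 0 by apply/eqP => e; apply: nZ; left.
have [c [r [c0 ef h2 h3 _]]] := closure_root_conditions cl lead.
have : nondegeneracy r (dehom (val g)) != 0.
  by apply/eqP => T0; apply: nZ; right; exists c, r; split.
rewrite mulf_eq0 negb_or => /andP[/prodf_neq0 hr /prodf_neq0 hT].
have inj : injective r.
  move=> i j e; apply/eqP/negPn/negP => ij.
  have /prodf_neq0/(_ j) := hr i isT; rewrite eq_sym ij => /(_ isT).
  by rewrite e subrr eqxx.
have [h sh eg] := annihilator_is_g_poly lamP charL inj (size_dehom (dhomog_is_dhomog g)) h2 h3.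
exists c, r, h; split=> // i i1.
by apply: (top_jet_neq0 lamP charL (r := r) sh i1); rewrite -eg; exact: hT.
Qed.

Lemma zclosure_self (W : binform L n -> binform L n -> Prop) (f g : binform L n) :
  f != 0 -> g != 0 -> W f g -> zclosure iota W f g.
Proof. by move=> f0 g0 w; split=> // F _; apply. Qed.

Lemma nondegeneracy_perm r q (tau : 'S_d) : (forall i, part lam (tau i) = part lam i) ->
  nondegeneracy r q != 0 -> nondegeneracy (fun i => r (tau i)) q != 0.
Proof.
move=> htau; rewrite /nondegeneracy mulf_eq0 negb_or => /andP[/prodf_neq0 hr /prodf_neq0 hT].
rewrite mulf_neq0 //; apply/prodf_neq0 => i.
  move=> _; apply/prodf_neq0 => j ji; have /prodf_neq0 := hr (tau i) isT; apply.
  by rewrite (inj_eq perm_inj).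
move=> i1; have := hT (tau i); rewrite htau i1 => /(_ isT).
congr (pair n _ q != 0); rewrite /root_prod (reindex_inj (@perm_inj _ tau)) /=.
apply: eq_bigr => j _; congr (_ ^+ _).
by rewrite /drop_roots htau (inj_eq perm_inj).
Qed.

(** The polynomial f / (X - r_i)^2 of top_jet_neq0 with denominators cleared, so that it
    is regular in the parameters. For a part equal to 1 the truncated exponent is 0;
    top_jets only takes the other parts. *)
Definition f_drop2 (v : param_space L lam) i : {poly L} :=
  \prod_j (root_t v j *: 'X - (root_s v j)%:P) ^+ drop_roots 2 i j.

Lemma pregular_f_drop2 i : pregular (fun v => f_drop2 v i).
Proof.
apply: pregular_prod => j; apply: pregularX; apply: pregularD.
  by apply: pregularZ; [exact: regular_root_t | exact: pregular_cst].
by apply: pregularN; apply: pregularC; exact: regular_root_s.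
Qed.

Lemma f_drop2_chart (v : param_space L lam) i : (forall j, root_t v j != 0) ->
  exists c, f_drop2 v i = c *: root_prod (root_ratio v) (drop_roots 2 i).
Proof.
move=> t0; exists (\prod_j root_t v j ^+ drop_roots 2 i j).
rewrite /root_prod -scaler_prod; apply: eq_bigr => j _.
by rewrite -exprZn scalerBr -[root_t v j *: _%:P]mul_polyC -polyCM mulrCA divff ?mulr1.
Qed.

Definition top_jets (v : param_space L lam) : L :=
  \prod_(i < d | part lam i != 1%N) pair n (f_drop2 v i) (g_point n v).

Lemma regular_top_jets : regular top_jets.
Proof.
apply: regular_prod => i; apply: regular_sum => k; apply: regularM; last exact: regular_cst.
by apply: regularM; [exact: pregular_f_drop2 | exact: pregular_g_poly].
Qed.

Lemma top_jets_ex : exists v, top_jets v != 0.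
Proof.
pose r := fun i : 'I_d => (i : nat)%:R : L.
pose h := fun j : 'I_d => if part lam j == 1%N then 0 else 'X^(part lam j - 2) : {poly L}.
exists (mk_param r (fun=> 1) h); apply/prodf_neq0 => i i1.
rewrite g_point_mk_param; last first.
  move=> j j1; rewrite /h (negbTE j1) size_polyXn.
  by have := part_ge2 lamP j; rewrite j1; lia.
rewrite (_ : f_drop2 _ i = root_prod r (drop_roots 2 i)); last first.
  by apply: eq_bigr => j _; rewrite /root_s /root_t !ffunE /= scale1r.
rewrite (_ : g_poly n r (fun=> 1) h = g_poly n r (fun=> 1) (fun j => 'X^(part lam j - 2))).
  by apply: top_jet_of_monomials => //; exact: (natr_inj_ord iota charK).
by apply: eq_bigr => j j1; rewrite /h (negbTE j1).
Qed.

(** By regular_dense it suffices to treat parameters with finite, distinct roots,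
    nonzero top coefficients and one fixed coefficient of g nonzero. Nondegeneracy must
    hold for every ordering of the roots that represents f; two orderings differ by a
    permutation preserving lambda (root_poly_unique), under which it is invariant. *)
Lemma nondegenerate_dense (f g : binform L n) : zclosure iota (param_pair lam) f g ->
  zclosure iota (fun f g => zclosure iota (param_pair lam) f g /\ ~ degenerate_pair f g) f g.
Proof.
case=> f0 g0 cl; split=> // F bF vF; apply: cl => // {f0 g0}f {}g fg.
have [_ [g0 _]] := fg.
have [v0 [c [c' [st0 c0 c'0 ef eg]]]] := param_pair_elim lamP fg.
rewrite evalPP_bieval_poly ef eg.
have [k0 gk0] : exists k, (g_point n v0)`_k != 0.
  apply: NNPP => N; move/negP: g0; apply; rewrite -dehom_eq0 eg.
  rewrite (_ : g_point n v0 = 0) ?scaler0 //; apply/polyP => k; rewrite coef0.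
  by apply/eqP/negPn/negP => H; apply: N; exists k.
have regF : pregular (@f_point L lam) by exact: pregular_f_poly.
have regG : pregular (@g_point L n lam) by exact: pregular_g_poly.
have reg1 := @regular_chart_good L lam.
have ex1 := chart_good_ex iota lam charK.
have ex12 := regular_neq0_both charL reg1 regular_top_jets ex1 top_jets_ex.
have exG : exists w, (@g_point L n lam w)`_k0 != 0 by exists v0.
have ex := regular_neq0_both charL (regularM reg1 regular_top_jets) (regG k0) ex12 exG.
apply: (@regular_dense _ _ charL (fun v => bieval_poly iota F (c *: f_point v)
  (c' *: g_point n v)) _
  _ (regularM (regularM reg1 regular_top_jets) (regG k0)) ex).
  by apply: regular_bieval_poly; apply: pregularZ => //; exact: regular_cst.
move=> v; rewrite mulf_eq0 negb_or => /andP[].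
rewrite (mulf_eq0 (chart_good v)) negb_or => /andP[gd tv] gk.
have [t0 inj] := chart_goodP gd.
have [a a0 eF] := f_point_chart t0; have [h sh eG] := g_point_chart n t0.
have sF := size_scaled c (size_f_point lamP v); have sG := size_scaled c' (size_g_point lamP v).
have := vF (form_of n (c *: f_point v)) (form_of n (c' *: g_point n v)).
rewrite evalPP_bieval_poly !dehom_form_of //; apply.
have gv0 : form_of n (c' *: g_point n v) != 0.
  rewrite -dehom_eq0 dehom_form_of // scaler_eq0 (negbTE c'0) /=.
  by apply: contraNneq gk => ->; rewrite coef0.
have fv0 : form_of n (c *: f_point v) != 0.
  by rewrite -dehom_eq0 dehom_form_of // scaler_eq0 (negbTE c0) f_point_neq0.
split.
  apply: zclosure_self => //.
  apply: (param_pair_intro lamP (c := c) (c' := c') (s := root_s v) (t := root_t v)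
    (h := jet_form v)) => //.
  - by move=> i; rewrite t0 orbT.
  - exact: small_jet_form.
  - by rewrite dehom_form_of.
  by rewrite dehom_form_of.
rewrite /degenerate_pair !dehom_form_of //.
case=> [|[b [r1 [b0 e1 _ _ /(_ isT) T0]]]].
  rewrite coefZ f_point_lead => /eqP; rewrite mulf_eq0 (negbTE c0) /= => /prodf_eq0[i _].
  by rewrite expf_eq0 (negbTE (t0 i)) andbF.
have eqr : root_poly r1 = root_poly (root_ratio v).
  have m1 : root_poly r1 \is monic by exact: root_prod_monic.
  have m2 : root_poly (root_ratio v) \is monic by exact: root_prod_monic.
  move: e1; rewrite eF scalerA => e1.
  have := congr1 lead_coef e1; rewrite !lead_coefZ (monicP m1) (monicP m2) !mulr1 => ca.
  by apply: (scalerI b0); rewrite -e1 ca.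
have [tau [et ht]] := root_poly_unique inj eqr.
have : nondegeneracy (root_ratio v) (c' *: g_point n v) != 0.
  rewrite mulf_neq0 //.
    apply/prodf_neq0 => i _; apply/prodf_neq0 => j ji; rewrite subr_eq0.
    by apply: contra ji => /eqP/inj ->.
  apply/prodf_neq0 => i i1; have /prodf_neq0/(_ i i1) := tv.
  have [w ->] := f_drop2_chart i t0.
  by rewrite pairZl pairZr !mulf_eq0 !negb_or c'0 => /andP[_ ->].
move=> /(nondegeneracy_perm ht); rewrite -(eq_nondegeneracy _ et) T0 eqxx //.
Qed.

End ClosedConditions.

(** * Permutations preserving a function *)

Section PreservingPermutations.

Variables (T : finType) (f : T -> nat).

(** The bound b fixes the points of large value, which allows an induction on the values
    of f. *)
Definition preserving b := [set t : {perm T} |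
  [forall x, (f (t x) == f x) && ((b <= f x) ==> (t x == x))]]%N.

Lemma preservingP b (t : {perm T}) : reflect
  ((forall x, f (t x) = f x) /\ forall x, (b <= f x)%N -> t x = x) (t \in preserving b).
Proof.
rewrite inE; apply: (iffP forallP) => [h|[h1 h2] x].
  by split=> x; have /andP[/eqP h1 /implyP h2] := h x => // /h2/eqP.
by rewrite h1 eqxx; apply/implyP => /h2/eqP.
Qed.

(** A permutation preserving f is uniquely the product of one that fixes the points of
    value b and of a permutation of these points. *)
Lemma card_preserving b :
  #|preserving b| = (\prod_(j < b) #|[set x | f x == j]|`!)%N.
Proof.
elim: b => [|b IH].
  rewrite big_ord0 -(cards1 (1%g : {perm T})); apply: eq_card => t; rewrite inE.
  apply/preservingP/eqP => [[_ h]|->].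
    by apply/permP => x; rewrite perm1 h.
  by split=> x; rewrite perm1.
rewrite big_ord_recr /= -IH -card_perm.
pose A := [set x | f x == b].
pose mul (st : {perm T} * {perm T}) := (st.1 * st.2)%g.
have memA (t : {perm T}) x : perm_on A t -> f x != b -> t x = x.
  by move=> tA fx; apply: (out_perm tA); rewrite inE.
have stA (t : {perm T}) x : perm_on A t -> f (t x) = f x.
  move=> tA; have [e|ne] := eqVneq (f x) b; last by rewrite (memA t).
  by have := perm_closed x tA; rewrite !inE e eqxx => /eqP.
have PA t : (t \in [set t | perm_on A t]) = perm_on A t by rewrite inE.
rewrite -[X in (_ * X)%N](cardsE (perm_on A)) -cardsX.
rewrite -(card_in_imset (f := mul) (D := setX (preserving b) [set t | perm_on A t])); last first.
  move=> [s t] [s' t']; rewrite !inE /= => /andP[sb tA] /andP[sb' tA'] e.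
  have /preservingP[s1 s2] : s \in preserving b by rewrite inE.
  have /preservingP[s1' s2'] : s' \in preserving b by rewrite inE.
  have ev x : t (s x) = t' (s' x) by rewrite -!permM; congr (fun_of_perm _ x).
  have es : s = s'.
    apply/permP => x; case: (ltnP (f x) b) => fx; last by rewrite s2 ?s2'.
    have nb : f x != b by rewrite ltn_eqF.
    by have := ev x; rewrite (memA t) ?s1 // (memA t') ?s1'.
  rewrite -es in ev *; congr (_, _); apply/permP => x.
  by have := ev (s^-1 x)%g; rewrite permKV.
apply: eq_card => p; apply/preservingP/imsetP => [[p1 p2]|[[s t]]].
  pose sf x := if (f x < b)%N then p x else x.
  pose tf x := if f x == b then p x else x.
  have sinj : injective sf.
    move=> x y; rewrite /sf; case: ifP => fx; case: ifP => fy // e.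
    - exact: perm_inj e.
    - by rewrite -e p1 fx in fy.
    by rewrite e p1 fy in fx.
  have tinj : injective tf.
    move=> x y; rewrite /tf; case: ifP => fx; case: ifP => fy // e.
    - exact: perm_inj e.
    - by rewrite -e p1 fx in fy.
    by rewrite e p1 fy in fx.
  exists (perm sinj, perm tinj).
    rewrite in_setX /=; apply/andP; split.
      apply/preservingP; split=> x; rewrite permE /sf; first by case: ifP.
      by rewrite ltnNge => ->.
    rewrite inE; apply/subsetP => x; rewrite !inE permE /tf; case: ifP => //.
    by rewrite eqxx.
  apply/permP => x; rewrite permM !permE /sf /tf; case: ltngtP => fx.
  - by rewrite p1 ltn_eqF.
  - by rewrite gtn_eqF // p2.
  by rewrite fx eqxx.
rewrite in_setX /= PA => /andP[/preservingP[s1 s2] tA] ->.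
split=> x; rewrite permM; first by rewrite stA.
by move=> fx; rewrite s2 ?memA //; [rewrite gtn_eqF | exact: ltnW].
Qed.

End PreservingPermutations.

(** The points of value j are the indices of the parts equal to j; no part is 0, which
    removes the factor of index 0. *)
Lemma card_part_stabilizer n (lam : seq nat) : is_partition n lam ->
  #|[set t : 'S_(size lam) | [forall i, part lam (t i) == part lam i]]|
  = (\prod_(1 <= j < (head 0%N lam).+1) (count_mem j lam)`!)%N.
Proof.
case/and3P => srt /allP pos _; set B := (head 0%N lam).+1.
have bnd (i : 'I_(size lam)) : (part lam i < B)%N.
  rewrite /B ltnS; have : part lam i \in lam by rewrite mem_nth.
  move: (part lam i) => k; case: lam srt {pos B i} => [|a s] //= srt;
    rewrite inE => /orP[/eqP-> //|].
  move: (order_path_min (fun x y z h1 h2 => leq_trans h2 h1) srt) => /allP h /h.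
  by [].
have -> : [set t : 'S_(size lam) | [forall i, part lam (t i) == part lam i]]
    = preserving (fun i : 'I_(size lam) => part lam i) B.
  apply/setP => t; rewrite inE; apply/forallP/preservingP => [h|[h _] x]; last exact/eqP.
  by split=> x; [exact/eqP | rewrite leqNgt bnd].
rewrite card_preserving -(big_mkord xpredT (fun j =>
  #|[set x : 'I_(size lam) | part lam x == j]|`!)).
have cnt j : #|[set x : 'I_(size lam) | part lam x == j]| = count_mem j lam.
  have e : lam = [seq part lam (val i) | i <- enum 'I_(size lam)].
    transitivity [seq part lam k | k <- [seq val i | i <- enum 'I_(size lam)]].
      by rewrite val_enum_ord map_nth_iota0 // take_size.
    by rewrite -map_comp.
  by rewrite [in RHS]e count_map cardsE cardE size_filter enumT.
rewrite big_ltn // cnt (count_memPn _) ?fact0 ?mul1n.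
  by apply: eq_big_nat => j _; rewrite cnt.
by apply/negP => /pos.
Qed.

(** * The rational map and its fibres *)

Section Source.

Variables (K : fieldType) (L : closedFieldType) (iota : {rmorphism K -> L}).
Variables (n : nat) (lam : seq nat).
Hypothesis lamP : is_partition n lam.
Hypothesis charK : [pchar K] =i pred0.
Local Notation d := (size lam).
Local Notation unit_parts := {i : 'I_d | part lam i == 1%N}.
Local Notation big_parts := {j : 'I_d | (2 <= part lam j)%N}.
Implicit Types (i : 'I_d) (r s t : 'I_d -> L) (h : 'I_d -> {poly L}).
Implicit Types (x y : join_vector L lam) (u : unit_parts) (b : big_parts).

Let charL : [pchar L] =i pred0 := pchar_codomain0 iota charK.

Lemma part_cases i : (exists u, val u = i) \/ (exists b, val b = i).
Proof.
have [e|ne] := eqVneq (part lam i) 1%N.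
  by left; exists (exist _ i (introT eqP e)).
by right; rewrite (part_ge2 lamP) in ne; exists (exist _ i ne).
Qed.

Lemma big_neq1 b : part lam (val b) != 1%N.
Proof. by have := valP b; rewrite -(part_ge2 lamP). Qed.

Lemma eq_g_poly_big s s' t t' h h' :
  (forall b, [/\ s (val b) = s' (val b), t (val b) = t' (val b) & h (val b) = h' (val b)]) ->
  g_poly n s t h = g_poly n s' t' h'.
Proof.
move=> e; apply: eq_bigr => i; rewrite (part_ge2 lamP) => i2.
by have [/= -> -> ->] := e (exist _ i i2).
Qed.

(** The defining equations of param_map in dehomogenized form, with functions on the
    index set instead of dependent families of forms. *)
Definition param_data x (f g : binform L n) s t h := [/\
  forall u, lin_part x u = (s (val u), t (val u)),
  forall b, [/\ t (val b) = 1, h (val b) != 0,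
    dehom (val (join_part x b).1) = s (val b) *: h (val b)
    & dehom (val (join_part x b).2) = h (val b)],
  (exists2 c, c != 0 & dehom (val f) = c *: f_poly s t)
  & (exists2 c, c != 0 & dehom (val g) = c *: g_poly n s t h)].

Lemma param_data_size x f g s t h b : param_data x f g s t h ->
  (size (h (val b)) <= part lam (val b) - 1)%N.
Proof.
case=> _ /(_ b)[_ _ _ <-] _ _.
apply: leq_trans (size_dehom (dhomog_is_dhomog _)) _.
by have := valP b; lia.
Qed.

Lemma param_mapP x f g : param_map x f g <->
  [/\ f != 0, g != 0 & exists s t h, param_data x f g s t h].
Proof.
split=> [[f0 [g0 [p [h [hu hb /(projeq_dehom _ (f_param_homog lamP _)) ef
    /(projeq_dehom _ (g_param_homog lamP _ _)) eg]]]]]|[f0 g0 [s [t [h D]]]]].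
  split=> //; exists (fun i => (p i).1), (fun i => (p i).2), (fun i => dehom (val (h i))).
  split.
  - by move=> u; rewrite hu; case: (p _).
  - move=> b; have [e1 h0 ->] := hb b; rewrite /= e1 scale1r dehomZ.
    by split=> //; rewrite dehom_eq0.
  - by case: ef => c c0 e; exists c => //; rewrite e dehom_f_param.
  by case: eg => c c0 e; exists c => //; rewrite e dehom_g_param.
have [D1 D2 D3 D4] := D.
pose p i : L^o * L^o := (s i, t i).
pose h' (k : nat) := form_of (part lam k - 2) (if insub k is Some i then h i else 0).
have eh b : dehom (val (h' (val b))) = h (val b).
  rewrite /h' valK dehom_form_of // (leq_trans (param_data_size b D)) //.
  by have := valP b; lia.
split=> //; split=> //; exists p, h'; split.
- by move=> u; rewrite D1.
- move=> b; have [e1 h0 e2 e3] := D2 b; split=> //.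
    by rewrite -dehom_eq0 eh.
  case: (join_part x b) e2 e3 => j1 j2 /= e2 e3.
  have -> : j1 = s (val b) *: h' (val b) by apply: dehom_form_inj; rewrite e2 /= dehomZ eh.
  have -> // : j2 = t (val b) *: h' (val b).
  by apply: dehom_form_inj; rewrite e3 /= dehomZ eh e1 scale1r.
- apply/(projeq_dehom _ (f_param_homog lamP _)); rewrite dehom_f_param; exact: D3.
apply/(projeq_dehom _ (g_param_homog lamP _ _)); rewrite dehom_g_param.
rewrite (_ : g_poly _ _ _ _ = g_poly n s t h); first exact: D4.
by apply: eq_g_poly_big => b; rewrite eh.
Qed.

Lemma f_poly_rescale s s' t t' (w : 'I_d -> L) :
  (forall i, s i = w i * s' i /\ t i = w i * t' i) ->
  f_poly s t = (\prod_i w i ^+ part lam i) *: f_poly s' t'.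
Proof.
move=> e; rewrite /f_poly -scaler_prod; apply: eq_bigr => i _; have [-> ->] := e i.
by rewrite -exprZn scalerBr scalerA -[w i *: _%:P]mul_polyC -polyCM.
Qed.

Lemma g_poly_rescale s t h c : g_poly n s t (fun i => c *: h i) = c *: g_poly n s t h.
Proof. by rewrite /g_poly scaler_sumr; apply: eq_bigr => i _; rewrite scalerAr. Qed.

Lemma projeq_scale (f f' : binform L n) p c c' : c != 0 -> c' != 0 ->
  dehom (val f) = c *: p -> dehom (val f') = c' *: p -> projeq f' f.
Proof.
move=> c0 c'0 e e'; exists (c' / c); first by rewrite mulf_neq0 ?invr_eq0.
by apply: dehom_form_inj; rewrite /= dehomZ e e' scalerA divfK.
Qed.

(** On the unit parts, the new representative rescales f only, since these parts do not
    enter g; on the other parts, (s : t) is normalized by t = 1, so the common scalar c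
    is absorbed by the h_i and rescales g. *)
Lemma source_eq_data x y f g s t h : source_eq x y -> param_data x f g s t h ->
  exists s' t' h', (forall f' g', projeq f' f -> projeq g' g -> param_data y f' g' s' t' h').
Proof.
case=> hu [c c0 hb] [D1 D2 [a a0 ef] [a' a'0 eg]].
pose p i : L * L := if insub i is Some u then (lin_part y u : L * L) else (s i, 1).
exists (fun i => (p i).1), (fun i => (p i).2), (fun i => c^-1 *: h i).
have pu u : p (val u) = lin_part y u by rewrite /p valK.
have pb b : p (val b) = (s (val b), 1).
  by rewrite /p insubF //; apply/negbTE; exact: big_neq1.
have ex i : exists w : L, w != 0 /\ (s i = w * (p i).1 /\ t i = w * (p i).2).
  have [[u <-]|[b <-]] := part_cases i.
    have [w w0 ew] := hu u; exists w; split=> //.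
    by move: ew; rewrite D1 pu => -[-> ->].
  have [tb _ _ _] := D2 b; exists 1; rewrite oner_neq0 pb tb !mul1r.
  by split.
have [w hw] := fin_all_exists ex.
have eF := f_poly_rescale (fun i => (hw i).2).
move=> f' g' [q q0 ->] [q' q'0 ->]; split.
- by move=> u; rewrite pu; case: (lin_part y u).
- move=> b; have [tb h0 e1 e2] := D2 b; rewrite pb /=; split=> //.
  + by rewrite scaler_eq0 negb_or invr_eq0 c0.
  + by have := hb b; move: e1 => /[swap] ->; rewrite /= dehomZ => e1;
      rewrite scalerA mulrC -scalerA -e1 scalerA mulVf // scale1r.
  by have := hb b; move: e2 => /[swap] ->; rewrite /= dehomZ => <-;
     rewrite scalerA mulVf // scale1r.
- exists (q * (a * \prod_i w i ^+ part lam i)); last by rewrite dehomZ ef eF !scalerA mulrA.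
  rewrite !mulf_neq0 //; apply/prodf_neq0 => i _; rewrite expf_neq0 //.
  by have [] := hw i.
exists (q' * (a' * c)); first by rewrite !mulf_neq0.
rewrite g_poly_rescale dehomZ eg !scalerA -!mulrA mulfV // mulr1; congr (_ *: _).
apply: eq_g_poly_big => b; have [tb _ _ _] := D2 b.
by rewrite pb.
Qed.

Lemma projeq_refl (f : binform L n) : projeq f f.
Proof. by exists 1; rewrite ?oner_neq0 ?scale1r. Qed.

Lemma projeq_neq0 (f f' : binform L n) : projeq f' f -> f != 0 -> f' != 0.
Proof. by case=> c c0 -> f0; rewrite scaler_eq0 negb_or c0. Qed.

(** The normalization t = 1 makes the Segre vector (s h, h) determine s and h. *)
Lemma param_data_unique x f g f' g' s t h s' t' h' :
  param_data x f g s t h -> param_data x f' g' s' t' h' -> projeq f' f /\ projeq g' g.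
Proof.
case=> D1 D2 [a a0 ef] [b b0 eg] [D1' D2' [a' a'0 ef'] [b' b'0 eg']].
have [st h_eq] : (forall i, s i = s' i /\ t i = t' i) /\
    (forall b : big_parts, h (val b) = h' (val b)).
  have heq (c : big_parts) : h (val c) = h' (val c).
    by have [_ _ _ <-] := D2 c; have [_ _ _ <-] := D2' c.
  split=> // i; have [[u <-]|[c <-]] := part_cases i.
    by have := D1 u; rewrite D1' => -[-> ->].
  have [t1 h0 e _] := D2 c; have [t1' _ e' _] := D2' c; rewrite t1 t1'; split=> //.
  move: e; rewrite e' -heq => /eqP; rewrite -subr_eq0 -scalerBl scaler_eq0 (negbTE h0) orbF.
  by rewrite subr_eq0 => /eqP.
split.
  apply: (projeq_scale a0 a'0 ef); rewrite ef'; congr (_ *: _).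
  by apply: eq_bigr => i _; have [-> ->] := st i.
apply: (projeq_scale b0 b'0 eg); rewrite eg'; congr (_ *: _).
by apply: eq_g_poly_big => c; have [-> ->] := st (val c).
Qed.

Lemma param_map_source_eq x y (f g : binform L n) : source_eq x y -> param_map x f g ->
  forall f' g', param_map y f' g' <-> projeq f' f /\ projeq g' g.
Proof.
move=> xy /param_mapP[f0 g0 [s [t [h D]]]] f' g'.
have [s' [t' [h' D']]] := source_eq_data xy D.
split=> [/param_mapP[f'0 g'0 [s2 [t2 [h2 D2]]]]|[ff gg]].
  exact: param_data_unique (D' f g (projeq_refl f) (projeq_refl g)) D2.
apply/param_mapP; split; [exact: projeq_neq0 ff f0 | exact: projeq_neq0 gg g0 |].
by exists s', t', h'; exact: D'.
Qed.

Section Fibre.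

Variables (f g : binform L n) (c : L) (r : 'I_d -> L) (h : 'I_d -> {poly L}).
Hypotheses (c0 : c != 0) (inj : injective r) (sh : small_jets h) (g0 : g != 0).
Hypotheses (ef : dehom (val f) = c *: root_poly r) (eg : dehom (val g) = g_poly n r (fun=> 1) h).
Hypothesis h0 : forall i, part lam i != 1%N -> h i != 0.

Definition preimage (tau : 'S_d) : join_vector L lam := JoinVector
  (fun u => (r (tau (val u)), 1) : L^o * L^o)
  (fun b => let H := form_of (part lam (val b) - 2) (h (tau (val b))) in
            (r (tau (val b)) *: H, H)).

Definition stabilizes (tau : 'S_d) := [forall i : 'I_d, part lam (tau i) == part lam i].

Lemma stabilizesP tau : stabilizes tau -> forall i, part lam (tau i) = part lam i.
Proof. by move=> /forallP e i; exact/eqP. Qed.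

Lemma dehom_preimage tau b : stabilizes tau ->
  dehom (val (form_of (part lam (val b) - 2) (h (tau (val b))))) = h (tau (val b)).
Proof.
move=> /stabilizesP e; rewrite dehom_form_of // (leq_trans (sh _)) // e.
by have := valP b; lia.
Qed.

Lemma preimage_neq0 tau b : stabilizes tau ->
  form_of (part lam (val b) - 2) (h (tau (val b))) != 0.
Proof.
move=> st; rewrite -dehom_eq0 dehom_preimage // h0 //.
by rewrite (stabilizesP st) big_neq1.
Qed.

Lemma big_part_exists : exists b, True.
Proof.
apply: NNPP => N; move/negP: g0; apply; rewrite -dehom_eq0 eg /g_poly big1 // => i.
by rewrite (part_ge2 lamP) => i2; case: N; exists (exist _ i i2).
Qed.

Lemma root_poly_perm tau : stabilizes tau -> root_poly (fun i => r (tau i)) = root_poly r.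
Proof.
move=> /stabilizesP e; rewrite [in RHS]/root_poly /root_prod (reindex_inj (@perm_inj _ tau)) /=.
by apply: eq_bigr => i _; rewrite e.
Qed.

Lemma g_poly_perm tau : stabilizes tau ->
  g_poly n (fun i => r (tau i)) (fun=> 1) (fun i => h (tau i)) = g_poly n r (fun=> 1) h.
Proof.
move=> /stabilizesP e; rewrite [in RHS]/g_poly (reindex_inj (@perm_inj _ tau)) /=.
by apply: eq_big => [i|i _]; rewrite e.
Qed.

Lemma preimage_in_source tau : stabilizes tau -> in_source (preimage tau).
Proof.
move=> st; split=> [u|b|].
- by rewrite pair_neq0 /= oner_neq0 orbT.
- exists (r (tau (val b)), 1), (form_of _ (h (tau (val b)))).
  by rewrite /= scale1r.
have [b _] := big_part_exists; exists b; apply: contra (preimage_neq0 b st).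
by move=> /eqP e; have := congr1 (fun w => w.2) e => /= ->.
Qed.

Lemma preimage_maps tau : stabilizes tau -> param_map (preimage tau) f g.
Proof.
move=> st; apply/param_mapP; split=> //.
  by rewrite -dehom_eq0 ef scaler_eq0 (negbTE c0) monic_neq0 ?root_prod_monic.
exists (fun i => r (tau i)), (fun=> 1), (fun i => h (tau i)); split=> //.
- move=> b; split=> //.
  + by rewrite h0 // (stabilizesP st) big_neq1.
  + by rewrite /= dehomZ dehom_preimage.
  by rewrite /= dehom_preimage.
- by exists c => //; rewrite f_poly_monic -/(root_poly _) root_poly_perm.
by exists 1; rewrite ?oner_neq0 // scale1r g_poly_perm.
Qed.

Lemma preimage_inj tau tau' : stabilizes tau -> stabilizes tau' ->
  source_eq (preimage tau) (preimage tau') -> tau = tau'.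
Proof.
move=> st st' [hu [a a0 hb]]; apply/permP => i; apply: inj.
have [[u <-]|[b <-]] := part_cases i.
  have [w w0 /= [-> e]] := hu u.
  by rewrite (_ : w = 1) ?scale1r //; exact: etrans (esym (mulr1 w)) (esym e).
have nz := preimage_neq0 b st'; move: nz (congr1 fst (hb b)) (congr1 snd (hb b)) => /=.
move: (form_of _ (h (tau (val b)))) (form_of _ (h (tau' (val b)))) => H H' H'0 e1 e2.
move: e1; rewrite e2 !scalerA => /eqP.
rewrite -subr_eq0 -scalerBl scaler_eq0 (negbTE H'0) orbF.
by rewrite mulrC -mulrBr mulf_eq0 (negbTE a0) subr_eq0 => /eqP.
Qed.

(** Equality of the two factorizations of f gives tau (root_poly_unique), and then
    equality of the two expressions of g gives the forms h_i, by g_poly_inj applied to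
    their difference. *)
Lemma preimage_onto x : in_source x -> param_map x f g ->
  exists2 tau, stabilizes tau & source_eq x (preimage tau).
Proof.
move=> xs /param_mapP[f0 _ [s [t [k D]]]]; have [D1 D2 [a a0 ef'] [b b0 eg']] := D.
have t0 i : t i != 0.
  have := @chart_of_lead K L iota n lam lamP charK (mk_param s t k).
  rewrite f_point_mk_param => H; have := H _ i; rewrite /root_t ffunE /=; apply.
  have := congr1 (fun p : {poly L} => p`_n) (etrans (esym ef') ef).
  have m : root_poly r \is monic by exact: root_prod_monic.
  move: (monicP m); rewrite lead_coefE (size_root_poly lamP) !coefZ => -> e.
  by apply: contraNneq c0 => e0; rewrite -[c]mulr1 -e e0 mulr0.
have [A A0 eA] : exists2 A, A != 0 & f_poly s t = A *: root_poly (fun i => s i / t i).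
  exists (\prod_i t i ^+ part lam i); last exact: f_poly_chart.
  by apply/prodf_neq0 => i _; rewrite expf_neq0.
have eqr : root_poly (fun i => s i / t i) = root_poly r.
  have m : root_poly r \is monic by exact: root_prod_monic.
  have m' : root_poly (fun i => s i / t i) \is monic by exact: root_prod_monic.
  move: ef'; rewrite ef eA scalerA => e.
  have := congr1 lead_coef e; rewrite !lead_coefZ (monicP m) (monicP m') !mulr1 => ca.
  by apply: (scalerI c0); rewrite e -ca.
have [tau [et ht]] := root_poly_unique lamP inj eqr.
have st : stabilizes tau by apply/forallP => i; rewrite ht.
exists tau => //.
pose rt i := r (tau i).
have rt_inj : injective rt by move=> i j /inj/perm_inj.
pose k' i := if part lam i == 1%N then 0 else b *: (t i ^+ (n - part lam i + 2) *: k i) - h (tau i).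
have sk' : small_jets k'.
  move=> i; rewrite /k'; case: ifP => [_|/negbT i1]; first by rewrite size_poly0.
  rewrite (part_ge2 lamP) in i1; have sk := param_data_size (exist _ i i1) D.
  have shi : (size (h (tau i)) <= part lam i - 1)%N by rewrite -(ht i); exact: sh.
  rewrite (leq_trans (size_polyD _ _)) // size_polyN geq_max shi andbT.
  by do 2! rewrite (leq_trans (size_scale_leq _ _)) //.
have k'0 : g_poly n rt (fun=> 1) k' = 0.
  have -> : g_poly n rt (fun=> 1) k' = b *: g_poly n s t k
    - g_poly n rt (fun=> 1) (fun i => h (tau i)).
    rewrite (g_poly_chart _ _ _ t0) -g_poly_rescale /g_poly -sumrB; apply: eq_bigr => i i1.
    by rewrite /k' (negbTE i1) mulrBr et.
  by rewrite -eg' eg g_poly_perm // subrr.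
have hk (i2 : big_parts) : b *: k (val i2) = h (tau (val i2)).
  have [t1 _ _ _] := D2 i2.
  have := g_poly_inj lamP charL rt_inj sk' k'0 (big_neq1 i2).
  by rewrite /k' (negbTE (big_neq1 i2)) t1 expr1n scale1r => /eqP; rewrite subr_eq0 => /eqP.
split=> [u|].
  exists (t (val u)) => //; rewrite D1 /= -et.
  congr (_, _); first by rewrite [RHS]mulrC divfK.
  by rewrite [RHS]mulr1.
exists b^-1; rewrite ?invr_eq0 // => i2; have [t1 _ e1 e2] := D2 i2.
case: (join_part x i2) e1 e2 => j1 j2 /= e1 e2.
have kb : k (val i2) = b^-1 *: h (tau (val i2)) by rewrite -hk scalerA mulVf // scale1r.
have -> : j2 = b^-1 *: form_of (part lam (val i2) - 2) (h (tau (val i2))).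
  by apply: dehom_form_inj; rewrite e2 /= dehomZ dehom_preimage.
have -> // : j1 = b^-1 *: (r (tau (val i2)) *: form_of (part lam (val i2) - 2) (h (tau (val i2)))).
apply: dehom_form_inj; rewrite e1 /= !dehomZ dehom_preimage // kb -et t1 divr1.
by rewrite !scalerA mulrC.
Qed.

Lemma fibre_stabilizer : fibre_card (@param_map L n lam) f g #|[set tau | stabilizes tau]|.
Proof.
pose xs (k : 'I_#|[set tau | stabilizes tau]|) := preimage (enum_val k).
have sx k : stabilizes (enum_val (A := [set tau | stabilizes tau]) k).
  by have := enum_valP k; rewrite inE.
exists xs; split=> [k|k l e|x ix px].
- by split; [exact: preimage_in_source | exact: preimage_maps].
- exact: enum_val_inj (preimage_inj (sx k) (sx l) e).
have [tau st e] := preimage_onto ix px.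
have ts : tau \in [set tau | stabilizes tau] by rewrite inE.
by exists (enum_rank_in ts tau); rewrite /xs enum_rankK_in.
Qed.

End Fibre.

End Source.

(** * The rational map is densely defined *)

Section SourceDensity.

Variables (K : fieldType) (L : closedFieldType) (iota : {rmorphism K -> L}).
Variables (n : nat) (lam : seq nat).
Hypothesis lamP : is_partition n lam.
Hypothesis charK : [pchar K] =i pred0.
Local Notation d := (size lam).
Local Notation unit_parts := {i : 'I_d | part lam i == 1%N}.
Local Notation big_parts := {j : 'I_d | (2 <= part lam j)%N}.
Implicit Types (i : 'I_d) (x : join_vector L lam) (u : unit_parts) (b : big_parts).

Let charL : [pchar L] =i pred0 := pchar_codomain0 iota charK.

Definition source_of (v : param_space L lam) : join_vector L lam := JoinVector
  (fun u => (root_s v (val u), root_t v (val u)) : L^o * L^o)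
  (fun b => let H := form_of (part lam (val b) - 2) (jet_form v (val b)) in
            (root_s v (val b) *: H, root_t v (val b) *: H)).

Lemma dehom_jet_form (v : param_space L lam) b :
  dehom (val (form_of (part lam (val b) - 2) (jet_form v (val b)))) = jet_form v (val b).
Proof.
rewrite dehom_form_of // (leq_trans (small_jet_form v _)) //.
by have := valP b; lia.
Qed.

(** The point of the source is recovered from linear parameters up to equality of
    coordinates, so that density arguments can be carried out in a vector space. *)
Lemma in_source_of x : in_source x ->
  exists v, source_coord (n := n) x =1 source_coord (n := n) (source_of v).
Proof.
case=> _ hb _.
have ex b : exists ah : (L^o * L^o) * binform L (part lam (val b) - 2),
    join_part x b = (ah.1.1 *: ah.2, ah.1.2 *: ah.2).
  by have [a [h e]] := hb b; exists (a, h).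
have [ah hah] := fin_all_exists ex.
pose v : param_space L lam := [ffun i =>
  if insub i is Some b then ((ah b).1, dehom (val (ah b).2))
  else if insub i is Some u then (lin_part x u, 0) else 0].
have vb b : v (val b) = ((ah b).1, dehom (val (ah b).2)) by rewrite ffunE valK.
have vu u : v (val u) = (lin_part x u, 0).
  rewrite ffunE insubF; first by rewrite valK.
  by apply/negbTE; rewrite -(part_ge2 lamP) negbK; exact: (valP u).
exists v => k; rewrite /source_coord; case: (enum_val k) => [[u w]|[[b w] l]].
  by rewrite /= /root_s /root_t vu; case: (lin_part x u).
have eH : form_of (part lam (val b) - 2) (jet_form v (val b)) = (ah b).2.
  apply: dehom_form_inj; rewrite dehom_jet_form /jet_form vb /= take_poly_id //.
  apply: leq_trans (size_dehom (dhomog_is_dhomog (ah b).2)) _.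
  by have := valP b; rewrite /=; lia.
by rewrite hah /= eH /root_s /root_t vb.
Qed.

Lemma regular_source_coord k : regular (fun v => source_coord (n := n) (source_of v) k).
Proof.
rewrite /source_coord; case: (enum_val k) => [[u []]|[[b w] l]].
- exact: regular_root_t.
- exact: regular_root_s.
case: (l <= part lam (val b) - 2)%N; last exact: regular_cst.
set m := inord _.
apply: (@eq_regular _ _ (fun v => (if w then root_t v (val b) else root_s v (val b))
    * (jet_form v (val b))`_(part lam (val b) - 2 - m))).
  by move=> v; case: w; rewrite /= form_coordZ form_coordE dehom_jet_form.
apply: regularM; last exact: pregular_jet_form.
by case: w; [exact: regular_root_t | exact: regular_root_s].
Qed.

(** Finite, distinct roots and nonzero h_i, ensured by their constant coefficients:
    enough for the map to be defined, by injectivity of g_poly. *)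
Definition source_good (v : param_space L lam) : L :=
  chart_good v * \prod_(i < d | part lam i != 1%N) (jet_form v i)`_0.

Lemma regular_source_good : regular source_good.
Proof.
apply: regularM; first exact: regular_chart_good.
by apply: regular_prod => i; exact: pregular_jet_form.
Qed.

Lemma source_good_ex : exists v, source_good v != 0.
Proof.
exists (mk_param (fun i => (i : nat)%:R) (fun=> 1) (fun=> 1)); rewrite mulf_neq0 //.
  exact: (chart_good_mk_param _ (natr_inj_ord iota charK)).
apply/prodf_neq0 => i i1; rewrite /jet_form ffunE /= coef_take_poly coef1 /=.
rewrite (part_ge2 lamP) in i1; rewrite (_ : (0 < part lam i - 1)%N) ?oner_neq0 //.
by lia.
Qed.

Lemma source_good_defined (v : param_space L lam) b0 : source_good v != 0 ->
  in_source (source_of v) /\ exists f g : binform L n, param_map (source_of v) f g.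
Proof.
rewrite mulf_eq0 negb_or => /andP[gd /prodf_neq0 hv].
have [t0 inj] := chart_goodP gd.
have h0 i : part lam i != 1%N -> jet_form v i != 0.
  by move=> /hv; apply: contraNneq => ->; rewrite coef0.
have H0 b : form_of (part lam (val b) - 2) (jet_form v (val b)) != 0.
  by rewrite -dehom_eq0 dehom_jet_form h0 // (big_neq1 lamP).
split.
  split=> [u|b|].
  - by rewrite pair_neq0 /= t0 orbT.
  - by exists (root_s v (val b), root_t v (val b)), (form_of _ (jet_form v (val b))).
  exists b0; apply: contra (H0 b0) => /eqP/(congr1 snd) /= /eqP.
  by rewrite scaler_eq0 (negbTE (t0 _)).
(* on the unit parts the given representative is kept, on the others t = 1 *)
pose w i : L := if part lam i == 1%N then 1 else (root_t v i)^-1.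
pose s i := w i * root_s v i; pose t i := w i * root_t v i; pose h i := (w i)^-1 *: jet_form v i.
have w0 i : w i != 0 by rewrite /w; case: ifP; rewrite ?oner_neq0 ?invr_eq0.
have wb b : w (val b) = (root_t v (val b))^-1 by rewrite /w (negbTE (big_neq1 lamP b)).
have t'0 i : t i != 0 by rewrite mulf_neq0.
have sh : small_jets h by move=> i; rewrite (leq_trans (size_scale_leq _ _)) // small_jet_form.
have eF : f_poly s t != 0 by apply: f_poly_neq0 => i; rewrite t'0 orbT.
have eG : g_poly n s t h != 0.
  apply/eqP; rewrite (g_poly_chart _ _ _ t'0) => /(g_poly_inj lamP charL) G0.
  have inj' : injective (fun i => s i / t i).
    move=> i j; rewrite /s /t -!mulf_div !divff // !mul1r; exact: inj.
  have sh' : small_jets (fun i => t i ^+ (n - part lam i + 2) *: h i).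
    by move=> i; rewrite (leq_trans (size_scale_leq _ _)) ?sh.
  have := G0 inj' sh' _ (big_neq1 lamP b0) => /eqP.
  rewrite !scaler_eq0 expf_eq0 (negbTE (t'0 _)) andbF invr_eq0 (negbTE (w0 _)) /=.
  by rewrite (negbTE (h0 _ (big_neq1 lamP b0))).
have sF := size_f_poly lamP s t; have sG := size_g_poly lamP s t sh.
exists (form_of n (f_poly s t)), (form_of n (g_poly n s t h)); apply/(param_mapP lamP); split.
- by rewrite -dehom_eq0 dehom_form_of.
- by rewrite -dehom_eq0 dehom_form_of.
exists s, t, h; split.
- by move=> u; rewrite /s /t /w (valP u) !mul1r.
- move=> b; have b1 := big_neq1 lamP b.
  rewrite /s /t /h wb invrK mulVf //=; split=> //.
  + by rewrite scaler_eq0 negb_or t0 h0.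
  + by rewrite dehomZ dehom_jet_form scalerA mulrC mulrA mulfV // mul1r.
  by rewrite dehomZ dehom_jet_form.
- by exists 1; rewrite ?oner_neq0 // scale1r dehom_form_of.
by exists 1; rewrite ?oner_neq0 // scale1r dehom_form_of.
Qed.

Lemma param_map_dense :
  @dense_in_source K L iota n lam (fun x => exists f g : binform L n, param_map x f g).
Proof.
move=> F vF x xs; have [v0 ev] := in_source_of xs.
have [_ _ [b0 _]] := xs.
rewrite (meval_eq _ ev).
pose phi v := (map_mpoly iota F).@[@source_coord L n lam (source_of v)].
rewrite -/(phi v0); apply: (@regular_dense _ _ charL phi _ _ regular_source_good source_good_ex).
  by apply: regular_meval => k; exact: regular_source_coord.
move=> v gd; have [vs ex] := source_good_defined b0 gd.
exact: vF.
Qed.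

End SourceDensity.

Theorem theorem2p5 (K : fieldType) (charK : [pchar K] =i pred0)
    (L : closedFieldType) (iota : {rmorphism K -> L})
    (n : nat) (lam : seq nat) (lamP : is_partition n lam) :
  [/\ forall f g : binform L n,
        Con iota lam f g <-> zclosure iota (param_pair lam) f g,
      rational_map_to iota (@param_map L n lam) (Con iota lam) &
      finite_of_degree iota (@param_map L n lam) (Con iota lam)
        (\prod_(1 <= j < (head 0%N lam).+1) (count_mem j lam)`!)%N].
Proof.
have ConE (f g : binform L n) : Con iota lam f g <-> zclosure iota (param_pair lam) f g.
  by split; [exact: Con_in_param_closure | exact: param_closure_in_Con].
split=> //.
  split.
  - exact: param_map_dense.
  - by move=> x y f g _ _; exact: param_map_source_eq.
  move=> x f g xs xfg; apply/ConE; have [f0 [g0 [p [h [hu hb ef eg]]]]] := xfg.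
  apply: zclosure_self => //; split=> //; split=> //; exists p, h; split=> // i.
  have [[u <-]|[b <-]] := part_cases lamP i.
    by rewrite -hu; case: xs => + _ _; apply.
  by have [e _ _] := hb b; rewrite pair_neq0 e oner_neq0 orbT.
exists (fun f g => zclosure iota (param_pair lam) f g /\ ~ degenerate_pair lam f g).
  split.
    exists (degenerate_pair lam); first exact: degenerate_pair_closed.
    by move=> f g; split=> -[/ConE].
  by move=> f g /ConE; exact: nondegenerate_dense.
move=> f g [cl nZ]; have [_ g0 _] := cl.
have [c [r [h [c0 inj sh [ef eg] h0]]]] := nondegenerate_pair_normal_form lamP charK cl nZ.
rewrite -(card_part_stabilizer lamP).
exact: (fibre_stabilizer iota lamP charK c0 inj sh g0 ef eg h0).
Qed.
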